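(* Let $M=\mathbb{S}^1$ and $n\ge1$. Suppose that for each $1\le j\le n$, either $W_j\in L^\infty(\mathbb{S}^1)$ or $W_j\in X^{\beta_j}_{\theta_j}$ with $\beta_j\in(-1,0)$ and $\theta_j\in\mathbb{S}^1$. Let $W=\sum_{j=1}^nW_j$, and assume $W\ge0$ and $W$ is not almost everywhere zero. Then there exist $C,c>0$ such that for all $t\ge0$ and all initial data $(u_0,u_1)\in H^1(\mathbb{S}^1)\times L^2(\mathbb{S}^1)$ the solution $u$ of $(\partial_t^2-\Delta+W\partial_t)u=0$, $(u,\partial_tu)|_{t=0}=(u_0,u_1)$, satisfies $$E(u,t)\le Ce^{-ct}E(u,0).$$
   Context: $\mathbb{S}^1=\mathbb{R}/2\pi\mathbb{Z}$. Polynomially controlled functions: fix $\theta\in\mathbb{S}^1$ and parametrize $\mathbb{S}^1$ by $x\in[-\pi,\pi)$ (ends identified) so that the point $\theta$ corresponds to $x=0$. $X^\beta_\theta$ is the set of measurable functions $f$ on $\mathbb{S}^1$ for which there are $C_0>0$ and $\sigma\in(0,\pi)$ with $C_0^{-1}V^\beta(x)\le f(x)\le C_0V^\beta(x)$, where $V^\beta(x)=0$ for $|x|\le\sigma$ and $V^\beta(x)=(|x|-\sigma)^\beta$ for $\sigma<|x|\le\pi$. Energy: $E(u,t)=\frac12\int_M|\nabla u|^2+|\partial_tu|^2\,dx$. Solutions are given by the strongly continuous semigroup $e^{t\mathcal{A}}$ on $H^1(M)\times L^2(M)$ generated by $\mathcal{A}(u,v)=(v,\Delta u-Wv)$ with domain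 $\{(u,v)\in H^1(M)\times H^1(M):-\Delta u+Wv\in L^2(M)\}$: $(u(t),\partial_tu(t))=e^{t\mathcal{A}}(u_0,u_1)$. *)

(* Defs.v *)
From mathcomp Require Import all_boot all_order all_algebra.
From mathcomp Require Import all_classical all_reals all_analysis.
From mathcomp Require Import complex.
Set Implicit Arguments.
Unset Strict Implicit.
Unset Printing Implicit Defensive.
Import Order.TTheory GRing.Theory Num.Theory.
Import numFieldNormedType.Exports.
Local Open Scope classical_set_scope.
Local Open Scope complex_scope.
Local Open Scope ring_scope.

(* Functions on the circle R / 2 pi Z are 2 pi-periodic functions on R, a point
   of the circle is given by any real representative, and integrals over the
   circle are integrals over one period.  For 2 pi-periodic functions, "almost
   everywhere on the circle" and "almost everywhere on R" mean the same, and so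
   do the essential suprema over the circle and over R. *)

Section Circle.
Context {R : realType}.
Implicit Types (f g u : R -> R[i]) (W phi : R -> R).

Definition circle : set R := `[- pi, pi[.

Definition on_circle (T : zmodType) (f : R -> T) : Prop := periodic f (pi *+ 2).

Definition abs2 (z : R[i]) : R := complex.Re z ^+ 2 + complex.Im z ^+ 2.

Definition cintegral f : R[i] :=
  (\int[lebesgue_measure]_(x in circle) complex.Re (f x))
  +i* (\int[lebesgue_measure]_(x in circle) complex.Im (f x)).

Definition L2 : set (R -> R[i]) := [set f : R -> R[i] |
  [/\ on_circle f,
      measurable_fun setT (fun x => complex.Re (f x)),
      measurable_fun setT (fun x => complex.Im (f x)) &
      lebesgue_measure.-integrable circle (fun x => (abs2 (f x))%:E)]].

(* Real test functions suffice, all the pairings below being complex linear. *)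
Definition test_function : set (R -> R) := [set phi : R -> R |
  on_circle phi /\ forall k x, derivable (derive1n k phi) x 1].

Definition weak_derivative u g : Prop := forall phi, test_function phi ->
  cintegral (fun x => (derive1 phi x)%:C * u x)
  = - cintegral (fun x => (phi x)%:C * g x).

Definition H1 : set (R -> R[i]) := [set u : R -> R[i] |
  L2 u /\ exists2 g, L2 g & weak_derivative u g].

(* A representative of the weak derivative, meaningful for [u] in [H1]. *)
Definition grad u : R -> R[i] :=
  xget (cst 0) [set g | L2 g /\ weak_derivative u g].

Definition Linfty : set (R -> R) := [set W : R -> R |
  on_circle W /\ W \in Lfun (@lebesgue_measure R) +oo%E].

Definition Vprofile (beta sigma x : R) : R :=
  if `|x| <= sigma then 0 else (`|x| - sigma) `^ beta.

Definition poly_controlled (beta theta : R) : set (R -> R) := [set W : R -> R |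
  [/\ on_circle W, measurable_fun setT W &
      exists C0 sigma : R, [/\ 0 < C0, 0 < sigma < pi &
        {ae lebesgue_measure, forall x, circle x ->
           C0^-1 * Vprofile beta sigma x <= W (theta + x)
           <= C0 * Vprofile beta sigma x}]]].

Definition state : Type := ((R -> R[i]) * (R -> R[i]))%type.

Definition phase_space : set state := [set p | H1 p.1 /\ L2 p.2].

Definition phase_norm (p : state) : R := Num.sqrt
  (\int[lebesgue_measure]_(x in circle) abs2 (p.1 x)
   + \int[lebesgue_measure]_(x in circle) abs2 (grad p.1 x)
   + \int[lebesgue_measure]_(x in circle) abs2 (p.2 x)).

Definition energy (p : state) : R :=
  2^-1 * \int[lebesgue_measure]_(x in circle)
           (abs2 (grad p.1 x) + abs2 (p.2 x)).

(* The graph of A (u, v) = (v, u'' - W v), with u'' - W v taken in the sense of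
   distributions: [damped_wave_op W (u, v) q] says that (u, v) lies in the
   domain of A and that A (u, v) is the class of [q].  In particular q.2 is the
   square-integrable function required by the definition of the domain. *)
Definition damped_wave_op W (p q : state) : Prop :=
  [/\ H1 p.1, H1 p.2,
      {ae lebesgue_measure, forall x, q.1 x = p.2 x},
      L2 q.2 &
      forall phi, test_function phi ->
        cintegral (fun x => (phi x)%:C * q.2 x)
        = cintegral (fun x => (derive1n 2 phi x)%:C * p.1 x)
          - cintegral (fun x => (phi x)%:C * ((W x)%:C * p.2 x))].

End Circle.

(* Strongly continuous semigroups on a linear subspace [X] of [V] endowed with a
   seminorm [N].  The normed space meant is the quotient of [X] by the kernel of
   [N]; operators act on representatives, so identities between elements read
   [N (x - y) = 0].  Linearity and boundedness make each operator well defined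
   on the quotient. *)
Section Semigroup.
Context {R : realType} {V : lmodType R[i]}.
Variables (X : set V) (N : V -> R).

Record C0_semigroup (S : R -> V -> V) : Prop := {
  semigroup_stable : forall t x, 0 <= t -> X x -> X (S t x) ;
  semigroup_linear : forall t (a : R[i]) x y, 0 <= t -> X x -> X y ->
    N (S t (a *: x + y) - (a *: S t x + S t y)) = 0 ;
  semigroup_bounded : forall t, 0 <= t ->
    exists M : R, forall x, X x -> N (S t x) <= M * N x ;
  semigroup_0 : forall x, X x -> N (S 0 x - x) = 0 ;
  semigroup_D : forall s t x, 0 <= s -> 0 <= t -> X x ->
    N (S (s + t) x - S s (S t x)) = 0 ;
  semigroup_cvg0 : forall x, X x ->
    N (S h x - x) @[h --> 0^'+] --> (0 : R) }.

(* [A] is the graph of the infinitesimal generator of [S]. *)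
Definition generates (A : V -> V -> Prop) (S : R -> V -> V) : Prop :=
  C0_semigroup S /\
  forall x y, X x -> X y ->
    (A x y <->
     N ((h^-1)%:C *: (S h x - x) - y) @[h --> 0^'+] --> (0 : R)).

End Semigroup.

(* Main.v *)
Require Import Defs.
From HB Require Import structures.
From mathcomp Require Import all_boot all_order all_algebra.
From mathcomp Require Import all_classical all_reals all_analysis.
From mathcomp Require Import measurable_realfun complex ring lra zify.
Set Implicit Arguments.
Unset Strict Implicit.
Unset Printing Implicit Defensive.
Import Order.TTheory GRing.Theory Num.Theory.
Import numFieldNormedType.Exports.
Local Open Scope classical_set_scope.
Local Open Scope ring_scope.

(** The energy decays because an explicit quadratic functional, equivalent to
    it, decays along the flow.

    The real and imaginary parts of a solution evolve separately, so let [u] be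
    real and put [g = u_x], [v = u_t].  The energy loses [I], the integral of
    [W v^2], and nothing else; the difficulty is to bound [g^2 + v^2] in terms
    of [I].  Fix a set [om] of positive measure on which [W] is bounded below,
    and let [p = v - g], [q = v + g], which the undamped flow transports in
    opposite directions.  The functional is
      [N / 2 * int (g^2 + v^2) + int (a g v) + K / 2 * M(p, q)],
    where [N] is a large constant and the other two terms are as follows.

    The weight [a] vanishes at both ends of a period and satisfies
    [a' = 2 (1 + delta W) - K 1_om], so that [K |om| = 2 int (1 + delta W)].
    The derivative of [int (a g v)] is
    [- int (1 + delta W) (g^2 + v^2) + K / 2 * int_om (g^2 + v^2)]
    plus [- int (a W g v)].  The latter is absorbed by [I] and by the term
    [delta W g^2], which is there because [W] may be unbounded.  On [om], [v^2]
    is controlled by [I], but [g^2] has the wrong sign and no control.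

    The form [M(p, q)] is the integral over [z] in [om] of
    [int s(d) p(z + d) q(z - d) dd], where [s] is the sawtooth jumping at [0].
    Under the undamped flow its derivative is, for each [z], the jump term
    [p(z) q(z) = v(z)^2 - g(z)^2] minus the mean of [p(z + d) q(z - d)] over
    [d].  It therefore exchanges [g^2] on [om] for [v^2] on [om].  Completing
    the square in the mean term and using the value of [K |om|] cancels the
    whole energy density up to a multiple of [delta], and leaves
      [- K / (4 T) * Th] with
      [Th = int_om int (p(z + d) + q(z - d))^2 dd dz],
    [T] being the length of the circle.  By [correlation_gap], [Th] is bounded
    below by a multiple of the energy: if [Th] is small then [q] is nearly
    invariant under small translations, hence under all of them, so [q] is
    close to a constant and [p] to the opposite constant; but [p] and [q] have
    the same mean, since [g] is a derivative.

    The damping enters the derivative of [M(p, q)] through [W v], whose L1 norm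
    is at most the square root of [int W * I].  So integrability of [W] is
    enough, and this is what exponents above [-1] provide.  The resulting
    inequality is [dissipation].

    It is an inequality for states in the domain of the generator.  There the
    weak equations force [g] and [v] to agree almost everywhere with absolutely
    continuous periodic functions ([weak_derivative_primitive]), so all the
    integrations by parts are exact.  The passage to the semigroup is abstract
    ([lyapunov_decay]): a strongly continuous semigroup on a complete space is
    bounded near time [0], the domain of its generator is dense and stable, and
    a Dini derivative argument integrates the dissipation inequality along
    orbits of the domain.  Completeness of the phase space is that of L2. *)

(** * Integrals over one period *)

Section affine.
Context {R : realType}.
Local Notation mu := (@lebesgue_measure R).

Lemma measurable_affine (c a : R) : measurable_fun setT (fun x : R => c * x + a).
Proof. by apply: measurable_funD => //; apply: measurable_funM. Qed.

(** Translation and scaling: the pushforward of Lebesgue measure by an affine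
    map, multiplied by the slope, gives half-open intervals their length. *)
Lemma lebesgue_affine (c a : R) (c0 : 0 < c) (A : set R) : measurable A ->
  mu A = (c%:E * mu ((fun x : R => c * x + a)%R @^-1` A))%E.
Proof.
pose phi : measurableTypeR R -> measurableTypeR R := fun x => c * x + a.
have mphi : measurable_fun setT phi by exact: measurable_affine.
pose m : {measure set (measurableTypeR R) -> \bar R} :=
  mscale (NngNum (ltW c0)) (measure_function_pushforward__canonical__measure_function_Measure mu mphi).
move=> mA; apply: (@lebesgue_measure_unique _ m _ _ mA) => _ [[x y] _ <-]/=.
rewrite /mscale/= /pushforward.
have -> : phi @^-1` `]x, y] = `](x - a) / c, (y - a) / c]%classic.
  apply/seteqP; split => z /=; rewrite /phi !in_itv/= ltr_pdivrMr// ler_pdivlMr//;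
    lra.
rewrite !lebesgue_measure_itv/= !lte_fin ltr_pM2r ?invr_gt0// ltrD2r.
case: ifPn => xy; last by rewrite mule0.
rewrite -EFinM; congr EFin; field; lra.
Qed.

Lemma ge0_integral_affine (c a : R) (D : set R) (f : R -> \bar R) : 0 < c ->
  measurable D -> measurable_fun setT f -> (forall x, 0 <= f x)%E ->
  (\int[mu]_(x in D) f x =
   c%:E * \int[mu]_(x in (fun x : R => c * x + a)%R @^-1` D) f (c * x + a)%R)%E.
Proof.
move=> c0 mD mf f0.
have mfD : measurable_fun D f by exact: measurable_funS mf.
rewrite -(@ge0_integral_pushforward _ _ (measurableTypeR R) (measurableTypeR R) R (fun x => c * x + a) (measurable_affine c a) mu D f)//.
pose phi : measurableTypeR R -> measurableTypeR R := fun x => c * x + a.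
have mphi : measurable_fun setT phi by exact: measurable_affine.
rewrite -(@ge0_integral_mscale _ _ R (measure_function_pushforward__canonical__measure_function_Measure mu mphi) D mD (NngNum (ltW c0)) f)//.
by apply: eq_measure_integral => //= A mA AS; rewrite (lebesgue_affine a c0 mA).
Qed.

Lemma ge0_integral_opp (D : set R) (f : R -> \bar R) :
  measurable D -> measurable_fun setT f -> (forall x, 0 <= f x)%E ->
  (\int[mu]_(x in D) f x = \int[mu]_(x in -%R @^-1` D) f (- x)%R)%E.
Proof.
move=> mD mf f0.
have mfD : measurable_fun D f by exact: measurable_funS mf.
rewrite -(@ge0_integral_pushforward _ _ (measurableTypeR R) (measurableTypeR R) R (fun x : R => - x) _ mu D f)//.
have mN : measurable_fun setT (-%R : measurableTypeR R -> measurableTypeR R) by exact: oppr_measurable.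
  apply: (@eq_measure_integral _ _ _ _ (measure_function_pushforward__canonical__measure_function_Measure mu mN)) => A mA AS.
  exact: (esym (lebesgue_measureN mA)).
exact: oppr_measurable.
Qed.

Lemma ge0_integral_shift (c a b : R) (f : R -> \bar R) :
  measurable_fun setT f -> (forall x, 0 <= f x)%E ->
  (\int[mu]_(x in `[(a + c)%R, (b + c)%R[) f x = \int[mu]_(x in `[a, b[) f (x + c)%R)%E.
Proof.
move=> mf f0; rewrite (ge0_integral_affine (c := 1) c)// mul1e.
rewrite (_ : _ @^-1` _ = `[a, b[%classic).
  by apply: eq_integral => x _; rewrite mul1r.
by apply/seteqP; split => x; rewrite /= !in_itv/=; lra.
Qed.

Definition circumference : R := pi *+ 2.
Local Notation T := circumference.

Lemma circumference_gt0 : 0 < T. Proof. by rewrite /T mulrn_wgt0// pi_gt0. Qed.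

Section periodic.
Variable f : R -> \bar R.
Hypothesis mf : measurable_fun setT f.
Hypothesis f0 : (forall x, 0 <= f x)%E.
Hypothesis fT : forall x, f (x + T) = f x.

Let J a := (\int[mu]_(x in `[a, (a + T)%R[) f x)%E.

Let JT a : J (a + T) = J a.
Proof. by rewrite /J ge0_integral_shift//; apply: eq_integral => x _; rewrite fT. Qed.

Let split_itv (a b c : R) : a <= b -> b <= c ->
  (\int[mu]_(x in `[a, c[) f x = \int[mu]_(x in `[a, b[) f x + \int[mu]_(x in `[b, c[) f x)%E.
Proof.
move=> ab bc; rewrite -ge0_integral_setU//.
- congr integral; apply/seteqP; split => x /=; rewrite !in_itv/=.
    by move=> /andP[ax xc]; case: (ltP x b) => xb; [left|right]; rewrite ?ax ?xb ?xc.
  by move=> [|] /andP[h1 h2]; apply/andP; split; lra.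
- exact: measurable_funTS.
- apply/disj_setPS => y [/=]; rewrite !in_itv/= => /andP[_ yx] /andP[].
  by rewrite leNgt yx.
Qed.

Let Jsmall a b : 0 <= b <= T -> J (a + b) = J a.
Proof.
move=> /andP[b0 bT].
have -> : J a = (\int[mu]_(x in `[a, (a + b)%R[) f x + \int[mu]_(x in `[(a + b)%R, (a + T)%R[) f x)%E.
  by rewrite -split_itv ?lerDl ?lerD2l.
have -> : J (a + b) = (\int[mu]_(x in `[(a + b)%R, (a + T)%R[) f x +
    \int[mu]_(x in `[(a + T)%R, (a + b + T)%R[) f x)%E.
  by rewrite -split_itv ?lerD2l ?lerD2r ?lerDl.
have -> : (\int[mu]_(x in `[(a + T)%R, (a + b + T)%R[) f x = \int[mu]_(x in `[a, (a + b)%R[) f x)%E.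
  by rewrite ge0_integral_shift//; apply: eq_integral => x _; rewrite fT.
by rewrite [LHS]addeC.
Qed.

Let JTz a (k : int) : J (a + k%:~R * T) = J a.
Proof.
have H n b : J (b + n%:R * T) = J b.
  elim: n => [|n IH]; first by rewrite mul0r addr0.
  by rewrite -natr1 mulrDl mul1r addrA JT IH.
case: k => n; first exact: H.
by rewrite NegzE -(H n.+1) mulrNz mulNr subrK.
Qed.

Lemma ge0_integral_period a : (\int[mu]_(x in `[a, (a + T)%R[) f x = \int[mu]_(x in circle) f x)%E.
Proof.
have -> : circle = `[- pi, (- pi + T)%R[%classic :> set R.
  by rewrite /circle /T mulr2n addKr.
rewrite -/(J a) -/(J (- pi)).
set k := Num.floor ((a + pi) / T).
have T0 := circumference_gt0.
have -> : a = (- pi + (a + pi - k%:~R * T)) + k%:~R * T by lra.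
rewrite JTz Jsmall//.
have /andP[h1 h2] := floor_itv ((a + pi) / T).
move: h1 h2; rewrite -/k ler_pdivlMr// ltr_pdivrMr// intrD; lra.
Qed.

Lemma ge0_circle_shift a : (\int[mu]_(x in circle) f (x + a)%R = \int[mu]_(x in circle) f x)%E.
Proof.
rewrite /circle -ge0_integral_shift// -[RHS](ge0_integral_period (- pi + a)).
by rewrite (_ : - pi + a + T = pi + a)// /T mulr2n; lra.
Qed.

End periodic.

Lemma measurable_circle : measurable (circle : set R).
Proof. exact: measurable_itv. Qed.

Lemma ge0_circle_opp (f : R -> \bar R) : measurable_fun setT f ->
  (forall x, 0 <= f x)%E ->
  (\int[mu]_(x in circle) f (- x)%R = \int[mu]_(x in circle) f x)%E.
Proof.
move=> mf f0; rewrite [RHS]ge0_integral_opp//; last exact: measurable_circle.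
have -> : -%R @^-1` circle = `](- pi), pi]%classic :> set R.
  by rewrite /circle; apply/seteqP; split => x /=; rewrite !in_itv/=; lra.
have mg : measurable_fun setT (fun x : R => f (- x)).
  by apply: measurableT_comp => //.
rewrite /circle -(@integral_itv_obnd_cbnd R (- pi)); last exact: measurable_funTS.
by rewrite -(@integral_itv_bndo_bndc _ _ pi)//; exact: measurable_funTS.
Qed.

(** The map [x |-> 2 x] covers the circle twice and doubles lengths. *)
Lemma ge0_circle_dbl (f : R -> \bar R) : measurable_fun setT f ->
  (forall x, 0 <= f x)%E -> (forall x, f (x + T) = f x) ->
  (\int[mu]_(x in circle) f (2 * x)%R = \int[mu]_(x in circle) f x)%E.
Proof.
move=> mf f0 fT.
have h : (2%:E * \int[mu]_(x in circle) f (2 * x)%R = 2%:E * \int[mu]_(x in circle) f x)%E.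
  have := ge0_integral_affine (c := 2) 0 (D := `[(- T)%R, T[%classic) _ _ mf f0.
  move=> /(_ ltac:(by []) (measurable_itv _)) H.
  transitivity (\int[mu]_(x in `[(- T)%R, T[%classic) f x)%E.
    rewrite H; congr (_ * _)%E.
    rewrite (_ : _ @^-1` _ = circle).
      by apply: eq_integral => x _; rewrite addr0.
    by rewrite /circle; apply/seteqP; split => x; rewrite /= !in_itv/= /T; lra.
  have := circumference_gt0 => T0.
  rewrite (@itv_bndbnd_setU _ _ _ (BLeft 0)); [|by rewrite bnd_simp oppr_le0 ltW|by rewrite bnd_simp ltW].
  rewrite ge0_integral_setU//; last 2 first.
  - exact: measurable_funTS.
  - apply/disj_setPS => y [/=]; rewrite !in_itv/= => /andP[_ yx] /andP[].
    by rewrite leNgt yx.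
  have := ge0_integral_period mf f0 fT (- T); rewrite addNr => ->.
  have := ge0_integral_period mf f0 fT 0; rewrite add0r => ->.
  by rewrite (_ : 2 = 1 + 1)%R// EFinD ge0_muleDl// mul1e.
have : (2^-1%:E * (2%:E * \int[mu]_(x in circle) f (2 * x)%R) = 2^-1%:E * (2%:E * \int[mu]_(x in circle) f x))%E.
  by rewrite h.
by rewrite !muleA -!EFinM mulVf// !mul1e.
Qed.

Lemma ge0_circle_sub (f : R -> \bar R) a : measurable_fun setT f ->
  (forall x, 0 <= f x)%E -> (forall x, f (x + T) = f x) ->
  (\int[mu]_(x in circle) f (a - x)%R = \int[mu]_(x in circle) f x)%E.
Proof.
move=> mf f0 fT.
have mN : measurable_fun setT (fun x : R => f (- x)) by apply: measurableT_comp.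
have NT x : f (- (x + T)) = f (- x) by rewrite -[LHS]fT; congr f; lra.
transitivity (\int[mu]_(x in circle) f (- (x + - a))%R)%E.
  by apply: eq_integral => x _; congr f; lra.
rewrite (ge0_circle_shift (f := fun x => f (- x)))//.
exact: ge0_circle_opp.
Qed.

End affine.

(** * Integrable and square-integrable functions on the circle *)

Section circle_L2.
Context {R : realType}.
Local Notation mu := (@lebesgue_measure R).
Local Notation T := (@circumference R).
Implicit Types (f g h : R -> R).

(** The circle is one fixed period; invariance of the integral under
    translations is then a property of periodic integrands. *)
Definition ci f : R := \int[mu]_(x in circle) f x.

Definition Cint f : Prop := mu.-integrable circle (EFin \o f).

Definition per f := forall x, f (x + T) = f x.

Definition L1c f := [/\ per f, measurable_fun setT f & Cint f].
Definition L2c f := [/\ per f, measurable_fun setT f & Cint (fun x => f x ^+ 2)].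

Lemma mcircle : measurable (circle : set (measurableTypeR R)).
Proof. exact: measurable_circle. Qed.
Hint Resolve mcircle : core.
Hint Resolve measurable_circle : core.

Lemma ae_imp (P Q : R -> Prop) : (forall x, P x -> Q x) ->
  {ae mu, forall x, P x} -> {ae mu, forall x, Q x}.
Proof. by move=> PQ; apply: (@filterS _ _ (ae_filter_ringOfSetsType mu)). Qed.

Lemma ae_and (P Q : R -> Prop) : {ae mu, forall x, P x} ->
  {ae mu, forall x, Q x} -> {ae mu, forall x, P x /\ Q x}.
Proof. by apply: (@filterI _ _ (ae_filter_ringOfSetsType mu)). Qed.

Lemma mu_circle : mu circle = T%:E.
Proof.
have pi0 : 0 < pi :> R := pi_gt0 R.
rewrite lebesgue_measure_itv/= lte_fin ifT; last lra.
by rewrite -EFinB /T opprK mulr2n.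
Qed.

Lemma Cint_cst (c : R) : Cint (cst c).
Proof.
apply: measurable_bounded_integrable => //.
- by rewrite [X in (X < _)%E](mu_circle) ltry.
- exact: bounded_cst.
Qed.

Lemma Cint_le f g : measurable_fun setT f -> Cint g ->
  (forall x, `|f x| <= g x) -> Cint f.
Proof.
move=> mf ig fg; apply: (le_integrable mcircle _ _ ig) => //.
  by apply/measurable_EFinP; exact: measurable_funTS.
by move=> x _ /=; rewrite lee_fin (le_trans (fg x))// ler_norm.
Qed.

Lemma CintD f g : Cint f -> Cint g -> Cint (fun x => f x + g x).
Proof. by move=> If Ig; exact: (integrableD mcircle If Ig). Qed.
Lemma CintB f g : Cint f -> Cint g -> Cint (fun x => f x - g x).
Proof. by move=> If Ig; exact: (integrableB mcircle If Ig). Qed.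
Lemma CintN f : Cint f -> Cint (fun x => - f x).
Proof. by move=> If; exact: (integrableN If). Qed.
Lemma CintZ c f : Cint f -> Cint (fun x => c * f x).
Proof. by move=> If; exact: (integrableZl mcircle c If). Qed.
Lemma Cint_abs f : Cint f -> Cint (fun x => `|f x|).
Proof. by move=> ?; rewrite /Cint; apply: (integrable_norm (mu := mu)). Qed.

Lemma ciD f g : Cint f -> Cint g -> ci (fun x => f x + g x) = ci f + ci g.
Proof. by move=> ? ?; rewrite /ci RintegralD. Qed.
Lemma ciB f g : Cint f -> Cint g -> ci (fun x => f x - g x) = ci f - ci g.
Proof. by move=> ? ?; rewrite /ci RintegralB. Qed.
Lemma ciZ c f : Cint f -> ci (fun x => c * f x) = c * ci f.
Proof. by move=> ?; rewrite /ci RintegralZl. Qed.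
Lemma ciN f : Cint f -> ci (fun x => - f x) = - ci f.
Proof.
move=> Cf; rewrite -mulN1r -ciZ//; apply: eq_Rintegral => x _; by rewrite mulN1r.
Qed.
Lemma ci_cst c : ci (cst c) = c * T.
Proof. by rewrite /ci Rintegral_cst// [X in fine X]mu_circle. Qed.
Lemma ci_ge0 f : (forall x, 0 <= f x) -> 0 <= ci f.
Proof. by move=> f0; apply: Rintegral_ge0. Qed.
Lemma ci_le f g : Cint f -> Cint g -> (forall x, f x <= g x) -> ci f <= ci g.
Proof. by move=> ? ? fg; apply: le_Rintegral. Qed.
Lemma ci_abs f : Cint f -> `|ci f| <= ci (fun x => `|f x|).
Proof. by move=> ?; apply: le_normr_Rintegral. Qed.
Lemma eq_ci f g : (forall x, f x = g x) -> ci f = ci g.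
Proof. by move=> fg; congr ci; apply/funext. Qed.

Lemma ci_ae f g : measurable_fun setT f -> measurable_fun setT g ->
  {ae mu, forall x, f x = g x} -> ci f = ci g.
Proof.
move=> mf mg fg; congr fine; apply: ae_eq_integral => //.
- by apply/measurable_EFinP; exact: measurable_funTS.
- by apply/measurable_EFinP; exact: measurable_funTS.
- by apply: ae_imp fg => x /= -> _.
Qed.

Lemma integral_circle_shift (f : R -> \bar R) a : measurable_fun setT f ->
  (forall x, f (x + T) = f x) ->
  (\int[mu]_(x in circle) f (x + a)%R = \int[mu]_(x in circle) f x)%E.
Proof.
move=> mf fT; rewrite integralE [RHS]integralE.
have mp : measurable_fun setT f^\+%E by apply: measurable_funepos.
have mn : measurable_fun setT f^\-%E by apply: measurable_funeneg.
have pp x : f^\+%E (x + T) = f^\+%E x by rewrite funepos.unlock fT.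
have pn x : f^\-%E (x + T) = f^\-%E x by rewrite funeneg.unlock fT.
have Hp := @ge0_circle_shift R f^\+%E  mp (fun x => funepos_ge0 f x) pp a.
have Hn := @ge0_circle_shift R f^\-%E  mn (fun x => funeneg_ge0 f x) pn a.
by congr (_ - _)%E; [rewrite -Hp|rewrite -Hn]; apply: eq_integral => x _;
  rewrite ?funepos.unlock ?funeneg.unlock.
Qed.

Lemma integral_circle_sub (f : R -> \bar R) a : measurable_fun setT f ->
  (forall x, f (x + T) = f x) ->
  (\int[mu]_(x in circle) f (a - x)%R = \int[mu]_(x in circle) f x)%E.
Proof.
move=> mf fT; rewrite integralE [RHS]integralE.
have mp : measurable_fun setT f^\+%E by apply: measurable_funepos.
have mn : measurable_fun setT f^\-%E by apply: measurable_funeneg.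
have pp x : f^\+%E (x + T) = f^\+%E x by rewrite funepos.unlock fT.
have pn x : f^\-%E (x + T) = f^\-%E x by rewrite funeneg.unlock fT.
have Hp := @ge0_circle_sub R f^\+%E a mp (fun x => funepos_ge0 f x) pp .
have Hn := @ge0_circle_sub R f^\-%E a mn (fun x => funeneg_ge0 f x) pn .
by congr (_ - _)%E; [rewrite -Hp|rewrite -Hn]; apply: eq_integral => x _;
  rewrite ?funepos.unlock ?funeneg.unlock.
Qed.

Lemma measurable_shift f (a : R) : measurable_fun setT f ->
  measurable_fun setT (fun x : R => f (x + a)).
Proof. by move=> mf; apply: (measurableT_comp mf); exact: measurable_funD. Qed.

Lemma measurable_reflect f (a : R) : measurable_fun setT f ->
  measurable_fun setT (fun x : R => f (a - x)).
Proof. by move=> mf; apply: (measurableT_comp mf); exact: measurable_funB. Qed.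

Lemma ci_shift f a : measurable_fun setT f -> per f -> ci (fun x => f (x + a)) = ci f.
Proof.
move=> mf pf; congr fine; rewrite -[RHS](@integral_circle_shift (EFin \o f) a)//.
  exact/measurable_EFinP.
by move=> x /=; rewrite pf.
Qed.

Lemma ci_sub f a : measurable_fun setT f -> per f -> ci (fun x => f (a - x)) = ci f.
Proof.
move=> mf pf; congr fine; rewrite -[RHS](@integral_circle_sub (EFin \o f) a)//.
  exact/measurable_EFinP.
by move=> x /=; rewrite pf.
Qed.

Lemma Cint_shift f a : measurable_fun setT f -> per f -> Cint f -> Cint (fun x => f (x + a)).
Proof.
move=> mf pf /integrableP[_ foo]; apply/integrableP; split.
  by apply/measurable_EFinP; apply: measurable_funTS; exact: measurable_shift.
rewrite (_ : (\int[_]_(_ in _) _)%E = (\int[mu]_(x in circle) `|(EFin \o f) x|)%E)//.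
rewrite -[RHS](@integral_circle_shift (fun x => `|(EFin \o f) x|%E) a)//.
  by apply: measurableT_comp => //; exact/measurable_EFinP.
by move=> x /=; rewrite pf.
Qed.

Lemma Cint_sub f a : measurable_fun setT f -> per f -> Cint f -> Cint (fun x => f (a - x)).
Proof.
move=> mf pf /integrableP[_ foo]; apply/integrableP; split.
  by apply/measurable_EFinP; apply: measurable_funTS; exact: measurable_reflect.
rewrite (_ : (\int[_]_(_ in _) _)%E = (\int[mu]_(x in circle) `|(EFin \o f) x|)%E)//.
rewrite -[RHS](@integral_circle_sub (fun x => `|(EFin \o f) x|%E) a)//.
  by apply: measurableT_comp => //; exact/measurable_EFinP.
by move=> x /=; rewrite pf.
Qed.

Lemma per_sub f a : per f -> per (fun x => f (a - x)).
Proof. by move=> pf x; rewrite -[LHS]pf; congr f; lra. Qed.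
Lemma per_shift f a : per f -> per (fun x => f (x + a)).
Proof. by move=> pf x; rewrite addrAC pf. Qed.

Lemma L1c_shift f a : L1c f -> L1c (fun x => f (x + a)).
Proof. by case=> pf mf If; split; [exact: per_shift|exact: measurable_shift|exact: Cint_shift]. Qed.
Lemma L1c_sub f a : L1c f -> L1c (fun x => f (a - x)).
Proof. by case=> pf mf If; split; [exact: per_sub|exact: measurable_reflect|exact: Cint_sub]. Qed.

Lemma measurable_sqr f : measurable_fun setT f -> measurable_fun setT (fun x => f x ^+ 2).
Proof. by move=> mf; exact: measurable_funX. Qed.

Lemma L2c_shift f a : L2c f -> L2c (fun x => f (x + a)).
Proof.
case=> pf mf If; split; [exact: per_shift|exact: measurable_shift|].
apply: (@Cint_shift (fun x => f x ^+ 2)) => //; first exact: measurable_sqr.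
by move=> x; rewrite pf.
Qed.
Lemma L2c_sub f a : L2c f -> L2c (fun x => f (a - x)).
Proof.
case=> pf mf If; split; [exact: per_sub|exact: measurable_reflect|].
apply: (@Cint_sub (fun x => f x ^+ 2)) => //; first exact: measurable_sqr.
by move=> x; rewrite pf.
Qed.

Lemma L1cD f g : L1c f -> L1c g -> L1c (fun x => f x + g x).
Proof.
move=> [pf mf If] [pg mg Ig]; split; [by move=> x; rewrite pf pg|exact: measurable_funD|exact: CintD].
Qed.
Lemma L1cB f g : L1c f -> L1c g -> L1c (fun x => f x - g x).
Proof.
move=> [pf mf If] [pg mg Ig]; split; [by move=> x; rewrite pf pg|exact: measurable_funB|exact: CintB].
Qed.
Lemma L1cZ c f : L1c f -> L1c (fun x => c * f x).
Proof.
move=> [pf mf If]; split; [by move=> x; rewrite pf|exact: measurable_funM|exact: CintZ].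
Qed.
Lemma L1c_abs f : L1c f -> L1c (fun x => `|f x|).
Proof.
move=> [pf mf If]; split; [by move=> x; rewrite pf|exact: measurableT_comp|exact: Cint_abs].
Qed.
Lemma L1c_bddM M f g : per g -> measurable_fun setT g -> (forall x, `|g x| <= M) ->
  L1c f -> L1c (fun x => g x * f x).
Proof.
move=> pg mg gM [pf mf If]; split; first by move=> x; rewrite pf pg.
  exact: measurable_funM.
apply: (Cint_le _ (CintZ M (Cint_abs If))); first exact: measurable_funM.
by move=> x; rewrite normrM ler_wpM2r.
Qed.

Lemma L2_mul f g : L2c f -> L2c g -> L1c (fun x => f x * g x).
Proof.
move=> [pf mf If] [pg mg Ig]; split; [by move=> x; rewrite pf pg|exact: measurable_funM|].
apply: (Cint_le _ (CintD If Ig)); first exact: measurable_funM.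
move=> x; have := sqr_ge0 (f x + g x); have := sqr_ge0 (f x - g x).
have := sqr_ge0 (f x); have := sqr_ge0 (g x).
rewrite ler_norml => *; apply/andP; split; nra.
Qed.

Lemma L2cD f g : L2c f -> L2c g -> L2c (fun x => f x + g x).
Proof.
move=> Lf Lg; have [_ _ Ifg] := L2_mul Lf Lg; case: Lf Lg => [pf mf If] [pg mg Ig].
split; [by move=> x; rewrite pf pg|exact: measurable_funD|].
rewrite (_ : (fun x => _) = (fun x => (f x ^+ 2 + g x ^+ 2) + 2 * (f x * g x))).
  by apply: CintD; [exact: CintD|exact: CintZ].
by apply/funext => x; ring.
Qed.
Lemma L2cZ c f : L2c f -> L2c (fun x => c * f x).
Proof.
move=> [pf mf If]; split; [by move=> x; rewrite pf|exact: measurable_funM|].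
rewrite (_ : (fun x => _) = (fun x => c ^+ 2 * (f x ^+ 2))); first exact: CintZ.
by apply/funext => x; ring.
Qed.
Lemma L2cN f : L2c f -> L2c (fun x => - f x).
Proof.
move=> /(L2cZ (-1)); congr L2c; by apply/funext => x; rewrite mulN1r.
Qed.
Lemma L2cB f g : L2c f -> L2c g -> L2c (fun x => f x - g x).
Proof. by move=> Lf /L2cN; exact: L2cD. Qed.
Lemma L2c_cst c : L2c (cst c).
Proof. by split => //; exact: (Cint_cst (c ^+ 2)). Qed.
Lemma L2c_abs f : L2c f -> L2c (fun x => `|f x|).
Proof.
move=> [pf mf If]; split; [by move=> x; rewrite pf|exact: measurableT_comp|].
by rewrite (_ : (fun x => _) = (fun x => f x ^+ 2))//; apply/funext => x; rewrite real_normK ?num_real.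
Qed.
Lemma L2_L1 f : L2c f -> L1c f.
Proof.
move=> Lf; have := L2_mul Lf (L2c_cst 1).
by rewrite (_ : (fun x => _) = f)//; apply/funext => x; rewrite /= mulr1.
Qed.
Lemma L2c_bddM M f g : per g -> measurable_fun setT g -> (forall x, `|g x| <= M) ->
  L2c f -> L2c (fun x => g x * f x).
Proof.
move=> pg mg gM [pf mf If]; split; first by move=> x; rewrite pf pg.
  exact: measurable_funM.
apply: (Cint_le _ (CintZ (M ^+ 2) If)).
  by apply: measurable_sqr; exact: measurable_funM.
move=> x; rewrite ger0_norm ?sqr_ge0// exprMn ler_wpM2r ?sqr_ge0//.
by rewrite -[g x ^+ 2]real_normK ?num_real// ler_pXn2r ?nnegrE// (le_trans _ (gM x)).
Qed.
Lemma L2c_bdd M g : per g -> measurable_fun setT g -> (forall x, `|g x| <= M) -> L2c g.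
Proof.
move=> pg mg gM; have := L2c_bddM pg mg gM (L2c_cst 1).
by rewrite (_ : (fun x => _) = g)//; apply/funext => x; rewrite /= mulr1.
Qed.

Definition ip f g := ci (fun x => f x * g x).

Lemma ipC f g : ip f g = ip g f.
Proof. by apply: eq_ci => x; rewrite mulrC. Qed.
Lemma ipDl f g h : L2c f -> L2c g -> L2c h ->
  ip (fun x => f x + g x) h = ip f h + ip g h.
Proof.
move=> Lf Lg Lh; rewrite /ip -ciD; [|by have [] := L2_mul Lf Lh|by have [] := L2_mul Lg Lh].
by apply: eq_ci => x; rewrite mulrDl.
Qed.
Lemma ipZl c f h : L2c f -> L2c h -> ip (fun x => c * f x) h = c * ip f h.
Proof.
move=> Lf Lh; rewrite /ip -ciZ; [|by have [] := L2_mul Lf Lh].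
by apply: eq_ci => x; rewrite mulrA.
Qed.
Lemma ipDr f g h : L2c f -> L2c g -> L2c h ->
  ip h (fun x => f x + g x) = ip h f + ip h g.
Proof. by move=> *; rewrite ipC ipDl// !(ipC h). Qed.
Lemma ipZr c f h : L2c f -> L2c h -> ip h (fun x => c * f x) = c * ip h f.
Proof. by move=> *; rewrite ipC ipZl// !(ipC h). Qed.
Lemma ip_ge0 f : 0 <= ip f f.
Proof. by apply: ci_ge0 => x; rewrite -expr2 sqr_ge0. Qed.

(** The discriminant argument behind each Cauchy-Schwarz inequality; [c = 0] is
    included since the quadratic forms are only semidefinite. *)
Lemma quad_discr (a b c : R) : 0 <= a -> 0 <= c ->
  (forall t : R, 0 <= a + 2 * t * b + t ^+ 2 * c) -> b ^+ 2 <= a * c.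
Proof.
move=> a0 c0 H; have [c0'|c0'] := eqVneq c 0.
  rewrite c0' mulr0; have [->|b0] := eqVneq b 0; first by rewrite expr0n.
  have := H (- (a + 1) / (2 * b)); rewrite c0' mulr0 addr0.
  rewrite (_ : 2 * _ * b = - (a + 1)); last by field.
  lra.
have c_gt0 : 0 < c by rewrite lt_neqAle eq_sym c0'.
have := H (- b / c); rewrite (_ : _ + _ = (a * c - b ^+ 2) / c); last by field.
by rewrite divr_ge0_pos// || (rewrite pmulr_lge0 ?invr_gt0// subr_ge0).
Qed.

Lemma CS f g : L2c f -> L2c g -> ip f g ^+ 2 <= ip f f * ip g g.
Proof.
move=> Lf Lg; apply: quad_discr; [exact: ip_ge0|exact: ip_ge0|move=> t].
have Ltg := L2cZ t Lg; have := ip_ge0 (fun x => f x + t * g x).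
rewrite ipDl ?ipDr//; last exact: L2cD.
by rewrite !ipZl// !ipZr// (ipC g f) => h; apply: le_trans h _; rewrite le_eqVlt; apply/orP; left; apply/eqP; ring.
Qed.

Lemma ci_abs_le f : L2c f -> (ci (fun x => `|f x|)) ^+ 2 <= T * ip f f.
Proof.
move=> Lf; have := CS (L2c_cst 1) (L2c_abs Lf).
rewrite [ip _ (fun x => `|f x|)](@eq_ci _ (fun x => `|f x|)); last by move=> x; rewrite mul1r.
rewrite [ip (cst 1) _](@eq_ci _ (cst 1)); last by move=> x; rewrite mul1r.
rewrite ci_cst mul1r [ip (fun x => `|f x|) _](@eq_ci _ (fun x => f x * f x))//.
by move=> x; rewrite -normrM ger0_norm// -expr2 sqr_ge0.
Qed.

Lemma ip_shift f g a : L2c f -> L2c g -> ip (fun x => f (x + a)) (fun x => g (x + a)) = ip f g.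
Proof.
move=> Lf Lg; have [pfg mfg _] := L2_mul Lf Lg.
exact: (@ci_shift (fun x => f x * g x) a).
Qed.
Lemma ip_sub f g a : L2c f -> L2c g -> ip (fun x => f (a - x)) (fun x => g (a - x)) = ip f g.
Proof.
move=> Lf Lg; have [pfg mfg _] := L2_mul Lf Lg.
exact: (@ci_sub (fun x => f x * g x) a).
Qed.

Lemma EFin_ci f : (forall x, 0 <= f x) -> Cint f -> (ci f)%:E = (\int[mu]_(x in circle) (f x)%:E)%E.
Proof.
move=> f0 If; rewrite /ci /Rintegral fineK//.
exact: (integrable_fin_num mcircle If).
Qed.

End circle_L2.
#[global] Hint Resolve mcircle : core.
#[global] Hint Resolve measurable_circle : core.

(** * Absolutely continuous functions *)

Section abs_cont.
Context {R : realType}.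
Local Notation mu := (@lebesgue_measure R).
Local Notation T := (@circumference R).
Implicit Types (f g h F G H : R -> R) (a b c : R).

Definition li a b f : R := \int[mu]_(x in `[a, b[) f x.

Definition lint f : Prop :=
  measurable_fun setT f /\ forall a b, mu.-integrable `[a, b[ (EFin \o f).

(** Absolute continuity is expressed by the increments of [F] being integrals
    of a locally integrable [f]; no statement about pointwise derivatives is
    then needed to integrate by parts. *)
Definition is_primitive F f : Prop := lint f /\ forall a b, a <= b -> F b - F a = li a b f.

Lemma measurable_itvco a b : measurable (`[a, b[%classic : set (measurableTypeR R)).
Proof. exact: measurable_itv. Qed.
Hint Resolve measurable_itvco : core.

Lemma itv_cat a b c : a <= b -> b <= c ->
  `[a, c[%classic = `[a, b[%classic `|` `[b, c[%classic :> set R.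
Proof.
move=> ab bc; apply/seteqP; split => x /=; rewrite !in_itv/=.
  by move=> /andP[ax xc]; case: (ltP x b) => xb; [left|right]; rewrite ?ax ?xb ?xc.
by move=> [|] /andP[h1 h2]; apply/andP; split; lra.
Qed.

Lemma itv_disj a b c : [disjoint `[a, b[%classic & `[b, c[%classic : set R].
Proof.
apply/disj_setPS => y [/=]; rewrite !in_itv/= => /andP[_ yx] /andP[].
by rewrite leNgt yx.
Qed.

Lemma lint_meas f : lint f -> measurable_fun setT f. Proof. by case. Qed.

Lemma lint_le f g : measurable_fun setT f -> lint g ->
  (forall x, `|f x| <= g x) -> lint f.
Proof.
move=> mf [mg ig] fg; split => // a b.
apply: (le_integrable (measurable_itvco a b) _ _ (ig a b)) => //.
  by apply/measurable_EFinP; exact: measurable_funTS.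
by move=> x _ /=; rewrite lee_fin (le_trans (fg x))// ler_norm.
Qed.

Lemma lintD f g : lint f -> lint g -> lint (fun x => f x + g x).
Proof.
move=> [mf If] [mg Ig]; split; first exact: measurable_funD.
by move=> a b; exact: (integrableD (measurable_itvco a b) (If a b) (Ig a b)).
Qed.
Lemma lintZ c f : lint f -> lint (fun x => c * f x).
Proof.
move=> [mf If]; split; first exact: measurable_funM.
by move=> a b; exact: (integrableZl (measurable_itvco a b) c (If a b)).
Qed.
Lemma lintN f : lint f -> lint (fun x => - f x).
Proof.
move=> /(lintZ (-1)); congr lint; by apply/funext => x; rewrite mulN1r.
Qed.
Lemma lintB f g : lint f -> lint g -> lint (fun x => f x - g x).
Proof. by move=> If /lintN; exact: lintD. Qed.
Lemma lint_abs f : lint f -> lint (fun x => `|f x|).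
Proof.
move=> [mf If]; split; first exact: measurableT_comp.
by move=> a b; exact: (integrable_norm (If a b)).
Qed.
Lemma lint_cst c : lint (cst c).
Proof.
split => // a b; apply: measurable_bounded_integrable => //.
- by rewrite [X in (X < _)%E](lebesgue_measure_itv `[a, b[); case: ifP => _; rewrite ltry.
- exact: bounded_cst.
Qed.

Lemma liD f g a b : lint f -> lint g -> li a b (fun x => f x + g x) = li a b f + li a b g.
Proof. by move=> [_ If] [_ Ig]; rewrite /li RintegralD. Qed.
Lemma liZ c f a b : lint f -> li a b (fun x => c * f x) = c * li a b f.
Proof. by move=> [_ If]; rewrite /li RintegralZl. Qed.
Lemma liN f a b : lint f -> li a b (fun x => - f x) = - li a b f.
Proof.
by move=> If; rewrite -mulN1r -liZ//; apply: eq_Rintegral => x _; rewrite mulN1r.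
Qed.
Lemma liB f g a b : lint f -> lint g -> li a b (fun x => f x - g x) = li a b f - li a b g.
Proof. by move=> If Ig; rewrite liD ?liN//; exact: lintN. Qed.
Lemma li_cat f a b c : lint f -> a <= b -> b <= c -> li a c f = li a b f + li b c f.
Proof.
move=> [mf If] ab bc; rewrite /li (itv_cat ab bc) Rintegral_setU//.
  by rewrite -itv_cat.
exact: itv_disj.
Qed.
Lemma li_nil f a b : b <= a -> li a b f = 0.
Proof. by move=> ba; rewrite /li set_itv_ge ?Rintegral_set0// bnd_simp -leNgt. Qed.
Lemma li_abs f a b : lint f -> `|li a b f| <= li a b (fun x => `|f x|).
Proof. by move=> [_ If]; apply: le_normr_Rintegral. Qed.
Lemma li_ge0 f a b : (forall x, 0 <= f x) -> 0 <= li a b f.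
Proof. by move=> f0; apply: Rintegral_ge0. Qed.
Lemma li_cst c a b : a <= b -> li a b (cst c) = c * (b - a).
Proof.
move=> ab; rewrite /li Rintegral_cst// [X in fine X](lebesgue_measure_itv `[a, b[)/=.
rewrite lte_fin; case: ltP => // ba; rewrite (_ : b = a) ?subrr//.
by apply/eqP; rewrite eq_le ba ab.
Qed.
Lemma eq_li f g a b : (forall x, f x = g x) -> li a b f = li a b g.
Proof. by move=> fg; congr li; apply/funext. Qed.
Lemma li_circle f : li (- pi) pi f = ci f. Proof. by []. Qed.

Lemma integral_shift (f : R -> \bar R) a b c : measurable_fun setT f ->
  (\int[mu]_(x in `[(a + c)%R, (b + c)%R[) f x = \int[mu]_(x in `[a, b[) f (x + c)%R)%E.
Proof.
move=> mf; rewrite integralE [RHS]integralE.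
have mp : measurable_fun setT f^\+%E by apply: measurable_funepos.
have mn : measurable_fun setT f^\-%E by apply: measurable_funeneg.
have Hp := @ge0_integral_shift R c a b f^\+%E mp (fun x => funepos_ge0 f x).
have Hn := @ge0_integral_shift R c a b f^\-%E mn (fun x => funeneg_ge0 f x).
by congr (_ - _)%E; [rewrite Hp|rewrite Hn]; apply: eq_integral => x _;
  rewrite ?funepos.unlock ?funeneg.unlock.
Qed.

Lemma li_shift f a b c : measurable_fun setT f ->
  li a b (fun x => f (x + c)) = li (a + c) (b + c) f.
Proof.
move=> mf; rewrite /li /Rintegral (integral_shift a b c)//; exact/measurable_EFinP.
Qed.

Lemma lint_shift f c : lint f -> lint (fun x => f (x + c)).
Proof.
move=> [mf If]; split; first exact: measurable_shift.
move=> a b; apply/integrableP; split.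
  by apply/measurable_EFinP; apply: measurable_funTS; exact: measurable_shift.
have /integrableP[_] := If (a + c) (b + c).
by rewrite (@integral_shift (fun x => `|(EFin \o f) x|%E))//; apply: measurableT_comp => //; exact/measurable_EFinP.
Qed.

Lemma integral_reflect (f : R -> \bar R) a b c : measurable_fun setT f ->
  (\int[mu]_(x in `[a, b[) f (c - x)%R = \int[mu]_(x in `[(c - b)%R, (c - a)%R[) f x)%E.
Proof.
move=> mf.
have main (g : R -> \bar R) : measurable_fun setT g -> (forall x, 0 <= g x)%E ->
    (\int[mu]_(x in `[a, b[) g (c - x)%R = \int[mu]_(x in `[(c - b)%R, (c - a)%R[) g x)%E.
  move=> mg g0; rewrite [RHS]ge0_integral_opp//.
  have -> : -%R @^-1` `[(c - b)%R, (c - a)%R[ = `](a - c)%R, (b - c)%R]%classic :> set R.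
    by apply/seteqP; split => x /=; rewrite !in_itv/=; lra.
  have mgN : measurable_fun setT (fun x : R => g (- x)).
    exact: (measurableT_comp mg).
  have [ab|ba] := ltP a b; last first.
    by rewrite !set_itv_ge ?integral_set0// bnd_simp -leNgt ?lerD2r.
  rewrite integral_itv_obnd_cbnd; last exact: measurable_funTS.
  rewrite -integral_itv_bndo_bndc; last exact: measurable_funTS.
  rewrite ge0_integral_shift//.
  by apply: eq_integral => x _; congr g; lra.
rewrite integralE [RHS]integralE.
have mp : measurable_fun setT f^\+%E by apply: measurable_funepos.
have mn : measurable_fun setT f^\-%E by apply: measurable_funeneg.
have Hp := main f^\+%E mp (fun x => funepos_ge0 f x).
have Hn := main f^\-%E mn (fun x => funeneg_ge0 f x).
by congr (_ - _)%E; [rewrite -Hp|rewrite -Hn]; apply: eq_integral => x _;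
  rewrite ?funepos.unlock ?funeneg.unlock.
Qed.

Lemma li_reflect f a b c : measurable_fun setT f ->
  li a b (fun x => f (c - x)) = li (c - b) (c - a) f.
Proof.
move=> mf; rewrite /li /Rintegral -(integral_reflect a b c)//; exact/measurable_EFinP.
Qed.

Lemma lint_reflect f c : lint f -> lint (fun x => f (c - x)).
Proof.
move=> [mf If]; split; first exact: measurable_reflect.
move=> a b; apply/integrableP; split.
  by apply/measurable_EFinP; apply: measurable_funTS; exact: measurable_reflect.
have /integrableP[_] := If (c - b) (c - a).
by rewrite -(@integral_reflect (fun x => `|(EFin \o f) x|%E))//; apply: measurableT_comp => //; exact/measurable_EFinP.
Qed.

Lemma L1c_lint f : L1c f -> lint f.
Proof.
case=> pf mf If; split => // a b.
have mE : measurable_fun setT (EFin \o f) by exact/measurable_EFinP.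
have mabs : measurable_fun setT (fun x => `|(EFin \o f) x|%E) by exact: measurableT_comp.
have T0 := @circumference_gt0 R.
have per1 c : (\int[mu]_(x in `[c, (c + T)%R[) `|(EFin \o f) x| < +oo)%E.
  rewrite (ge0_integral_period mabs)//; last by move=> x /=; rewrite pf.
  by case/integrableP : If.
have perN n : (\int[mu]_(x in `[a, (a + n%:R * T)%R[) `|(EFin \o f) x| < +oo)%E.
  elim: n => [|n IH].
    by rewrite mul0r addr0 set_itvco0 integral_set0.
  have h1 : a <= a + n%:R * T by rewrite lerDl mulr_ge0// ltW.
  have h2 : a + n%:R * T <= a + n.+1%:R * T by rewrite lerD2l ler_pM2r// ler_nat.
  rewrite (itv_cat h1 h2) ge0_integral_setU//; last 2 first.
  - exact: measurable_funTS.
  - exact: itv_disj.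
  by rewrite lte_add_pinfty// -natr1 mulrDl mul1r addrA.
apply/integrableP; split; first exact: measurable_funTS.
pose n := Num.truncn `|(b - a) / T|.
apply: le_lt_trans (perN n.+1); apply: ge0_subset_integral => //.
- exact: measurable_funTS.
apply: subset_itvl; rewrite bnd_simp -lerBlDl -ler_pdivrMr//.
by apply: (le_trans (ler_norm _)); exact/ltW/truncnS_gt.
Qed.

Lemma li_period f a : L1c f -> li a (a + T) f = ci f.
Proof.
move=> [pf mf If]; rewrite -(ci_shift (a + pi) mf pf) -li_circle (li_shift _ _ _ mf).
have -> : - pi + (a + pi) = a by ring.
by have -> : pi + (a + pi) = a + T by rewrite /T mulr2n; ring.
Qed.

Lemma primitive_lint F f : is_primitive F f -> lint f. Proof. by case. Qed.

Lemma primitive_cst c : is_primitive (cst c) (cst 0).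
Proof. by split => [|a b ab]; [exact: lint_cst|rewrite li_cst// subrr mul0r]. Qed.

Lemma primitiveD F f G g : is_primitive F f -> is_primitive G g -> is_primitive (fun x => F x + G x) (fun x => f x + g x).
Proof.
move=> [If HF] [Ig HG]; split => [|a b ab]; first exact: lintD.
by rewrite liD// -HF// -HG//; ring.
Qed.
Lemma primitiveB F f G g : is_primitive F f -> is_primitive G g -> is_primitive (fun x => F x - G x) (fun x => f x - g x).
Proof.
move=> [If HF] [Ig HG]; split => [|a b ab]; first exact: lintB.
by rewrite liB// -HF// -HG//; ring.
Qed.
Lemma primitive_shift F f c : is_primitive F f -> is_primitive (fun x => F (x + c)) (fun x => f (x + c)).
Proof.
move=> [If HF]; split => [|a b ab]; first exact: lint_shift.
rewrite li_shift; last exact: lint_meas.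
by rewrite HF// lerD2r.
Qed.
Lemma primitive_reflect F f c : is_primitive F f -> is_primitive (fun x => F (c - x)) (fun x => - f (c - x)).
Proof.
move=> [If HF]; split => [|a b ab]; first by apply/lintN/lint_reflect.
rewrite liN ?li_reflect -?HF; [ring|lra|exact: lint_meas|exact: lint_reflect].
Qed.

Definition prim f x : R := if 0 <= x then li 0 x f else - li x 0 f.

Lemma prim_primitive f : lint f -> is_primitive (prim f) f.
Proof.
move=> If; split => // a b ab; rewrite /prim.
case: (leP 0 a) => a0; case: (leP 0 b) => b0.
- by rewrite (@li_cat f 0 a b)//; ring.
- by lra.
- by rewrite (@li_cat f a 0 b)// ?(ltW a0)//; ring.
- by rewrite (@li_cat f a b 0)// ?(ltW b0)//; ring.
Qed.

Lemma primitive_continuous F f : is_primitive F f -> continuous F.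
Proof.
move=> [[mf If] HF] x.
have ab : x - 1 <= x + 1 by lra.
have Icc : mu.-integrable `[x - 1, x + 1] (EFin \o f).
  by apply: integrableS (If (x - 1) (x + 2)) => //; apply: subset_itvl; rewrite bnd_simp; lra.
have := parameterized_integral_continuous ab Icc.
have abl : x - 1 < x + 1 by lra.
move=> /(continuous_within_itvP _ abl)[+ _ _] => /(_ x).
rewrite in_itv/= => /(_ ltac:(apply/andP; split; lra)) cont.
have cont2 : F (x - 1) + parameterized_integral mu (x - 1) y f @[y --> x] -->
    F (x - 1) + parameterized_integral mu (x - 1) x f.
  by apply: cvgD; [exact: cvg_cst|exact: cont].
have E : F x = F (x - 1) + parameterized_integral mu (x - 1) x f.
  rewrite /parameterized_integral -Rintegral_itv_bndo_bndc//.
  by rewrite -[X in _ + X]/(li _ _ _) -HF; [ring|lra].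
rewrite /continuous_at E; apply: cvg_trans cont2; apply: near_eq_cvg; near=> y.
have xy : x - 1 <= y.
  have : `|x - y| < 1 by near: y; apply: cvgr_dist_lt => //; exact: cvg_id.
  by rewrite ltr_norml; lra.
rewrite /parameterized_integral -Rintegral_itv_bndo_bndc//.
by rewrite -[X in _ + X]/(li _ _ _) -HF; [ring|].
Unshelve. all: by end_near. Qed.

Lemma primitive_measurable F f : is_primitive F f -> measurable_fun setT F.
Proof. by move=> /primitive_continuous cF; exact: continuous_measurable_fun. Qed.

Lemma primitive_bound F f a b x : is_primitive F f -> a <= x <= b -> `|F x| <= `|F a| + li a b (fun x => `|f x|).
Proof.
move=> [If HF] /andP[ax xb]; rewrite -lerBlDl.
have h : F x = F a + li a x f by rewrite -HF//; ring.
have := ler_normD (F a) (li a x f); rewrite -h => h1.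
have h2 := li_abs a x If.
have : li a x (fun x => `|f x|) <= li a b (fun x => `|f x|).
  rewrite (@li_cat _ a x b)//; last exact: lint_abs.
  by rewrite lerDl li_ge0.
lra.
Qed.

Lemma lint_primitiveM F f h : is_primitive F f -> lint h -> lint (fun x => F x * h x).
Proof.
move=> AF [mh Ih]; have mF := primitive_measurable AF.
split; first exact: measurable_funM.
move=> a b.
have [ab|ba] := leP a b; last first.
  by rewrite set_itv_ge ?bnd_simp -?leNgt ?ltW//; exact: integrable_set0.
pose C := `|F a| + li a b (fun x => `|f x|).
have C0 : 0 <= C by rewrite addr_ge0// li_ge0.
have IC := integrableZl (measurable_itvco a b) C (integrable_norm (Ih a b)).
apply: (le_integrable (measurable_itvco a b) _ _ IC).
  by apply/measurable_EFinP; apply: measurable_funTS; exact: measurable_funM.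
move=> x /=; rewrite in_itv/= => /andP[ax xb].
rewrite lee_fin normrM [leRHS]ger0_norm ?mulr_ge0// ler_wpM2r//.
by apply: primitive_bound => //; rewrite ax ltW.
Qed.

Lemma prod_integrable (f h : R -> R) : mu.-integrable setT (EFin \o f) ->
  mu.-integrable setT (EFin \o h) ->
  (mu \x mu)%E.-integrable setT (fun w : R * R => (f w.1 * h w.2)%:E).
Proof.
move=> If Ih; have mf := measurable_int _ If; have mh := measurable_int _ Ih.
have mf' : measurable_fun setT f by exact/measurable_EFinP.
have mh' : measurable_fun setT h by exact/measurable_EFinP.
apply/integrable12ltyP.
  apply/measurable_EFinP; apply: measurable_funM.
    exact: (measurableT_comp mf').
  exact: (measurableT_comp mh').
have /integrableP[_ foo] := If; have /integrableP[_ hoo] := Ih.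
have E x : (\int[mu]_y `|(f x * h y)%:E| = `|f x|%:E * \int[mu]_y `|(EFin \o h) y|)%E.
  rewrite -ge0_integralZl//; last exact: measurableT_comp.
  by apply: eq_integral => y _ /=; rewrite normrM EFinM.
under eq_integral do rewrite /= E.
have h0 : (0 <= \int[mu]_y `|(EFin \o h) y|)%E by exact: integral_ge0.
have hfin : (\int[mu]_y `|(EFin \o h) y|)%E \is a fin_num by rewrite ge0_fin_numE.
rewrite -(fineK hfin) ge0_integralZr//.
  by rewrite muleC lte_mul_pinfty// ?lee_fin ?fine_ge0.
- by apply: measurableT_comp => //; exact: measurableT_comp.
- by rewrite lee_fin fine_ge0.
Qed.

Lemma EFin_Rint d (X : measurableType d) (m : {measure set X -> \bar R}) (D : set X) (f : X -> R) :
  measurable D -> m.-integrable D (EFin \o f) ->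
  (\int[m]_(x in D) f x)%:E = (\int[m]_(x in D) (f x)%:E)%E.
Proof. by move=> mD If; rewrite /Rintegral fineK//; exact: (integrable_fin_num mD If). Qed.

(** Both sides are the integral of [f x * h y] over the triangle
    [a <= y < x < b]. *)
Lemma fubini_triangle F f H h a b : is_primitive F f -> is_primitive H h -> a <= b ->
  li a b (fun x => f x * (H x - H a)) = li a b (fun y => h y * (F b - F y)).
Proof.
move=> [lf HF] [lh HH] ab; have [mf If] := lf; have [mh Ih] := lh.
pose D : set R := `[a, b[%classic.
pose f1 : R -> R := f \_ D; pose h1 : R -> R := h \_ D.
have mD : measurable (D : set (measurableTypeR R)) by exact: measurable_itvco.
have If1 : mu.-integrable setT (EFin \o f1).
  by have := If a b; rewrite integrable_mkcond// restrict_EFin.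
have Ih1 : mu.-integrable setT (EFin \o h1).
  by have := Ih a b; rewrite integrable_mkcond// restrict_EFin.
pose E : set (R * R) := [set w | w.2 < w.1].
have mE : measurable (E : set (measurableTypeR R * measurableTypeR R)).
  rewrite (_ : E = (fun w : measurableTypeR R * measurableTypeR R => w.1 - w.2) @^-1` `]0, +oo[).
    rewrite -[X in measurable X]setTI; apply: measurable_funB => //; exact: measurable_itv.
  by apply/seteqP; split => w /=; rewrite in_itv/= andbT subr_gt0.
pose g (w : R * R) : R := f1 w.1 * h1 w.2 * \1_E w.
have If1h1 := prod_integrable If1 Ih1.
have Ig : (mu \x mu)%E.-integrable setT (EFin \o g).
  apply: (le_integrable _ _ _ If1h1) => //.
    apply/measurable_EFinP; apply: measurable_funM; last exact: measurable_indic.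
    by have /measurable_EFinP := measurable_int _ If1h1.
  move=> w _ /=; rewrite lee_fin normrM ler_piMr// indicE normr_nat.
  by case: (_ \in _).
have Fub := Fubini Ig.
have in1 x : (\int[mu]_y (EFin \o g) (x, y) = (f1 x * li a x h)%:E)%E.
  have gx y : g (x, y) = f1 x * (h \_ `[a, x[) y.
    rewrite /g /f1 /h1 !patchE indicE /D; case: ifPn => [|_]; last by rewrite !mul0r.
    rewrite inE/= in_itv/= => /andP[ax xb]; rewrite -mulrA; congr (_ * _).
    rewrite (_ : ((x, y) \in E) = (y < x)); last by apply/idP/idP; rewrite inE.
    rewrite (_ : (y \in _) = (a <= y < b)); last by apply/idP/idP; rewrite inE/= in_itv.
    rewrite (_ : (y \in _) = (a <= y < x)); last by apply/idP/idP; rewrite inE/= in_itv.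
    case: (ltP y x) => yx; last by rewrite mulr0 andbF.
    by rewrite mulr1 (lt_trans yx xb).
  have Ihx : mu.-integrable setT (EFin \o (h \_ `[a, x[)).
    by have := Ih a x; rewrite integrable_mkcond// restrict_EFin.
  under eq_integral do rewrite /= gx.
  rewrite -EFin_Rint; [|exact: measurableT|exact: (integrableZl measurableT (f1 x) Ihx)].
  by rewrite (RintegralZl _ measurableT Ihx) -Rintegral_mkcond.
have in2 y : (\int[mu]_x (EFin \o g) (x, y) = (h1 y * li y b f)%:E)%E.
  have gx x : g (x, y) = h1 y * (f \_ `]y, b[) x.
    rewrite /g /f1 /h1 !patchE indicE /D mulrAC mulrC; case: ifPn => [|_]; last by rewrite !mul0r.
    rewrite inE/= in_itv/= => /andP[ay yb]; congr (_ * _).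
    rewrite (_ : ((x, y) \in E) = (y < x)); last by apply/idP/idP; rewrite inE.
    rewrite (_ : (x \in _) = (a <= x < b)); last by apply/idP/idP; rewrite inE/= in_itv.
    rewrite (_ : (x \in _) = (y < x < b)); last by apply/idP/idP; rewrite inE/= in_itv.
    case: (ltP y x) => yx; last by rewrite mulr0.
    by rewrite mulr1 (le_trans ay (ltW yx)).
  have Ifo : mu.-integrable `]y, b[ (EFin \o f).
    by apply: integrableS (If y b) => //; apply: subset_itvr; rewrite bnd_simp.
  have Ify : mu.-integrable setT (EFin \o (f \_ `]y, b[)).
    by move: Ifo; rewrite integrable_mkcond// restrict_EFin.
  under eq_integral do rewrite /= gx.
  rewrite -EFin_Rint; [|exact: measurableT|exact: (integrableZl measurableT (h1 y) Ify)].
  by rewrite (RintegralZl _ measurableT Ify) -Rintegral_mkcond Rintegral_itv_obnd_cbnd.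
have {}Fub : (\int[mu]_x (f1 x * li a x h)%:E = \int[mu]_y (h1 y * li y b f)%:E)%E.
  have e1 : (\int[mu]_x (f1 x * li a x h)%:E = \int[mu]_x \int[mu]_y (EFin \o g) (x, y))%E.
    by apply: eq_integral => x _; rewrite in1.
  have e2 : (\int[mu]_y (h1 y * li y b f)%:E = \int[mu]_y \int[mu]_x (EFin \o g) (x, y))%E.
    by apply: eq_integral => y _; rewrite in2.
  rewrite e1 e2; exact: Fub.
have Fub2 : \int[mu]_x (f1 x * li a x h) = \int[mu]_y (h1 y * li y b f).
  by rewrite /Rintegral Fub.
have P1 : \int[mu]_x (f1 x * li a x h) = li a b (fun x => f x * (H x - H a)).
  rewrite [in RHS]/li [RHS]Rintegral_mkcond; apply: eq_Rintegral => x _.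
  rewrite /f1 !patchE; case: ifPn => [|_]; last by rewrite mul0r.
  by rewrite /D inE/= in_itv/= => /andP[ax _]; rewrite HH.
have P2 : \int[mu]_y (h1 y * li y b f) = li a b (fun y => h y * (F b - F y)).
  rewrite [in RHS]/li [RHS]Rintegral_mkcond; apply: eq_Rintegral => y _.
  rewrite /h1 !patchE; case: ifPn => [|_]; last by rewrite mul0r.
  by rewrite /D inE/= in_itv/= => /andP[_ /ltW yb]; rewrite HF.
by rewrite -P1 -P2.
Qed.

(** The product rule is integration by parts, which is the exchange of the
    order of integration on a triangle. *)
Lemma primitiveM F f H h : is_primitive F f -> is_primitive H h -> is_primitive (fun x => F x * H x) (fun x => F x * h x + H x * f x).
Proof.
move=> AF AH; have [lf HF] := AF; have [lh HH] := AH.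
have lFh := lint_primitiveM AF lh; have lHf := lint_primitiveM AH lf.
split => [|a b ab]; first exact: lintD.
have := fubini_triangle AF AH ab.
rewrite (eq_li (g := fun x => H x * f x - H a * f x)); last by move=> x; ring.
rewrite [in RHS](eq_li (g := fun x => F b * h x - F x * h x)); last by move=> x; ring.
rewrite !liB ?liZ ?liD//; try exact: lintZ.
by rewrite -(HF a b)// -(HH a b)// => E; lra.
Qed.

Lemma C1_primitive F f : (forall x, is_derive x (1 : R) F (f x)) -> continuous f -> is_primitive F f.
Proof.
move=> dF cf.
have mf : measurable_fun setT f by exact: continuous_measurable_fun.
have Icc a b : mu.-integrable `[a, b] (EFin \o f).
  apply: continuous_compact_integrable; first exact: segment_compact.
  exact: continuous_subspaceT.
have lf : lint f.
  by split => // a b; apply: integrableS (Icc a b) => //; by apply: subset_itvl; rewrite bnd_simp.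
split => // a b; rewrite le_eqVlt => /predU1P[->|ab].
  by rewrite subrr li_nil.
have cF : continuous F.
  by move=> x; apply: differentiable_continuous; apply/derivable1_diffP; have [] := dF x.
have := @continuous_FTC2 R f F a b ab.
move=> /(_ (continuous_subspaceT cf)) H.
rewrite /li Rintegral_itv_bndo_bndc; last exact: (proj2 lf).
rewrite /Rintegral H//.
- split.
  + by move=> x _; have [] := dF x.
  + by apply: cvg_at_right_filter; exact: cF.
  + by apply: cvg_at_left_filter; exact: cF.
- by move=> x _; rewrite derive1E; have [_ ->] := dF x.
Qed.

End abs_cont.

(** * Test functions and weak derivatives *)

Section test_functions.
Context {R : realType}.
Local Notation mu := (@lebesgue_measure R).
Local Notation T := (@circumference R).
Implicit Types (f g h F G H u w phi psi : R -> R) (a b c : R).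

(** Smoothness of a function is obtained by placing it in an algebra stable
    under differentiation, generated here by sine, cosine and one function
    whose derivative lies in the algebra. *)
Inductive test_algebra (rho : R -> R) : (R -> R) -> Prop :=
| test_algebra_cst c : test_algebra rho (fun=> c)
| test_algebra_cos : test_algebra rho (@cos R)
| test_algebra_sin : test_algebra rho (@sin R)
| test_algebra_gen : test_algebra rho rho
| test_algebra_add f g : test_algebra rho f -> test_algebra rho g -> test_algebra rho (fun x => f x + g x)
| test_algebra_mul f g : test_algebra rho f -> test_algebra rho g -> test_algebra rho (fun x => f x * g x).

Lemma test_algebra_opp rho f : test_algebra rho f -> test_algebra rho (fun x => - f x).
Proof.
move=> sf; rewrite (_ : (fun x => _) = (fun x => (fun=> -1) x * f x)).
  by apply: test_algebra_mul => //; exact: test_algebra_cst.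
by apply/funext => x; rewrite mulN1r.
Qed.

Lemma test_algebra_derive rho rho' : test_algebra rho rho' ->
  (forall x, is_derive x (1 : R) rho (rho' x)) ->
  forall f, test_algebra rho f -> exists2 f', test_algebra rho f' & forall x, is_derive x (1 : R) f (f' x).
Proof.
move=> srho' drho f; elim => [c| | | |{}f g sf [f' sf' df'] sg [g' sg' dg']|{}f g sf [f' sf' df'] sg [g' sg' dg']].
- by exists (fun=> 0) => [|x]; [exact: test_algebra_cst|exact: is_derive_cst].
- exists (fun x => - sin x) => [|x]; last exact: is_derive_cos.
  exact/test_algebra_opp/test_algebra_sin.
- exists cos => [|x]; last exact: is_derive_sin.
  exact: test_algebra_cos.
- by exists rho'.
- exists (fun x => f' x + g' x) => [|x]; first exact: test_algebra_add.
  exact: (is_deriveD (df' x) (dg' x)).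
- exists (fun x => f x * g' x + g x * f' x) => [|x].
    by apply: test_algebra_add; exact: test_algebra_mul.
  exact: (is_deriveM (df' x) (dg' x)).
Qed.

Lemma test_algebra_test rho rho' f : test_algebra rho rho' ->
  (forall x, is_derive x (1 : R) rho (rho' x)) ->
  test_algebra rho f -> on_circle f -> test_function f.
Proof.
move=> srho' drho sf pf; split => // k x.
suff : test_algebra rho (derive1n k f).
  by move=> /(test_algebra_derive srho' drho)[g _ /(_ x)[]].
elim: k => [//|k IH] /=.
have [g sg dg] := test_algebra_derive srho' drho IH.
rewrite (_ : derive1 _ = g)//; apply/funext => y; rewrite derive1E.
by have [_ ->] := dg y.
Qed.

Section bump.
Variables (N A B C : R).
Let s x := A * cos x + B * sin x + C.
(** A logistic function of a trigonometric polynomial of degree one.  It is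
    smooth, periodic, and has values between 0 and 1; as [N] grows it tends to
    the indicator of the arc on which the trigonometric polynomial is
    positive.  So indicators of arcs are limits of test functions without any
    compactly supported smooth function. *)
Definition bump x : R := (1 + expR (- (N * s x)))^-1.

Let s' x := - A * sin x + B * cos x.
(* The logistic function [r] satisfies [r' = r (1 - r)]. *)
Let bump' x := N * s' x * (bump x * (1 - bump x)).

Let ds x : is_derive x (1 : R) s (s' x).
Proof.
have d1 := is_deriveM (is_derive_cst A x 1) (is_derive_cos x).
have d2 := is_deriveM (is_derive_cst B x 1) (is_derive_sin x).
have d3 := is_deriveD (is_deriveD d1 d2) (is_derive_cst C x 1).
apply: is_derive_eq d3 _.
by rewrite /s' !scaler0 !addr0 /= /GRing.scale/=; ring.
Qed.

Let den_gt0 x : 0 < 1 + expR (- (N * s x)).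
Proof. by rewrite addr_gt0 ?expR_gt0. Qed.

Let dbump x : is_derive x (1 : R) bump (bump' x).
Proof.
have d1 : is_derive x (1 : R) (fun x => - (N * s x)) (- (N * s' x)).
  have d := is_deriveN (is_deriveM (is_derive_cst N x 1) (ds x)).
  by apply: is_derive_eq d _; rewrite scaler0 addr0.
have d2 := is_derive1_comp (is_derive_expR _) d1.
have d3 := is_deriveD (is_derive_cst (1 : R) x 1) d2.
have d4 := @is_deriveV _ (fun x => 1 + expR (- (N * s x))) x _ 1 (lt0r_neq0 (den_gt0 x)) d3.
apply: is_derive_eq d4 _.
rewrite /bump' /bump /= /GRing.scale/= add0r.
by field; exact: lt0r_neq0 (den_gt0 x).
Qed.

Lemma bump_test : test_function bump.
Proof.
apply: (@test_algebra_test bump bump') => //.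
- apply: test_algebra_mul.
    apply: test_algebra_mul; first exact: test_algebra_cst.
    by apply: test_algebra_add; apply: test_algebra_mul; [exact: test_algebra_cst|exact: test_algebra_sin|exact: test_algebra_cst|exact: test_algebra_cos].
  apply: test_algebra_mul; first exact: test_algebra_gen.
  by apply: test_algebra_add; [exact: test_algebra_cst|exact/test_algebra_opp/test_algebra_gen].
- exact: test_algebra_gen.
- move=> x; rewrite /bump /s.
  by rewrite (cosD2pi x) (sinD2pi x).
Qed.

Lemma bump_le1 x : 0 <= bump x <= 1.
Proof.
rewrite /bump invr_ge0 (ltW (den_gt0 x))/=.
by rewrite invf_le1// lerDl expR_ge0.
Qed.
End bump.

Lemma test_cst c : test_function (fun=> c).
Proof.
apply: (@test_algebra_test (fun=> 0) (fun=> 0)) => //; first exact: test_algebra_cst.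
exact: test_algebra_cst.
Qed.

Lemma bump_cvg1 A B C x : 0 < A * cos x + B * sin x + C ->
  bump n%:R A B C x @[n --> \oo] --> (1 : R).
Proof.
move=> s0; rewrite /bump; set s := _ + C in s0 *.
rewrite -[X in _ --> X]invr1; apply: cvgV; first by rewrite oner_eq0.
rewrite -[X in _ --> X]addr0; apply: cvgD; first exact: cvg_cst.
rewrite (_ : (fun n : nat => _) = (fun n => expR (- s) ^+ n)).
  by apply: cvg_expr; rewrite ger0_norm ?expR_ge0// -expR0 ltr_expR oppr_lt0.
by apply/funext => n; rewrite -expRM_natl mulrN.
Qed.

Lemma bump_cvg0 A B C x : A * cos x + B * sin x + C < 0 ->
  bump n%:R A B C x @[n --> \oo] --> (0 : R).
Proof.
move=> s0; rewrite /bump; set s := _ + C in s0 *.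
have c : expR s ^+ n @[n --> \oo] --> (0 : R).
  by apply: cvg_expr; rewrite ger0_norm ?expR_ge0// -expR0 ltr_expR.
apply: (squeeze_cvgr _ (cvg_cst 0) c); apply: nearW => n.
rewrite invr_ge0 addr_ge0 ?expR_ge0//= -expRM_natl expRN.
have e0 := expR_gt0 (n%:R * s).
rewrite -[leRHS]invrK lef_pV2 ?posrE ?invr_gt0//; first by rewrite lerDr.
Qed.

(** The trigonometric polynomial is [cos (x - m) - cos h], with [m] the
    midpoint and [h] half the length of the arc. *)
Lemma arc_sign a b x : - pi < a -> a < b -> b < pi -> circle x ->
  let m := (a + b) / 2 in let h := (b - a) / 2 in
  (a < x < b -> 0 < cos m * cos x + sin m * sin x - cos h) /\
  ((x < a) || (b < x) -> cos m * cos x + sin m * sin x - cos h < 0).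
Proof.
move=> pa ab bp cx m h; have /andP[px xp] : - pi <= x < pi by move: cx; rewrite /circle/= in_itv.
have E : cos m * cos x + sin m * sin x = cos `|x - m|.
  have -> : cos `|x - m| = cos (x - m) by case: (ger0P (x - m)) => // _; rewrite cosN.
  by rewrite cosB; ring.
have h0 : 0 <= h <= pi by rewrite /h; apply/andP; split; lra.
have dec (y z : R) : 0 <= y -> y < z -> z <= pi -> cos z < cos y.
  move=> y0 yz zp; have yI : y \in `[0, pi] by rewrite in_itv/=; apply/andP; split; lra.
  have zI : z \in `[0, pi] by rewrite in_itv/=; apply/andP; split; lra.
  by rewrite ltr_cos.
split=> H; rewrite E ?subr_gt0 ?subr_lt0.
  apply: dec; [exact: normr_ge0| |by case/andP: h0].
  by rewrite ltr_norml /h /m; move: H; lra.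
have xm : h < `|x - m|.
  by rewrite ltr_normr /h /m; case/orP: H => H; apply/orP; [right|left]; lra.
have xm2 : `|x - m| < pi *+ 2 - h.
  by rewrite ltr_norml /h /m mulr2n; apply/andP; split; lra.
have [xmp|xmp] := leP `|x - m| pi; first by apply: dec => //; case/andP: h0.
rewrite -[ltLHS]cosN -(cosD2pi (- `|x - m|)).
move: xm2; rewrite mulr2n => xm2.
apply: dec; [by case/andP: h0|lra|lra].
Qed.

Lemma ae_neq a : {ae mu, forall x : R, x != a}.
Proof.
exists [set a]; split => //; first exact: lebesgue_measure_set1.
by move=> x /= /negP; rewrite negbK => /eqP.
Qed.

(** Dominated convergence along the bump functions of the arc. *)
Lemma pair_arc u a b : L1c u -> (forall phi, test_function phi -> ci (fun x => phi x * u x) = 0) ->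
  - pi < a -> a < b -> b < pi -> li a b u = 0.
Proof.
move=> [pu mu' Iu] Hu pa ab bp.
pose m := (a + b) / 2; pose h := (b - a) / 2.
pose f_ n x := bump n%:R (cos m) (sin m) (- cos h) x * u x.
pose f x := if a <= x < b then u x else 0.
have mb n : measurable_fun setT (bump n%:R (cos m) (sin m) (- cos h)).
  apply: continuous_measurable_fun => x.
  have [_ /(_ 0%N x) d] := bump_test n%:R (cos m) (sin m) (- cos h).
  by apply: differentiable_continuous; exact/derivable1_diffP.
have mf_ n : measurable_fun circle (EFin \o f_ n).
  by apply/measurable_EFinP; apply: measurable_funTS; exact: measurable_funM.
have mf : measurable_fun circle (EFin \o f).
  apply/measurable_EFinP; apply: measurable_funTS.
  rewrite (_ : f = u \_ `[a, b[).
    apply/(measurable_restrictT _ _).1; first exact: measurable_itv.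
    exact: (measurable_funTS mu').
  by apply/funext => x; rewrite /f patchE mem_setE in_itv.
have cv : {ae mu, forall x, circle x -> (EFin \o f_ n) x @[n --> \oo] --> (EFin \o f) x}.
  apply: ae_imp (ae_and (ae_neq a) (ae_neq b)) => x [xa xb] cx.
  apply: cvg_EFin; first exact: nearW.
  rewrite (_ : fine \o _ = f_^~ x); last by [].
  have [s1 s2] := arc_sign pa ab bp cx; rewrite /f.
  case: ifPn.
    move=> /andP[ax xb']; rewrite -[X in _ --> X]mul1r; apply: cvgM; last exact: cvg_cst.
    by apply: bump_cvg1; apply: s1; rewrite lt_neqAle eq_sym xa ax.
  move=> /negP H; rewrite -(mul0r (u x)); apply: cvgM; last exact: cvg_cst.
  apply: bump_cvg0; apply: s2; case: (ltP x a) => //= ax.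
  rewrite ltNge; apply/negP => xb'; apply: H; rewrite ax lt_neqAle xb//.
have Iabs := Cint_abs Iu.
have dom : {ae mu, forall x n, circle x -> (`|(EFin \o f_ n) x| <= (`|u x|)%:E)%E}.
  apply: aeW => x n _ /=; rewrite lee_fin normrM ler_piMl//.
  by have /andP[b0 b1] := bump_le1 n%:R (cos m) (sin m) (- cos h) x; rewrite ger0_norm.
have [If _ lim] := dominated_convergence mcircle mf_ mf cv Iabs dom.
have seq0 n : (\int[mu]_(x in circle) (EFin \o f_ n) x)%E = 0%E.
  have := Hu _ (bump_test n%:R (cos m) (sin m) (- cos h)); rewrite /ci => E.
  rewrite -(EFin_Rint mcircle) ?E//.
  apply: (@Cint_le _ _ (fun x => `|u x|)); [exact: measurable_funM|exact: Iabs|].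
  move=> x; rewrite normrM ler_piMl//.
  by have /andP[b0 b1] := bump_le1 n%:R (cos m) (sin m) (- cos h) x; rewrite ger0_norm.
have : (\int[mu]_(x in circle) (EFin \o f) x)%E = 0%E.
  apply/esym; apply: (cvg_unique (@ereal_hausdorff R) _ lim).
  rewrite (_ : [sequence _]_n = cst 0%E); first exact: cvg_cst.
  by apply/funext => n /=; rewrite seq0.
rewrite /li /Rintegral => E.
rewrite (_ : (\int[mu]_(x in `[a, b[) (u x)%:E)%E = 0%E)//.
apply: etrans E; rewrite (_ : EFin \o f = (EFin \o u) \_ `[a, b[).
  rewrite -integral_mkcondr; congr integral; apply/esym/setIidPr => x /=.
  by rewrite /circle/= !in_itv/=; lra.
by apply/funext => x; rewrite /f patchE mem_setE in_itv /=; case: ifP.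
Qed.

(** All integrals over arcs vanish, so the primitive is constant and Lebesgue's
    differentiation theorem applies. *)
Lemma du_bois_reymond0 u : L1c u -> (forall phi, test_function phi -> ci (fun x => phi x * u x) = 0) ->
  {ae mu, forall x, circle x -> u x = 0}.
Proof.
move=> Lu Hu; have lu := L1c_lint Lu.
have AU := prim_primitive lu; have cU := primitive_continuous AU.
have [mu' Iu] := lu.
have pi0 := pi_gt0 R.
have Uc b : - pi < b -> b < pi -> prim u b = prim u (- pi).
  move=> pb bp.
  have : prim u a @[a --> (- pi)^'+] --> prim u b.
    apply: cvg_near_cst; near=> a.
    have ab : a < b by near: a; exact: nbhs_right_lt.
    have pa : - pi < a by near: a; exact: nbhs_right_gt.
    have := pair_arc Lu Hu pa ab bp.
    by have [_ H] := AU; rewrite -(H a b (ltW ab)) => /eqP; rewrite subr_eq0 => /eqP ->.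
  have c2 := cvg_at_right_filter (cU (- pi)).
  by move=> c1; exact: (cvg_unique _ c1 c2).
have locu : locally_integrable setT u.
  split => //; first exact: openT.
  move=> K _ cK; have [M [_ HM]] := compact_bounded cK.
  have HM1 := HM (M + 1) ltac:(by rewrite ltrDl).
  have /integrableP[_ foo] := Iu (- (M + 1)) (M + 2).
  apply: le_lt_trans foo; apply: ge0_subset_integral => //.
  - exact: compact_measurable.
  - by apply/measurable_EFinP; apply: measurable_funTS; exact: measurableT_comp.
  - by move=> x Kx /=; rewrite in_itv/=; have := HM1 x Kx; rewrite /= ler_norml; lra.
have Icc y : mu.-integrable [set` Interval (BLeft (- pi)) (BRight y)] (EFin \o u).
  by apply: integrableS (Iu (- pi) (y + 1)) => //; apply: subset_itvl; rewrite bnd_simp; lra.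
have := @FTC1 R u (BLeft (- pi)) Icc locu.
move=> H; apply: ae_imp (ae_and H (ae_neq (- pi))) => x [Hx xp].
rewrite /circle/= in_itv/= => /andP[px xpi].
have px' : - pi < x by rewrite lt_neqAle eq_sym xp px.
have [|_ <-] := Hx; first by rewrite /= lte_fin.
rewrite derive1E (@near_eq_derive _ _ _ _ (cst 0)) ?derive_cst//.
near=> y.
have py : - pi < y by near: y; exact: lt_nbhsr.
have yp : y < pi by near: y; exact: lt_nbhsl.
have := Uc y py yp; have [_ HU] := AU.
rewrite /= -Rintegral_itv_bndo_bndc; last exact: Iu.
by move=> E; rewrite -[LHS]/(li _ _ _) -HU ?E ?subrr// ltW.
Unshelve. all: by end_near. Qed.

Lemma primitive_derive F f x : is_primitive F f -> {for x, continuous f} -> is_derive x (1 : R) F (f x).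
Proof.
move=> AF cf; have [[mf If] HF] := AF.
have Icc : mu.-integrable `[x - 1, x + 1] (EFin \o f).
  by apply: integrableS (If (x - 1) (x + 2)) => //; apply: subset_itvl; rewrite bnd_simp; lra.
have x1 : x < x + 1 by lra.
have x2 : x - 1 < x by lra.
have [d1 d2] := continuous_FTC1_closed x1 Icc x2 cf.
pose G y := \int[mu]_(t in `[x - 1, y]) f t.
have dG : is_derive x (1 : R) G (f x) by apply: DeriveDef; [exact: d1|rewrite -derive1E; exact: d2].
have dFG : is_derive x (1 : R) (fun y => F (x - 1) + G y) (f x).
  have := is_deriveD (is_derive_cst (F (x - 1)) x 1) dG; by rewrite add0r.
apply: near_eq_is_derive dFG; near=> y.
have xy : x - 1 <= y.
  have : `|x - y| < 1 by near: y; apply: cvgr_dist_lt => //; exact: cvg_id.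
  by rewrite ltr_norml; lra.
rewrite /G /= -Rintegral_itv_bndo_bndc//.
by rewrite -[X in _ + X]/(li _ _ _) -HF//; ring.
Unshelve. all: by end_near. Qed.

Lemma test_cont phi k : test_function phi -> continuous (derive1n k phi).
Proof.
move=> [_ d] x; apply: differentiable_continuous; apply/derivable1_diffP; exact: d.
Qed.

Lemma test_addc c phi : test_function phi -> test_function (fun x => phi x + c).
Proof.
move=> [pf d]; split; first by move=> x; rewrite pf.
have dc f x : derivable f x (1 : R) -> is_derive x (1 : R) (fun x => f x + c) (derive1 f x).
  move=> df; have df' : is_derive x (1 : R) f (derive1 f x) by split => //; rewrite derive1E.
  by have := is_deriveD df' (is_derive_cst c x 1); rewrite addr0.
move=> [|k] x; first by have [] := dc phi x (d 0%N x).
rewrite /derive1n iterSr (_ : derive1 _ = derive1 phi).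
  by have := d k.+1 x; rewrite /derive1n iterSr.
by apply/funext => y; rewrite derive1E; have [_ ->] := dc phi y (d 0%N y).
Qed.

Lemma derive1_per f : per f -> per (derive1 f).
Proof.
move=> pf x; rewrite /derive1.
suff -> : (fun h : R => h^-1 *: (f (h + (x + T)) - f (x + T))) = (fun h : R => h^-1 *: (f (h + x) - f x)) by [].
by apply/funext => h; rewrite addrA !pf.
Qed.

Lemma test_derive phi : test_function phi -> test_function (derive1 phi).
Proof.
move=> [pf d]; split; first exact: derive1_per.
by move=> k x; have := d k.+1 x; rewrite /derive1n iterSr.
Qed.

Lemma test_primitive phi : test_function phi -> is_primitive phi (derive1 phi).
Proof.
move=> tphi; apply: C1_primitive; last exact: (@test_cont phi 1%N tphi).
move=> x; split; first by have [_ /(_ 0%N x)] := tphi.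
by rewrite derive1E.
Qed.

Lemma periodic_primitive_bdd F f : is_primitive F f -> per F -> exists M, forall x, `|F x| <= M.
Proof.
move=> AF pF; exists (`|F (- pi)| + li (- pi) pi (fun x => `|f x|)) => x.
have T0 := @circumference_gt0 R.
pose k := Num.floor ((x + pi) / T).
have perz (z : int) y : F (y + z%:~R * T) = F y.
  have Hn n v : F (v + n%:R * T) = F v.
    elim: n => [|n IH]; first by rewrite mul0r addr0.
    by rewrite -[n.+1%:R]natr1 mulrDl mul1r addrA pF IH.
  case: z => n; first exact: Hn.
  by rewrite NegzE -(Hn n.+1) mulrNz mulNr subrK.
have -> : F x = F (x - k%:~R * T) by rewrite -[RHS](perz k) subrK.
apply: primitive_bound => //.
have /andP[h1 h2] := floor_itv ((x + pi) / T); rewrite -/k in h1 h2.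
move: h1 h2; rewrite ler_pdivlMr// ltr_pdivrMr// intrD.
have -> : T = pi + pi by rewrite /T mulr2n.
by move=> h1 h2; apply/andP; split; lra.
Qed.

Lemma test_bdd phi : test_function phi -> exists M, forall x, `|phi x| <= M.
Proof. by move=> tp; apply: (periodic_primitive_bdd (test_primitive tp)); case: tp. Qed.

Lemma test_meas phi : test_function phi -> measurable_fun setT phi.
Proof. by move=> /test_primitive/primitive_measurable. Qed.

Lemma L1c_test phi f : test_function phi -> L1c f -> L1c (fun x => phi x * f x).
Proof.
move=> tp Lf; have [M HM] := test_bdd tp; apply: (L1c_bddM _ _ HM) => //.
- by case: tp.
- exact: test_meas.
Qed.

Lemma per_prim f : L1c f -> ci f = 0 -> per (prim f).
Proof.
move=> Lf f0 x; have [_ H] := prim_primitive (L1c_lint Lf).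
have T0 := @circumference_gt0 R.
have := H x (x + T); rewrite lerDl (ltW T0) => /(_ isT).
by rewrite li_period// f0 => /eqP; rewrite subr_eq0 => /eqP.
Qed.

Lemma ci_periodic_derivative F f : is_primitive F f -> per F -> ci f = 0.
Proof.
move=> [lf HF] pF; rewrite -li_circle -HF; last first.
  by have := pi_gt0 R; lra.
by rewrite -(pF (- pi)) (_ : - pi + T = pi) ?subrr// /T mulr2n; ring.
Qed.

Lemma L2c_periodic_primitive F f : is_primitive F f -> per F -> L2c F.
Proof.
move=> AF pF; have [M HM] := periodic_primitive_bdd AF pF.
by apply: (L2c_bdd _ _ HM) => //; exact: primitive_measurable AF.
Qed.

(** A test function minus its mean has a periodic primitive, which is again a
    test function; hence [u] minus its mean annihilates every test function. *)
Lemma du_bois_reymond u : L1c u -> (forall phi, test_function phi -> ci (fun x => derive1 phi x * u x) = 0) ->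
  exists c, {ae mu, forall x, circle x -> u x = c}.
Proof.
move=> Lu Hu; exists (ci u / T); have T0 := @circumference_gt0 R.
have [pu mu' Iu] := Lu.
have Lc c : L1c (fun=> c : R) by apply: L2_L1; exact: L2c_cst.
suff H : {ae mu, forall x, circle x -> u x - ci u / T = 0}.
  by apply: ae_imp H => x H cx; apply/eqP; rewrite -subr_eq0 H.
apply: du_bois_reymond0; first exact: (L1cB Lu (Lc _)).
move=> psi tpsi; pose mp := ci psi / T.
have Lpsi : L1c psi by apply: L2_L1; apply: (L2c_periodic_primitive (test_primitive tpsi)); case: tpsi.
have Lq : L1c (fun x => psi x - mp) := L1cB Lpsi (Lc mp).
have q0 : ci (fun x => psi x - mp) = 0.
  have [_ _ I1] := Lpsi; have [_ _ I2] := Lc mp.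
  by rewrite ciB// (ci_cst mp) /mp divfK ?subrr// gt_eqF.
pose phi := prim (fun x => psi x - mp).
have cq : continuous (fun x => psi x - mp).
  by move=> x; apply: cvgB; [exact: (@test_cont psi 0%N tpsi)|exact: cvg_cst].
have dphi : derive1 phi = (fun x => psi x - mp).
  apply/funext => x; rewrite derive1E.
  by have [_ ->] := primitive_derive (prim_primitive (L1c_lint Lq)) (cq x).
have tphi : test_function phi.
  split; first exact: per_prim.
  move=> [|k] x; first by have [] := primitive_derive (prim_primitive (L1c_lint Lq)) (cq x).
  by rewrite /derive1n iterSr dphi; have [_ /(_ k x)] := test_addc (- mp) tpsi.
have := Hu _ tphi; rewrite dphi => E.
have L1 := L1c_test tpsi Lu; have [_ _ I1] := L1.
have [_ _ Ipsi] := Lpsi.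
move: E; rewrite (@eq_ci _ _ (fun x => psi x * u x - mp * u x)); last by move=> x; ring.
rewrite ciB//; last exact: CintZ.
rewrite ciZ// => E.
rewrite (@eq_ci _ _ (fun x => psi x * u x - ci u / T * psi x)); last by move=> x; ring.
rewrite ciB//; last exact: CintZ.
rewrite ciZ//; move: E; rewrite /mp; lra.
Qed.

(** Testing against a constant shows that [h] has mean zero, so that its
    primitive is periodic; the difference of [w] and this primitive has zero
    weak derivative. *)
Lemma weak_derivative_primitive w h : L1c w -> L1c h ->
  (forall phi, test_function phi -> ci (fun x => derive1 phi x * w x) = - ci (fun x => phi x * h x)) ->
  exists W : R -> R, [/\ is_primitive W h, per W, ci h = 0 & {ae mu, forall x, circle x -> w x = W x}].
Proof.
move=> Lw Lh Hwh.
have h0 : ci h = 0.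
  have := Hwh _ (test_cst 1).
  rewrite (@eq_ci _ _ (fun=> 0)); last by move=> x; rewrite derive1_cst mul0r.
  rewrite (ci_cst 0) mul0r (@eq_ci _ _ h); last by move=> x; rewrite mul1r.
  by move=> /esym/eqP; rewrite oppr_eq0 => /eqP.
have AH := prim_primitive (L1c_lint Lh); have pH := per_prim Lh h0.
have LH := L2_L1 (L2c_periodic_primitive AH pH).
have [phi|c Hc] := @du_bois_reymond (fun x => w x - prim h x) (L1cB Lw LH).
  move=> tphi; have td := test_derive tphi.
  rewrite (@eq_ci _ _ (fun x => derive1 phi x * w x - derive1 phi x * prim h x)); last by move=> x; ring.
  have [_ _ I1] := L1c_test td Lw; have [_ _ I2] := L1c_test td LH.
  have [_ _ I3] := L1c_test tphi Lh.
  rewrite ciB// Hwh//.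
  have AM := primitiveM (test_primitive tphi) AH.
  have : ci (fun x => phi x * h x + prim h x * derive1 phi x) = 0.
    apply: (ci_periodic_derivative AM) => x; rewrite pH; by case: tphi => ->.
  rewrite (@eq_ci _ _ (fun x => phi x * h x + derive1 phi x * prim h x)); last by move=> x; ring.
  rewrite ciD// => E; lra.
exists (fun x => c + prim h x); split => //.
- have := primitiveD (primitive_cst c) AH; congr is_primitive; by apply/funext => x; rewrite add0r.
- by move=> x; rewrite pH.
- by apply: ae_imp Hc => x H cx; rewrite -(H cx) subrK.
Qed.

End test_functions.

(** * Correlation integrals *)

Section correlation.
Context {R : realType}.
Local Notation mu := (@lebesgue_measure R).
Local Notation T := (@circumference R).
Implicit Types (f g h a b s : R -> R).

Lemma measurable_param (F : R * R -> R) :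
  measurable_fun (setT : set (measurableTypeR R * measurableTypeR R)) F ->
  measurable_fun setT (fun z : R => ci (fun d => F (z, d))).
Proof.
move=> mF.
have sec z (f : R * R -> \bar R) : (\int[mu]_(d in circle) f (z, d) =
   \int[mu]_d (f \_ (setT `*` circle)) (z, d))%E.
  rewrite integral_mkcond; apply: eq_integral => d _.
  rewrite !patchE; congr (if _ then _ else _).
  by apply/idP/idP; rewrite !inE => // -[].
have msec (f : R * R -> \bar R) : (forall w, 0 <= f w)%E ->
    measurable_fun (setT : set (measurableTypeR R * measurableTypeR R)) f ->
    measurable_fun setT (fun z : R => \int[mu]_(d in circle) f (z, d))%E.
  move=> f0 mf; rewrite (_ : (fun z => _) = (fun z => \int[mu]_d (f \_ (setT `*` circle)) (z, d))%E).
    apply: measurable_fun_fubini_tonelli_F.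
      apply/(measurable_restrictT _ _).1.
        by apply: measurableX => //; exact: mcircle.
      exact: measurable_funTS.
    by move=> w; rewrite patchE; case: ifP.
  by apply/funext => z; exact: sec.
have mE : measurable_fun (setT : set (measurableTypeR R * measurableTypeR R)) (EFin \o F).
  exact/measurable_EFinP.
rewrite (_ : (fun z => _) = (fun z => fine (\int[mu]_(d in circle) ((EFin \o F)^\+ (z, d))
   - \int[mu]_(d in circle) ((EFin \o F)^\- (z, d)))%E)).
  apply: measurableT_comp; first exact: fine_measurable.
  apply: emeasurable_funB; apply: msec => //.
  - exact: measurable_funepos.
  - exact: measurable_funeneg.
apply/funext => z; rewrite /ci /Rintegral integralE; congr (fine (_ - _)%E).
- by apply: eq_integral => d _; rewrite !funepos.unlock.
- by apply: eq_integral => d _; rewrite !funeneg.unlock.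
Qed.

Lemma Cint_bddM M f g : measurable_fun setT g -> (forall x, `|g x| <= M) ->
  measurable_fun setT f -> Cint f -> Cint (fun x => g x * f x).
Proof.
move=> mg gM mf If; apply: (Cint_le _ (CintZ M (Cint_abs If))).
  exact: measurable_funM.
by move=> x; rewrite normrM ler_wpM2r.
Qed.

(** If [p] and [q] are carried by the flow in opposite directions, then
    [p(z + d) q(z - d)] pairs waves that meet at [z] at the time [d]. *)
Definition correlation s a b z : R := ci (fun d => s d * (a (z + d) * b (z - d))).

Lemma measurable_addl a (z : R) : measurable_fun setT a -> measurable_fun setT (fun d : R => a (z + d)).
Proof.
move=> ma; rewrite (_ : (fun d => _) = (fun d : R => a (d + z))).
  exact: measurable_shift.
by apply/funext => d; rewrite addrC.
Qed.

Lemma correlation_meas s a b : measurable_fun setT s -> measurable_fun setT a -> measurable_fun setT b ->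
  measurable_fun setT (correlation s a b).
Proof.
move=> ms ma mb.
apply: (@measurable_param (fun w => s w.2 * (a (w.1 + w.2) * b (w.1 - w.2)))).
apply: measurable_funM; first exact: (measurableT_comp ms).
apply: measurable_funM.
- by apply: (measurableT_comp ma); exact: measurable_funD.
- by apply: (measurableT_comp mb); exact: measurable_funB.
Qed.

(** Covers both uses: two square-integrable functions, and one integrable
    function (such as the damping term) against a bounded one. *)
Definition pairable a b := [/\ measurable_fun setT a, measurable_fun setT b &
  forall z, Cint (fun d => a (z + d) * b (z - d))].

Lemma pairable_meas a b z : pairable a b -> measurable_fun setT (fun d : R => a (z + d) * b (z - d)).
Proof.
by move=> [ma mb _]; apply: measurable_funM; [exact: measurable_addl|exact: measurable_reflect].
Qed.

Lemma L1c_addl z a : L1c a -> L1c (fun d => a (z + d)).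
Proof. by move=> /(L1c_shift z); congr L1c; apply/funext => d; rewrite addrC. Qed.
Lemma L2c_addl z a : L2c a -> L2c (fun d => a (z + d)).
Proof. by move=> /(L2c_shift z); congr L2c; apply/funext => d; rewrite addrC. Qed.

Lemma pairable_L2 a b : L2c a -> L2c b -> pairable a b.
Proof.
move=> La Lb; split; [by case: La|by case: Lb|move=> z].
by have [] := L2_mul (L2c_addl z La) (L2c_sub z Lb).
Qed.

Lemma pairable_L1b M a b : L1c a -> measurable_fun setT b -> (forall x, `|b x| <= M) -> pairable a b.
Proof.
move=> La mb bM; split=> //; [by case: La|move=> z].
have [_ m1 I1] := L1c_addl z La.
rewrite (_ : (fun d => _) = (fun d => b (z - d) * a (z + d))).
  by apply: (@Cint_bddM M) => //; exact: measurable_reflect.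
by apply/funext => d; rewrite mulrC.
Qed.

Lemma pairable_bL1 M a b : L1c b -> measurable_fun setT a -> (forall x, `|a x| <= M) -> pairable a b.
Proof.
move=> Lb ma aM; split=> //; [by case: Lb|move=> z].
have [_ m1 I1] := L1c_sub z Lb.
by apply: (@Cint_bddM M) => //; exact: measurable_addl.
Qed.

Definition nrm a : R := Num.sqrt (ip a a).

Lemma nrm_ge0 a : 0 <= nrm a. Proof. exact: sqrtr_ge0. Qed.
Lemma nrm_sqr a : nrm a ^+ 2 = ip a a. Proof. by rewrite sqr_sqrtr// ip_ge0. Qed.

Lemma CS_nrm a b : L2c a -> L2c b -> `|ip a b| <= nrm a * nrm b.
Proof.
move=> La Lb; have n0 : 0 <= nrm a * nrm b by rewrite mulr_ge0 ?nrm_ge0.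
rewrite -ler_sqr ?nnegrE ?normr_ge0// real_normK ?num_real//.
by rewrite exprMn !nrm_sqr CS.
Qed.

Section bounded_kernel.
Variables (s : R -> R) (M : R).
Hypotheses (ms : measurable_fun setT s) (sM : forall x, `|s x| <= M).

Lemma pairable_Cint a b z : pairable a b -> Cint (fun d => s d * (a (z + d) * b (z - d))).
Proof.
by move=> pab; have [_ _ H] := pab; apply: (@Cint_bddM M) => //; exact: pairable_meas.
Qed.

Lemma correlationDl a b c z : pairable a c -> pairable b c ->
  correlation s (fun x => a x + b x) c z = correlation s a c z + correlation s b c z.
Proof.
move=> pa pb; rewrite /correlation -ciD; try exact: pairable_Cint.
by apply: eq_ci => d; ring.
Qed.

Lemma correlationZl k a c z : pairable a c -> correlation s (fun x => k * a x) c z = k * correlation s a c z.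
Proof.
move=> pa; rewrite /correlation -ciZ; last exact: pairable_Cint.
by apply: eq_ci => d; ring.
Qed.

Lemma correlationDr a b c z : pairable c a -> pairable c b ->
  correlation s c (fun x => a x + b x) z = correlation s c a z + correlation s c b z.
Proof.
move=> pa pb; rewrite /correlation -ciD; try exact: pairable_Cint.
by apply: eq_ci => d; ring.
Qed.

Lemma correlationZr k a c z : pairable c a -> correlation s c (fun x => k * a x) z = k * correlation s c a z.
Proof.
move=> pa; rewrite /correlation -ciZ; last exact: pairable_Cint.
by apply: eq_ci => d; ring.
Qed.

Lemma correlation_abs a b z : pairable a b ->
  `|correlation s a b z| <= M * correlation (cst 1) (fun x => `|a x|) (fun x => `|b x|) z.
Proof.
move=> pab; have [_ _ H] := pab; apply: le_trans (ci_abs (pairable_Cint z pab)) _.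
have I1 := CintZ M (Cint_abs (H z)).
rewrite /correlation -ciZ; last first.
  move: (Cint_abs (H z)); congr Cint; apply/funext => d; by rewrite mul1r normrM.
apply: ci_le => [||d]; first exact: Cint_abs (pairable_Cint z pab).
  by move: I1; congr Cint; apply/funext => d; rewrite mul1r normrM.
by rewrite mul1r !normrM ler_wpM2r ?mulr_ge0.
Qed.

Lemma correlation_CS a b z : L2c a -> L2c b -> `|correlation s a b z| <= M * (nrm a * nrm b).
Proof.
move=> La Lb; have pab := pairable_L2 La Lb.
apply: le_trans (correlation_abs z pab) _.
have M0 : 0 <= M by apply: le_trans (sM 0); rewrite normr_ge0.
rewrite ler_wpM2l//.
have La' := L2c_addl z (L2c_abs La); have Lb' := L2c_sub z (L2c_abs Lb).
have -> : correlation (cst 1) (fun x => `|a x|) (fun x => `|b x|) z = ip (fun d => `|a (z + d)|) (fun d => `|b (z - d)|).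
  by apply: eq_ci => d; rewrite mul1r.
apply: le_trans (ler_norm _) _; apply: le_trans (CS_nrm La' Lb') _.
rewrite /nrm (@ip_sub _ (fun x => `|b x|) (fun x => `|b x|))//; try exact: L2c_abs.
have -> : ip (fun d => `|a (z + d)|) (fun d => `|a (z + d)|) = ip (fun d => `|a d|) (fun d => `|a d|).
  rewrite -[RHS](@ip_shift _ _ _ z); try exact: L2c_abs.
  by apply: eq_ci => d; rewrite ![d + z]addrC.
have E c : ip (fun d => `|c d|) (fun d => `|c d|) = ip c c.
  by apply: eq_ci => d; rewrite -normrM ger0_norm// -expr2 sqr_ge0.
by rewrite !E.
Qed.

End bounded_kernel.

Lemma tonelli_circle (F : R * R -> R) :
  measurable_fun (setT : set (measurableTypeR R * measurableTypeR R)) F -> (forall w, 0 <= F w) ->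
  (\int[mu]_(z in circle) \int[mu]_(y in circle) (F (z, y))%:E
   = \int[mu]_(y in circle) \int[mu]_(z in circle) (F (z, y))%:E)%E.
Proof.
move=> mF F0; pose f w := ((EFin \o F) \_ (circle `*` circle)) w.
have f0 w : (0 <= f w)%E by rewrite /f patchE; case: ifP => // _; rewrite lee_fin.
have mf : measurable_fun (setT : set (measurableTypeR R * measurableTypeR R)) f.
  apply/(measurable_restrictT _ _).1; first by apply: measurableX; exact: mcircle.
  by apply: measurable_funTS; exact/measurable_EFinP.
have e1 : (\int[mu]_(z in circle) \int[mu]_(y in circle) (F (z, y))%:E
   = \int[mu]_z \int[mu]_y f (z, y))%E.
  rewrite integral_mkcond; apply: eq_integral => z _; rewrite patchE.
  case: ifPn => cz.
    rewrite integral_mkcond; apply: eq_integral => y _; rewrite /f !patchE.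
    by congr (if _ then _ else _); apply/idP/idP; move: cz; rewrite !inE => cz // -[].
  rewrite integral0_eq// => y _; rewrite /f patchE ifF//; apply/negbTE; apply: contra cz.
  by rewrite !inE => -[].
have e2 : (\int[mu]_(y in circle) \int[mu]_(z in circle) (F (z, y))%:E
   = \int[mu]_y \int[mu]_z f (z, y))%E.
  rewrite integral_mkcond; apply: eq_integral => z _; rewrite patchE.
  case: ifPn => cz.
    rewrite integral_mkcond; apply: eq_integral => y _; rewrite /f !patchE.
    by congr (if _ then _ else _); apply/idP/idP; move: cz; rewrite !inE => cz // -[].
  rewrite integral0_eq// => y _; rewrite /f patchE ifF//; apply/negbTE; apply: contra cz.
  by rewrite !inE => -[].
have Tn : (\int[mu]_z \int[mu]_y f (z, y) = \int[mu]_y \int[mu]_z f (z, y))%E.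
  exact: (@fubini_tonelli _ _ (measurableTypeR R) (measurableTypeR R) R mu mu f mf f0).
exact: (etrans e1 (etrans Tn (esym e2))).
Qed.

(** Substituting [y = z + d], then integrating in [z]: the argument [2 z - y]
    runs through the circle twice at double speed, which costs no factor. *)
Lemma tonelli_correlation a b : L1c a -> L1c b -> (forall x, 0 <= a x) -> (forall x, 0 <= b x) ->
  (\int[mu]_(z in circle) \int[mu]_(d in circle) (a (z + d) * b (z - d))%:E
   = (ci a * ci b)%:E)%E.
Proof.
move=> [pa ma Ia] [pb mb Ib] a0 b0.
have in1 z : (\int[mu]_(d in circle) (a (z + d) * b (z - d))%:E
    = \int[mu]_(y in circle) (a y * b (2 * z - y))%:E)%E.
  rewrite -[RHS](@ge0_circle_shift _ (fun y => (a y * b (2 * z - y))%:E) _ _ _ z).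
  - by apply: eq_integral => d _; congr (a _ * b _)%:E; ring.
  - apply/measurable_EFinP; apply: measurable_funM => //; exact: measurable_reflect.
  - by move=> x; rewrite lee_fin mulr_ge0.
  - move=> x; rewrite pa; congr (_ * _)%:E; by rewrite -[RHS](per_sub (2 * z) pb).
under eq_integral do rewrite in1.
have m2 : measurable_fun (setT : set (measurableTypeR R * measurableTypeR R))
    (fun w => (a w.2 * b (2 * w.1 - w.2))%:E).
  apply/measurable_EFinP; apply: measurable_funM; first exact: (measurableT_comp ma).
  by apply: (measurableT_comp mb); apply: measurable_funB => //; apply: measurable_funM.
rewrite (@tonelli_circle (fun w => a w.2 * b (2 * w.1 - w.2))); last first.
- by move=> w; rewrite mulr_ge0.
- exact/measurable_EFinP.
have in2 y : (\int[mu]_(z in circle) (a y * b (2 * z - y))%:E = (a y * ci b)%:E)%E.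
  under eq_integral do rewrite EFinM.
  rewrite ge0_integralZl//; last first.
  - by rewrite lee_fin.
  - by move=> x _; rewrite lee_fin.
  - apply/measurable_EFinP; apply: measurable_funTS; apply: (measurableT_comp mb).
    by apply: measurable_funB => //; apply: measurable_funM.
  have mbE (c : R) : measurable_fun setT (fun x : R => (b (x - c))%:E).
    by apply/measurable_EFinP; exact: measurable_shift.
  have b0' (x : R) : (0 <= (b x)%:E)%E by rewrite lee_fin.
  rewrite (@ge0_circle_dbl _ (fun x => (b (x - y))%:E) (mbE y) (fun x => b0' _)); last first.
    by move=> x; rewrite addrAC pb.
  rewrite (@ge0_circle_shift _ (fun x => (b x)%:E) _ b0'); last first.
    by move=> x; rewrite pb.
    exact/measurable_EFinP.
  by rewrite EFinM -(EFin_ci b0 Ib).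
under eq_integral do rewrite in2 mulrC EFinM.
have cb0 := ci_ge0 b0.
rewrite ge0_integralZl//; last first.
- by move=> x _; rewrite lee_fin.
- by apply/measurable_EFinP; apply: measurable_funTS.
by rewrite -(EFin_ci a0 Ia) -EFinM mulrC.
Qed.

End correlation.

(** * The sawtooth kernel *)

Section kernel.
Context {R : realType}.
Local Notation mu := (@lebesgue_measure R).
Local Notation T := (@circumference R).
Implicit Types (f g h a b p q s P Q : R -> R).

(** The periodic primitive of (Dirac mass at 0) - 1 / T. *)
Definition sawtooth (d : R) : R :=
  \1_(`[0, pi[%classic : set R) d * (2^-1 - d / T) + \1_(`[- pi, 0[%classic : set R) d * (- 2^-1 - d / T).

Lemma sawtooth_pos d : 0 <= d < pi -> sawtooth d = 2^-1 - d / T.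
Proof.
move=> /andP[d0 dp]; rewrite /sawtooth !indicE mem_set ?memNset/= ?in_itv/= ?d0//; first by ring.
by rewrite ltNge d0 andbF.
Qed.

Lemma sawtooth_neg d : - pi <= d < 0 -> sawtooth d = - 2^-1 - d / T.
Proof.
move=> /andP[d0 dp]; rewrite /sawtooth !indicE memNset ?mem_set/= ?in_itv/= ?d0//; first by ring.
by rewrite leNgt dp.
Qed.

Lemma sawtooth_meas : measurable_fun setT sawtooth.
Proof.
by apply: measurable_funD; apply: measurable_funM => //; apply: measurable_funB => //; apply: measurable_funM.
Qed.

Lemma sawtooth_le d : `|sawtooth d| <= 2^-1.
Proof.
have T0 := @circumference_gt0 R; have pi0 := pi_gt0 R.
have TE : T = 2 * pi by rewrite /T mulr_natl.
have [dp|dp] := boolP (0 <= d < pi).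
  rewrite sawtooth_pos//; have /andP[h1 h2] := dp.
  have h3 : d / T <= 2^-1 by rewrite ler_pdivrMr// TE; lra.
  have h4 : 0 <= d / T by rewrite divr_ge0// ltW.
  by rewrite ler_norml; apply/andP; split; lra.
have [dn|dn] := boolP (- pi <= d < 0).
  rewrite sawtooth_neg//; have /andP[h1 h2] := dn.
  have h3 : - 2^-1 <= d / T by rewrite ler_pdivlMr// TE; lra.
  have h4 : d / T <= 0 by rewrite pmulr_lle0 ?invr_gt0// ltW.
  by rewrite ler_norml; apply/andP; split; lra.
rewrite /sawtooth !indicE !memNset/= ?in_itv/=; [|exact/negP|exact/negP].
by rewrite !mul0r addr0 normr0 invr_ge0.
Qed.

Lemma affine_primitive (c k : R) : is_primitive (fun d => c - d * k) (cst (- k)).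
Proof.
split=> [|x y xy]; first exact: lint_cst.
by rewrite li_cst//; ring.
Qed.

(** Integration by parts on each side of the jump; the two values at the ends
    of the period, where the sawtooth vanishes, drop out. *)
Lemma sawtooth_parts H h : is_primitive H h -> ci (fun d => sawtooth d * h d) = - H 0 + T^-1 * ci H.
Proof.
move=> AH; have [lh _] := AH; have mH := primitive_measurable AH.
have T0 := @circumference_gt0 R; have pi0 := pi_gt0 R.
have TE : T = 2 * pi by rewrite /T mulr_natl.
have lH : lint H.
  have := lint_primitiveM AH (lint_cst 1); congr lint; by apply/funext => x; rewrite /= mulr1.
have ls : lint (fun d => sawtooth d * h d).
  apply: (@lint_le _ _ (fun x => 2^-1 * `|h x|)).
  - by apply: measurable_funM; [exact: sawtooth_meas|exact: lint_meas].
  - by apply/lintZ/lint_abs.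
  - by move=> x; rewrite normrM ler_wpM2r// sawtooth_le.
rewrite -li_circle (li_cat (b := 0) ls); [|lra|lra].
have part (c x y : R) : x <= y -> (forall d, x <= d < y -> sawtooth d = c - d / T) ->
    li x y (fun d => sawtooth d * h d) = (c - y / T) * H y - (c - x / T) * H x + T^-1 * li x y H.
  move=> xy Hs; have AM := primitiveM (affine_primitive c T^-1) AH.
  have [_ HM] := AM; have := HM x y xy; rewrite /= => ->.
  rewrite -liZ// -liD; [|by have [] := AM|exact: lintZ].
  apply: eq_Rintegral => d; rewrite inE/= in_itv/= => Hd.
  by rewrite Hs//; ring.
rewrite (part (- 2^-1)); [|lra|exact: sawtooth_neg].
rewrite (part (2^-1)); [|lra|exact: sawtooth_pos].
rewrite -(li_circle H) [li (- pi) pi H](li_cat (b := 0) lH); [|lra|lra].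
have e1 : pi / T = 2^-1 by rewrite TE -[X in X / _]mul1r -mulf_div divff ?gt_eqF// mulr1 div1r.
have e2 : - pi / T = - 2^-1 by rewrite mulNr e1.
rewrite e1 e2 !mul0r; lra.
Qed.

(** The derivative of [d |-> p(z + d) q(z - d)] is [p' q - p q'], and the
    sawtooth kernel evaluates it at [d = 0] up to the mean. *)
Lemma correlation_parts p p' q q' z : is_primitive p p' -> is_primitive q q' ->
  pairable p q' -> pairable p' q ->
  correlation sawtooth p q' z - correlation sawtooth p' q z = p z * q z - T^-1 * correlation (cst 1) p q z.
Proof.
move=> Ap Aq pq1 pq2.
have A1 : is_primitive (fun d => p (z + d)) (fun d => p' (z + d)).
  have := primitive_shift z Ap; congr is_primitive; by apply/funext => d; rewrite addrC.
have AH := primitiveM A1 (primitive_reflect z Aq).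
have := sawtooth_parts AH; rewrite addr0 subr0 => E.
have -> : correlation (cst 1) p q z = ci (fun d => p (z + d) * q (z - d)).
  by apply: eq_ci => d; rewrite mul1r.
have sm := sawtooth_meas; have sl := sawtooth_le.
rewrite /correlation -ciB; try exact: (pairable_Cint sm sl).
move: E; rewrite (@eq_ci _ _ (fun d => -1 * (sawtooth d * (p (z + d) * q' (z - d)) - sawtooth d * (p' (z + d) * q (z - d))))).
  rewrite ciZ; first by move=> E; lra.
  by apply: CintB; exact: (pairable_Cint sm sl).
by move=> d; ring.
Qed.

Lemma nrm_triangle a b : L2c a -> L2c b -> nrm (fun x => a x + b x) <= nrm a + nrm b.
Proof.
move=> La Lb; have Lab := L2cD La Lb.
have n0 : 0 <= nrm a + nrm b by rewrite addr_ge0 ?nrm_ge0.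
rewrite -ler_sqr ?nnegrE ?nrm_ge0// nrm_sqr.
rewrite ipDl// ipDr// ipDr// -!nrm_sqr sqrrD (ipC b a).
have := CS_nrm La Lb; rewrite ler_norml => /andP[_ h]; lra.
Qed.

(** * Observation on a region *)

Section region.
Variable om : set R.
Hypotheses (mom : measurable (om : set (measurableTypeR R))) (omc : om `<=` circle).

Definition oi f := \int[mu]_(z in om) f z.
Definition Oint f := mu.-integrable om (EFin \o f).

Lemma mu_om_fin : (mu om < +oo)%E.
Proof.
apply: (@le_lt_trans _ _ (mu circle)); last by rewrite [X in (X < _)%E]mu_circle ltry.
by apply: le_measure => //; rewrite inE//; exact: mcircle.
Qed.

Definition osize : R := fine (mu om).

Lemma osizeE : mu om = osize%:E.
Proof. by rewrite /osize fineK// ge0_fin_numE// mu_om_fin. Qed.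

Lemma osize_ge0 : 0 <= osize. Proof. exact: fine_ge0. Qed.

Lemma Oint_bdd M f : measurable_fun setT f -> (forall z, `|f z| <= M) -> Oint f.
Proof.
move=> mf fM; apply: measurable_bounded_integrable => //.
- exact: mu_om_fin.
- exact: measurable_funTS.
- by exists M; split; [exact: num_real|move=> y My z _; exact: le_trans (fM z) (ltW My)].
Qed.

Lemma oi_cst c : oi (cst c) = c * osize.
Proof. by rewrite /oi Rintegral_cst. Qed.

Lemma Cint_Oint f : Cint f -> Oint f.
Proof. by apply: integrableS => //; exact: mcircle. Qed.

Lemma oi_le_ci f : Cint f -> (forall x, 0 <= f x) -> oi f <= ci f.
Proof.
move=> If f0; rewrite /oi /ci /Rintegral fine_le//.
- exact: (integrable_fin_num mom (Cint_Oint If)).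
- exact: (integrable_fin_num mcircle If).
- have mf : measurable_fun (circle : set (measurableTypeR R)) (EFin \o f) := measurable_int _ If.
  apply: (@ge0_subset_integral _ (measurableTypeR R) _ mu om circle mom mcircle _ mf) => //.
  by move=> x _ /=; rewrite lee_fin.
Qed.

(** The bound uniform in [z] is what allows integration over the region. *)
Definition bpair a b := pairable a b /\
  exists M, forall z, correlation (cst 1) (fun x => `|a x|) (fun x => `|b x|) z <= M.

Lemma bpair_L2 a b : L2c a -> L2c b -> bpair a b.
Proof.
move=> La Lb; split; first exact: pairable_L2.
have s1 (x : R) : `|cst 1 x| <= 1 :> R by rewrite normr1.
exists (1 * (nrm (fun x => `|a x|) * nrm (fun x => `|b x|))) => z.
apply: le_trans (correlation_CS _ s1 z (L2c_abs La) (L2c_abs Lb)) => //.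
exact: ler_norm.
Qed.

Lemma bpair_L1b M a b : L1c a -> measurable_fun setT b -> (forall x, `|b x| <= M) -> bpair a b.
Proof.
move=> La mb bM; split; first exact: pairable_L1b bM.
exists (M * ci (fun x => `|a x|)) => z.
have [pa' ma' Ia'] := L1c_abs La.
have [_ m1 I1] := L1c_addl z (L1c_abs La).
have -> : ci (fun x => `|a x|) = ci (fun x => `|a (z + x)|).
  rewrite -(ci_shift z ma' pa'); by apply: eq_ci => x; rewrite addrC.
rewrite -ciZ// /correlation; have [_ _ H] := @pairable_L1b _ M _ _ (L1c_abs La) (measurableT_comp (@normr_measurable R setT) mb) (fun x => ltac:(by rewrite normr_id)).
apply: ci_le => [||d]; [|exact: CintZ|].
  by move: (H z); congr Cint; apply/funext => d; rewrite mul1r.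
by rewrite mul1r mulrC ler_wpM2r.
Qed.

Lemma bpair_bL1 M a b : L1c b -> measurable_fun setT a -> (forall x, `|a x| <= M) -> bpair a b.
Proof.
move=> Lb ma aM; split; first exact: pairable_bL1 aM.
exists (M * ci (fun x => `|b x|)) => z.
have [pb' mb' Ib'] := L1c_abs Lb.
have [_ m1 I1] := L1c_sub z (L1c_abs Lb).
have -> : ci (fun x => `|b x|) = ci (fun x => `|b (z - x)|) by rewrite -(ci_sub z mb' pb').
rewrite -ciZ// /correlation; have [_ _ H] := @pairable_bL1 _ M _ _ (L1c_abs Lb) (measurableT_comp (@normr_measurable R setT) ma) (fun x => ltac:(by rewrite normr_id)).
apply: ci_le => [||d]; [|exact: CintZ|].
  by move: (H z); congr Cint; apply/funext => d; rewrite mul1r.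
by rewrite mul1r ler_wpM2r.
Qed.

Lemma Oint_correlation s M a b : measurable_fun setT s -> (forall x, `|s x| <= M) -> bpair a b ->
  Oint (correlation s a b).
Proof.
move=> ms sM [pab [K HK]]; have [ma mb _] := pab.
have M0 : 0 <= M := le_trans (normr_ge0 _) (sM 0).
apply: (@Oint_bdd (M * K)); first exact: correlation_meas.
by move=> z; apply: le_trans (correlation_abs ms sM z pab) _; rewrite ler_wpM2l.
Qed.

Definition kernel_form a b := oi (correlation sawtooth a b).

Lemma kernel_formDl a b c : bpair a c -> bpair b c -> kernel_form (fun x => a x + b x) c = kernel_form a c + kernel_form b c.
Proof.
move=> pa pb; rewrite /kernel_form /oi -RintegralD//; try exact: (Oint_correlation sawtooth_meas sawtooth_le).
congr Rintegral; apply/funext => z; apply: (correlationDl sawtooth_meas sawtooth_le); [by case: pa|by case: pb].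
Qed.

Lemma kernel_formDr a b c : bpair c a -> bpair c b -> kernel_form c (fun x => a x + b x) = kernel_form c a + kernel_form c b.
Proof.
move=> pa pb; rewrite /kernel_form /oi -RintegralD//; try exact: (Oint_correlation sawtooth_meas sawtooth_le).
congr Rintegral; apply/funext => z; apply: (correlationDr sawtooth_meas sawtooth_le); [by case: pa|by case: pb].
Qed.

Lemma kernel_formZl k a c : bpair a c -> kernel_form (fun x => k * a x) c = k * kernel_form a c.
Proof.
move=> pa; rewrite /kernel_form /oi -RintegralZl//; try exact: (Oint_correlation sawtooth_meas sawtooth_le).
congr Rintegral; apply/funext => z; apply: (correlationZl sawtooth_meas sawtooth_le); by case: pa.
Qed.

Lemma kernel_formZr k a c : bpair c a -> kernel_form c (fun x => k * a x) = k * kernel_form c a.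
Proof.
move=> pa; rewrite /kernel_form /oi -RintegralZl//; try exact: (Oint_correlation sawtooth_meas sawtooth_le).
congr Rintegral; apply/funext => z; apply: (correlationZr sawtooth_meas sawtooth_le); by case: pa.
Qed.

Lemma kernel_form_le a b : L2c a -> L2c b -> `|kernel_form a b| <= osize * (2^-1 * (nrm a * nrm b)).
Proof.
move=> La Lb; have O1 := Oint_correlation sawtooth_meas sawtooth_le (bpair_L2 La Lb).
apply: le_trans (le_normr_Rintegral _ O1) _ => //.
rewrite mulrC -oi_cst; apply: le_Rintegral => //.
- exact: (integrable_norm O1).
- by apply: (@Oint_bdd `|2^-1 * (nrm a * nrm b)|).
- by move=> z _; exact: (correlation_CS sawtooth_meas sawtooth_le).
Qed.

(** The bound by L1 norms alone, which is what permits an unbounded damping: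
    enlarging the region to the whole circle turns the double integral into a
    product. *)
Lemma kernel_form_err a b : L1c a -> L1c b -> bpair a b ->
  `|kernel_form a b| <= 2^-1 * (ci (fun x => `|a x|) * ci (fun x => `|b x|)).
Proof.
move=> La Lb pab; have O1 := Oint_correlation sawtooth_meas sawtooth_le pab.
have La' := L1c_abs La; have Lb' := L1c_abs Lb.
pose c1 := correlation (cst 1) (fun x => `|a x|) (fun x => `|b x|).
have [[ma mb H] [K HK]] := pab.
have mc1 : measurable_fun setT c1.
  by apply: correlation_meas => //; exact: measurableT_comp.
have c10 z : 0 <= c1 z by apply: ci_ge0 => d; rewrite mul1r mulr_ge0.
have c1K z : `|c1 z| <= K by rewrite ger0_norm.
have Ic1 : Cint c1.
  apply: (Cint_le mc1 (Cint_cst K)) => z; exact: c1K.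
have -> : ci (fun x => `|a x|) * ci (fun x => `|b x|) = ci c1.
  apply: EFin_inj; rewrite -(tonelli_correlation La' Lb')// (EFin_ci c10 Ic1).
  apply: eq_integral => z _; rewrite /c1 /correlation.
  rewrite EFin_ci; last 2 first.
  - by move=> d; rewrite mul1r mulr_ge0.
  - by move: (Cint_abs (H z)); congr Cint; apply/funext => d; rewrite mul1r normrM.
  by apply: eq_integral => d _; rewrite mul1r.
apply: le_trans (le_normr_Rintegral _ O1) _ => //.
apply: (@le_trans _ _ (oi (fun z => 2^-1 * c1 z))).
  apply: le_Rintegral => //; first exact: (integrable_norm O1).
    exact: (Cint_Oint (CintZ _ Ic1)).
  by move=> z _; apply: (correlation_abs sawtooth_meas sawtooth_le); case: pab.
rewrite /oi RintegralZl//; last exact: Cint_Oint.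
by rewrite ler_wpM2l// ?invr_ge0//; exact: oi_le_ci.
Qed.

End region.

(** * The gap inequality *)

Section gap_lemma.
Variable om : set R.
Hypotheses (mom : measurable (om : set (measurableTypeR R))) (omc : om `<=` circle).

(** Equal to [int (P(z + d) + Q(z - d))^2 dd], written with [y = z + d]. *)
Definition gapN P Q z := ip (fun y => P y + Q (2 * z - y)) (fun y => P y + Q (2 * z - y)).

Lemma gapNE P Q z : L2c P -> L2c Q ->
  gapN P Q z = ip P P + ip Q Q + 2 * correlation (cst 1) P Q z.
Proof.
move=> LP LQ; have LR := L2c_sub (2 * z) LQ.
rewrite /gapN ipDl ?ipDr//; try exact: L2cD.
have -> : correlation (cst 1) P Q z = ip P (fun y => Q (2 * z - y)).
  rewrite -(ip_shift z LP LR); apply: eq_ci => d.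
  by rewrite mul1r [z + d]addrC; congr (_ * Q _); ring.
rewrite (ip_sub _ LQ LQ) (ipC _ P); ring.
Qed.

Lemma gapN_ge0 P Q z : 0 <= gapN P Q z. Proof. exact: ip_ge0. Qed.

Lemma gapN_meas P Q : L2c P -> L2c Q -> measurable_fun setT (gapN P Q).
Proof.
move=> LP LQ; rewrite (_ : gapN P Q = fun z => ip P P + ip Q Q + 2 * correlation (cst 1) P Q z).
  apply: measurable_funD => //; apply: measurable_funM => //.
  by apply: correlation_meas => //; [case: LP|case: LQ].
by apply/funext => z; exact: gapNE.
Qed.

Lemma gapN_bdd P Q z : L2c P -> L2c Q -> `|gapN P Q z| <= 2 * (ip P P + ip Q Q).
Proof.
move=> LP LQ; rewrite ger0_norm ?gapN_ge0// gapNE//.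
have s1 (x : R) : `|cst 1 x| <= 1 :> R by rewrite normr1.
have := @correlation_CS _ (cst 1) 1 _ s1 P Q z LP LQ; rewrite mul1r => /(_ ltac:(by []))h.
have {}h := le_trans (ler_norm _) h; rewrite -!nrm_sqr.
have := sqr_ge0 (nrm P - nrm Q); rewrite sqrrB; lra.
Qed.

Lemma Oint_gapN P Q : L2c P -> L2c Q -> Oint om (gapN P Q).
Proof.
move=> LP LQ; apply: (@Oint_bdd _ mom omc (2 * (ip P P + ip Q Q))); first exact: gapN_meas.
by move=> z; exact: gapN_bdd.
Qed.

Lemma ip_le_sum2 f g : L2c f -> L2c g ->
  ip (fun x => f x - g x) (fun x => f x - g x) <= 2 * ip f f + 2 * ip g g.
Proof.
move=> Lf Lg; have := ip_ge0 (fun x => f x + g x).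
have LN := L2cN Lg.
have E : ip (fun x => f x - g x) (fun x => f x - g x) = ip f f - 2 * ip f g + ip g g.
  rewrite (ipDl Lf LN (L2cD Lf LN)) (ipDr Lf LN Lf) (ipDr Lf LN LN).
  have N1 h : L2c h -> ip h (fun x => - g x) = - ip h g.
    move=> Lh; rewrite -mulN1r -ipZr//; by apply: eq_ci => x; rewrite mulN1r.
  rewrite (ipC (fun x => - g x) f) (N1 f Lf) (N1 (fun x => - g x) LN) (ipC (fun x => - g x) g) (N1 g Lg); ring.
rewrite E ipDl ?ipDr//; last exact: L2cD.
by rewrite (ipC g f); lra.
Qed.

Definition shift_defect Q t := ip (fun x => Q x - Q (x + t)) (fun x => Q x - Q (x + t)).

(** If [P y] is close to both [- Q (2 z - y)] and [- Q (2 (z + r) - y)], the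
    latter are close to each other. *)
Lemma shift_defect_gapN P Q z r : L2c P -> L2c Q ->
  shift_defect Q (2 * r) <= 2 * gapN P Q z + 2 * gapN P Q (z + r).
Proof.
move=> LP LQ; have L1 := L2cD LP (L2c_sub (2 * z) LQ); have L2 := L2cD LP (L2c_sub (2 * (z + r)) LQ).
apply: le_trans (ip_le_sum2 L1 L2).
have Ld : L2c (fun x => Q x - Q (x + 2 * r)) := L2cB LQ (L2c_shift (2 * r) LQ).
rewrite /shift_defect -(ip_sub (2 * z) Ld Ld) le_eqVlt; apply/orP; left; apply/eqP.
by apply: eq_ci => y; congr (_ * _); rewrite (_ : 2 * (z + r) - y = 2 * z - y + 2 * r); ring.
Qed.

Lemma L2c_shift_defect Q t : L2c Q -> L2c (fun x => Q x - Q (x + t)).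
Proof. by move=> LQ; exact: (L2cB LQ (L2c_shift t LQ)). Qed.

Lemma shift_defect_mul Q t k : L2c Q -> shift_defect Q (k%:R * t) <= k%:R ^+ 2 * shift_defect Q t.
Proof.
move=> LQ.
suff H : nrm (fun x => Q x - Q (x + k%:R * t)) <= k%:R * nrm (fun x => Q x - Q (x + t)).
  rewrite /shift_defect -!nrm_sqr -exprMn ler_sqr ?nnegrE ?nrm_ge0//.
  by rewrite mulr_ge0 ?nrm_ge0.
elim: k => [|k IH].
  rewrite mul0r (_ : (fun x => _) = cst 0) ?/nrm /ip.
    by rewrite (@eq_ci _ _ (cst 0)) ?ci_cst ?mul0r ?sqrtr0// => x; rewrite mulr0.
  by apply/funext => x; rewrite addr0 subrr.
have Lk := L2c_shift_defect (k%:R * t) LQ; have Lt := L2c_shift_defect t LQ.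
have -> : (fun x => Q x - Q (x + k.+1%:R * t)) =
  (fun x => (Q x - Q (x + t)) + (Q (x + t) - Q (x + t + k%:R * t))).
  apply/funext => x; rewrite -[k.+1%:R]natr1.
  by rewrite (_ : x + (k%:R + 1) * t = x + t + k%:R * t); ring.
apply: le_trans (nrm_triangle Lt (L2c_shift t Lk)) _.
rewrite -[k.+1%:R]natr1 mulrDl mul1r addrC lerD2r.
by rewrite /nrm (ip_shift _ Lk Lk) -/(nrm _).
Qed.

(** By Jensen's inequality the average of the squares of [Q y - Q (y + t)] over
    [t] is at least the square of [Q y] minus the mean. *)
Lemma shift_defect_mean Q C : L2c Q -> (forall t, circle t -> shift_defect Q t <= C) ->
  ip (fun x => Q x - ci Q / T) (fun x => Q x - ci Q / T) <= C.
Proof.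
move=> LQ HC; have T0 := @circumference_gt0 R; set m := ci Q / T.
have LQm : L2c (fun x => Q x - m) := L2cB LQ (L2c_cst m).
have [pQ mQ _] := LQ.
have key y : T * ((Q y - m) * (Q y - m)) <= ci (fun t => (Q y - Q (y + t)) ^+ 2).
  have Ls : L2c (fun t => Q y - Q (y + t)) := L2cB (L2c_cst (Q y)) (L2c_addl y LQ).
  have [_ _ I1] := L2_L1 Ls; have [_ _ I2] := L2_L1 (L2c_addl y LQ).
  have e : ci (fun t => Q y - Q (y + t)) = T * (Q y - m).
    rewrite ciB//; last exact: Cint_cst.
    rewrite ci_cst (_ : ci (fun t => Q (y + t)) = ci Q); last first.
      by rewrite -(ci_shift y mQ pQ); apply: eq_ci => t; rewrite addrC.
    by rewrite /m mulrBr mulrCA divff ?gt_eqF// mulr1 mulrC.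
  have h := ci_abs_le Ls; have h2 := ci_abs I1.
  rewrite e in h2.
  have h3 : (T * (Q y - m)) ^+ 2 <= T * ip (fun t => Q y - Q (y + t)) (fun t => Q y - Q (y + t)).
    apply: le_trans h; rewrite -(real_normK (num_real (T * _))) ler_sqr ?nnegrE//.
    by rewrite ci_ge0.
  rewrite -(ler_pM2l T0).
  have -> : T * (T * ((Q y - m) * (Q y - m))) = (T * (Q y - m)) ^+ 2 by ring.
  apply: le_trans h3 _.
  by rewrite ler_pM2l.
rewrite -(ler_pM2l T0) -lee_fin.
have [_ _ Im] := L2_mul LQm LQm.
rewrite /ip -ciZ// EFin_ci; last 2 first.
- by move=> x; rewrite mulr_ge0 ?(ltW T0)// -expr2 sqr_ge0.
- exact: CintZ.
have mF : measurable_fun (setT : set (measurableTypeR R * measurableTypeR R))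
    (fun w => (Q w.1 - Q (w.1 + w.2)) ^+ 2).
  apply: measurable_funX; apply: measurable_funB; first exact: (measurableT_comp mQ).
  by apply: (measurableT_comp mQ); exact: measurable_funD.
have Isq y : Cint (fun t => (Q y - Q (y + t)) ^+ 2).
  by have [_ _] := L2cB (L2c_cst (Q y)) (L2c_addl y LQ).
apply: (@le_trans _ _ (\int[mu]_(y in circle) \int[mu]_(t in circle) ((Q y - Q (y + t)) ^+ 2)%:E)%E).
  apply: ge0_le_integral => //.
  - by move=> x _; rewrite lee_fin mulr_ge0 ?(ltW T0)// -expr2 sqr_ge0.
  - apply/measurable_EFinP; apply: measurable_funTS; apply: measurable_funM => //.
    by apply: measurable_funM; apply: measurable_funB.
  - have := measurable_param mF; move=> /measurable_EFinP mp.
    apply: measurable_funTS; apply: eq_measurable_fun mp => y _ /=.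
    by rewrite EFin_ci// => t; exact: sqr_ge0.
  - by move=> y _; rewrite -EFin_ci ?lee_fin// => t; exact: sqr_ge0.
rewrite (tonelli_circle mF); last by move=> w; exact: sqr_ge0.
apply: (@le_trans _ _ (\int[mu]_(t in circle) (cst C%:E t))%E); last first.
  by rewrite integral_cst ?[X in (_ * X)%E]mu_circle -?EFinM 1?mulrC//; exact: mcircle.
have E t : (\int[mu]_(y in circle) ((Q y - Q (y + t)) ^+ 2)%:E = (shift_defect Q t)%:E)%E.
  have [_ _ I] := L2c_shift_defect t LQ.
  by rewrite -EFin_ci// => y; exact: sqr_ge0.
apply: ge0_le_integral => //.
- by move=> t _; apply: integral_ge0 => y _; rewrite lee_fin sqr_ge0.
- have mF2 : measurable_fun (setT : set (measurableTypeR R * measurableTypeR R))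
      (fun w => (Q w.2 - Q (w.2 + w.1)) ^+ 2).
    apply: measurable_funX; apply: measurable_funB; first exact: (measurableT_comp mQ).
    by apply: (measurableT_comp mQ); exact: measurable_funD.
  have := measurable_param mF2; move=> /measurable_EFinP mp.
  apply: measurable_funTS; apply: eq_measurable_fun mp => y _ /=.
  rewrite EFin_ci//; first by move=> t; exact: sqr_ge0.
  by have [_ _] := L2c_shift_defect y LQ.
- by move=> t ct; rewrite E lee_fin HC.
Qed.

(** A set of density at least 3/4 in an interval meets its small translates:
    both lie in an interval of length [2 l + |r|], too short for two disjoint
    sets of measure [3 l / 2]. *)
Lemma overlap (x0 l r : R) : 0 < l -> om `<=` `]x0 - l, x0 + l[%classic ->
  ((l * (3 / 2))%:E <= mu om)%E ->
  `|r| <= l / 2 -> ((l / 2)%:E <= mu (om `&` (fun x => 1 * x + r)%R @^-1` om))%E.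
Proof.
move=> l0 oml lom rl; set B := _ @^-1` om.
have mB : measurable (B : set (measurableTypeR R)).
  by rewrite -[B]setTI; exact: (measurable_affine 1 r).
have eB : mu B = mu om.
  by rewrite [RHS](@lebesgue_affine _ 1 r)// mul1e.
have fom := mu_om_fin mom omc.
have U : (mu (om `|` B) = mu om + mu B - mu (om `&` B))%E := measureUfinl mom mB fom.
have Ule : (mu (om `|` B) <= (2 * l + `|r|)%:E)%E.
  pose c := x0 - l - (r + `|r|) / 2; pose d := x0 + l - (r - `|r|) / 2.
  have h : (mu (om `|` B) <= mu `]c, d[%classic)%E.
    apply: le_measure; rewrite ?inE//; [exact: measurableU|].
    have hr := ler_norm r; have hr2 := ler_norm (- r); rewrite normrN in hr2.
    move=> x [/oml|/oml] /=; rewrite !in_itv/= /c /d => /andP[h1 h2]; apply/andP; split; lra.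
  apply: le_trans h _; rewrite lebesgue_measure_itv/= lte_fin; case: ifP => _.
    by rewrite -EFinB lee_fin /c /d; lra.
  by rewrite lee_fin; have := normr_ge0 r; lra.
have fI : (mu (om `&` B) < +oo)%E.
  by apply: le_lt_trans fom; apply: le_measure; rewrite ?inE//; try exact: measurableI.
move: U Ule; rewrite eB (osizeE mom omc).
have -> : mu (om `&` B) = (fine (mu (om `&` B)))%:E by rewrite fineK// ge0_fin_numE.
move=> -> h; have {}h : osize om + osize om - fine (mu (om `&` B)) <= 2 * l + `|r| by exact: h.
by move: lom rl h; rewrite (osizeE mom omc) !lee_fin; lra.
Qed.

(** Averaging the two-point inequality over those [z] for which both [z] and
    [z + r] lie in the region. *)
Lemma shift_defect_small P Q (x0 l r : R) : L2c P -> L2c Q -> 0 < l ->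
  om `<=` `]x0 - l, x0 + l[%classic -> ((l * (3 / 2))%:E <= mu om)%E ->
  `|r| <= l / 2 -> shift_defect Q (2 * r) * (l / 2) <= 4 * oi om (gapN P Q).
Proof.
move=> LP LQ l0 oml lom rl.
pose B := (fun x : R => 1 * x + r) @^-1` om.
have ov := overlap l0 oml lom rl; rewrite -/B in ov.
have IN := Oint_gapN LP LQ; have mN := gapN_meas LP LQ.
have mB : measurable (B : set (measurableTypeR R)).
  by rewrite -[B]setTI; exact: (measurable_affine 1 r).
rewrite -lee_fin.
have e4 : (4 * oi om (gapN P Q))%:E = (2%:E * \int[mu]_(z in om) (gapN P Q z)%:E +
    2%:E * \int[mu]_(z in om) (gapN P Q z)%:E)%E.
  by rewrite -(EFin_Rint mom IN) -!EFinM -EFinD; congr EFin; rewrite -/(oi om _); ring.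
have N0 z : (0 <= (gapN P Q z)%:E)%E by rewrite lee_fin gapN_ge0.
have mNE : measurable_fun setT (fun z => (gapN P Q z)%:E) by exact/measurable_EFinP.
have mD : measurable_fun (setT : set (measurableTypeR R)) (fun z => (gapN P Q (1 * z + r))%:E).
  by apply/measurable_EFinP; apply: (measurableT_comp mN); exact: measurable_affine.
apply: (@le_trans _ _ (\int[mu]_(z in om `&` B) (cst (shift_defect Q (2 * r))%:E z))%E).
  rewrite integral_cst; last exact: measurableI.
  by rewrite EFinM; apply: lee_wpmul2l => //; rewrite lee_fin; exact: ip_ge0.
apply: (@le_trans _ _ (\int[mu]_(z in om `&` B) (2%:E * (gapN P Q z)%:E + 2%:E * (gapN P Q (1 * z + r))%:E))%E).
  apply: ge0_le_integral => //.
  - exact: measurableI.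
  - by move=> z _; rewrite lee_fin; exact: ip_ge0.
  - by apply: measurable_funTS; apply: emeasurable_funD; apply: measurable_funeM.
  - by move=> z _; rewrite mul1r -!EFinM -EFinD lee_fin; exact: shift_defect_gapN.
rewrite ge0_integralD//; last 5 first.
- exact: measurableI.
- by move=> z _; rewrite mule_ge0.
- by apply: measurable_funTS; apply: measurable_funeM.
- by move=> z _; rewrite mule_ge0// lee_fin gapN_ge0.
- by apply: measurable_funTS; apply: measurable_funeM.
have Z (f : R -> \bar R) : measurable_fun (setT : set (measurableTypeR R)) f -> (forall z, 0 <= f z)%E ->
    (\int[mu]_(z in om `&` B) (2%:E * f z) = 2%:E * \int[mu]_(z in om `&` B) f z)%E.
  by move=> mf f0; rewrite ge0_integralZl//; [exact: measurableI|exact: measurable_funTS].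
rewrite (Z _ mNE N0) (Z _ mD (fun z => N0 _)).
rewrite e4; apply: leeD; (apply: lee_wpmul2l; first by rewrite lee_fin).
- apply: ge0_subset_integral => //; first exact: measurableI.
  exact: measurable_funTS.
- rewrite [leRHS](@ge0_integral_affine _ 1 r)// mul1e -/B.
  apply: ge0_subset_integral => //; first exact: measurableI.
  exact: measurable_funTS.
Qed.

(** The constant comes from reaching any translation of the circle in [k] small
    steps, each controlled by the integral over the region; each step enters
    squared.  Equality of the means enters at the end: [Q] is close to its mean
    [m] and [P] to [- m], while both have mean [m], which bounds [m]. *)
Lemma correlation_gap (x0 l : R) : 0 < l -> om `<=` `]x0 - l, x0 + l[%classic -> ((l * (3 / 2))%:E <= mu om)%E ->
  exists2 gam, 0 < gam & forall P Q, L2c P -> L2c Q -> ci P = ci Q ->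
    gam * (ip P P + ip Q Q) <= oi om (gapN P Q).
Proof.
move=> l0 oml lom; have pi0 := pi_gt0 R; have T0 := @circumference_gt0 R.
have O0 : 0 < osize om.
  rewrite -lte_fin -(osizeE mom omc); apply: lt_le_trans lom; rewrite lte_fin; lra.
have [k /andP[k0 kl]] : exists k : nat, (0 < k)%N && (pi <= k%:R * l).
  exists (Num.bound (pi / l)).+1; rewrite ltn0Sn/= -ler_pdivrMr//.
  have := archi_boundP (divr_ge0 (ltW pi0) (ltW l0)); move=> h.
  by apply: ltW; apply: lt_le_trans h _; rewrite ler_nat leqnSn.
pose C := k%:R ^+ 2 * (8 / l).
have kR : 0 < k%:R :> R by rewrite ltr0n.
have C0 : 0 < C by rewrite mulr_gt0 ?exprn_gt0// divr_gt0.
exists (2 / osize om + 3 * C)^-1 => [|P Q LP LQ PQ].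
  by rewrite invr_gt0 addr_gt0 ?divr_gt0// mulr_gt0.
set Th := oi om (gapN P Q).
have H1 t : circle t -> shift_defect Q t <= C * Th.
  rewrite /circle/= in_itv/= => /andP[t1 t2].
  pose r := t / (2 * k%:R).
  have rl : `|r| <= l / 2.
    rewrite /r normrM normfV (@gtr0_norm _ (2 * k%:R)) ?mulr_gt0// ler_pdivrMr ?mulr_gt0//.
    have : `|t| <= pi by rewrite ler_norml; lra.
    move=> h; apply: le_trans h _; apply: le_trans kl _; lra.
  have := shift_defect_small LP LQ l0 oml lom rl; rewrite -/Th => h.
  have {}h : shift_defect Q (2 * r) <= 8 / l * Th.
    rewrite mulrAC ler_pdivlMr//; move: h; lra.
  have -> : t = k%:R * (2 * r) by rewrite /r; field; rewrite gt_eqF.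
  apply: le_trans (shift_defect_mul _ _ LQ) _.
  by rewrite /C -mulrA ler_wpM2l// sqr_ge0.
have H2 := shift_defect_mean LQ H1; set m := ci Q / T in H2.
have LQm : L2c (fun x => Q x - m) := L2cB LQ (L2c_cst m).
have LPm : L2c (fun x => P x + m) := L2cD LP (L2c_cst m).
have mT : ci Q = m * T by rewrite /m divfK// gt_eqF.
have ipc f : L2c f -> ip f (cst m) = m * ci f.
  move=> /L2_L1[_ _ If]; rewrite -ciZ//; by apply: eq_ci => x; rewrite mulrC.
have cc : ip (cst m) (cst m) = m ^+ 2 * T.
  by rewrite ipc ?ci_cst//; [ring|exact: L2c_cst].
have EP : ip (fun x => P x + m) (fun x => P x + m) = ip P P + 2 * m * ci P + m ^+ 2 * T.
  have Lm := L2c_cst m; rewrite (ipDl LP Lm LPm) (ipDr LP Lm LP) (ipDr LP Lm Lm).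
  rewrite -[ip P (fun=> m)]/(ip P (cst m)) -[ip (fun=> m) P]/(ip (cst m) P).
  by rewrite -[ip (fun=> m) (fun=> m)]/(ip (cst m) (cst m)) (ipC (cst m) P) cc ipc//; ring.
have EQ : ip (fun x => Q x - m) (fun x => Q x - m) = ip Q Q - 2 * m * ci Q + m ^+ 2 * T.
  have Lm := L2c_cst (- m); rewrite (ipDl LQ Lm LQm) (ipDr LQ Lm LQ) (ipDr LQ Lm Lm).
  have e f : L2c f -> ip f (cst (- m)) = - (m * ci f).
    move=> /L2_L1[_ _ If]; rewrite (_ : - (m * ci f) = ci (fun x => - m * f x)).
      by apply: eq_ci => x; rewrite mulrC.
    by rewrite (ciZ _ If) mulNr.
  rewrite (ipC (cst (- m)) Q) (e Q LQ) (e _ Lm).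
  by rewrite ci_cst; ring.
have H3 z : ip (fun x => P x + m) (fun x => P x + m) <= 2 * gapN P Q z + 2 * (C * Th).
  have LR := L2c_sub (2 * z) LQm; have LS := L2cD LP (L2c_sub (2 * z) LQ).
  have := ip_le_sum2 LS LR; rewrite (ip_sub _ LQm LQm).
  rewrite (_ : (fun x => _ - _) = (fun x => P x + m)); last by apply/funext => x; ring.
  by rewrite -/(gapN P Q z); move: H2; lra.
have H4 : osize om * ip (fun x => P x + m) (fun x => P x + m) <= 2 * Th + osize om * (2 * (C * Th)).
  have IN := Oint_gapN LP LQ.
  have Icst c : Oint om (cst c) by apply: (@Oint_bdd _ mom omc `|c|).
  have I2 : Oint om (fun z => 2 * gapN P Q z) := integrableZl mom _ IN.
  have := @le_Rintegral _ _ _ mu om _ _ mom (Icst (ip (fun x => P x + m) (fun x => P x + m)))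
    (integrableD mom I2 (Icst (2 * (C * Th)))) (fun z _ => H3 z).
  have -> : \int[mu]_(x in om) (2 * gapN P Q x + cst (2 * (C * Th)) x) = 2 * Th + 2 * (C * Th) * osize om.
    by rewrite (RintegralD mom I2 (Icst _)) (RintegralZl _ mom IN) [X in _ + X]oi_cst.
  have -> : \int[mu]_(x in om) cst (ip (fun x1 : R => P x1 + m) (fun x1 : R => P x1 + m)) x =
    ip (fun x => P x + m) (fun x => P x + m) * osize om by exact: oi_cst.
  by rewrite [osize om * _]mulrC [osize om * (2 * _)]mulrC.
rewrite mulrC ler_pdivrMr; last by rewrite addr_gt0 ?divr_gt0// mulr_gt0.
have m2 : 0 <= m ^+ 2 * T by rewrite mulr_ge0 ?sqr_ge0// ltW.
have {}H4 : ip (fun x => P x + m) (fun x => P x + m) <= 2 / osize om * Th + 2 * (C * Th).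
  rewrite -(ler_pM2l O0); apply: le_trans H4 _; rewrite le_eqVlt; apply/orP; left; apply/eqP.
  by field; rewrite gt_eqF.
move: H2 H4; rewrite EP EQ PQ mT; move: m2; rewrite mulrDr; nra.
Qed.

End gap_lemma.

End kernel.

(** * The Lyapunov form *)

Section damping.
Context {R : realType}.
Local Notation mu := (@lebesgue_measure R).
Local Notation T := (@circumference R).
Implicit Types (f g h v p q W : R -> R).

Definition en g v : R := ip g g + ip v v.

Lemma young_sqr (x m n I Y : R) : 0 <= m -> 0 <= n -> 0 <= I -> 0 <= Y ->
  x ^+ 2 <= 4 * m * n * (I * Y) -> x <= m * I + n * Y.
Proof.
move=> m0 n0 I0 Y0 h; have [x0|x0] := leP x 0.
  by apply: le_trans x0 _; rewrite addr_ge0 ?mulr_ge0.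
rewrite -ler_sqr ?nnegrE ?(ltW x0) ?addr_ge0 ?mulr_ge0//; apply: le_trans h _.
rewrite -subr_ge0 (_ : _ - _ = (m * I - n * Y) ^+ 2) ?sqr_ge0//; ring.
Qed.

Ltac atoms := repeat match goal with
  | |- context [kernel_form ?om ?p ?q] => let z := fresh in generalize (kernel_form om p q); intro z
  | |- context [ip ?p ?q] => let z := fresh in generalize (ip p q); intro z
  | |- context [ci ?p] => let z := fresh in generalize (ci p); intro z
  end.

Section form.
Variables (om : set R) (a : R -> R) (A K N : R).
Hypotheses (mom : measurable (om : set (measurableTypeR R))) (omc : om `<=` circle).
Hypotheses (ma : measurable_fun setT a) (aA : forall x, `|a x| <= A) (K0 : 0 <= K) (N0 : 0 <= N).

Let M := kernel_form om.

(** The polarized form: what is estimated along a trajectory is the value at a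
    state and at its time derivative. *)
Definition lyapunov_form g v g' v' : R :=
  N / 2 * (ip g g' + ip v v') + 2^-1 * ci (fun x => a x * (g x * v' x + g' x * v x))
  + K / 4 * (M (fun x => v x - g x) (fun x => v' x + g' x) + M (fun x => v' x - g' x) (fun x => v x + g x)).

Lemma lyapunov_formC g v g' v' : lyapunov_form g v g' v' = lyapunov_form g' v' g v.
Proof.
rewrite /lyapunov_form (ipC g g') (ipC v v') [M _ _ + M _ _]addrC; congr (_ + _ * _ + _).
by apply: eq_ci => x; rewrite [g x * _ + _]addrC.
Qed.

Lemma Cint_wt g v : L2c g -> L2c v -> Cint (fun x => a x * (g x * v x)).
Proof. by move=> Lg Lv; have [_ m1 I1] := L2_mul Lg Lv; exact: (Cint_bddM ma aA m1 I1). Qed.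

Lemma ci_wt g v g' v' : L2c g -> L2c v -> L2c g' -> L2c v' ->
  ci (fun x => a x * (g x * v' x + g' x * v x))
  = ci (fun x => a x * (g x * v' x)) + ci (fun x => a x * (g' x * v x)).
Proof.
move=> Lg Lv Lg' Lv'; rewrite -ciD; try exact: Cint_wt.
by apply: eq_ci => x; ring.
Qed.

Lemma lyapunov_formD g v g1 v1 g' v' : L2c g -> L2c v -> L2c g1 -> L2c v1 -> L2c g' -> L2c v' ->
  lyapunov_form (fun x => g x + g1 x) (fun x => v x + v1 x) g' v' = lyapunov_form g v g' v' + lyapunov_form g1 v1 g' v'.
Proof.
move=> Lg Lv Lg1 Lv1 Lg' Lv'; rewrite /lyapunov_form !ipDl// !ci_wt//; try exact: L2cD.
have e1 h h1 k : L2c h -> L2c h1 -> L2c k -> ci (fun x => a x * ((h x + h1 x) * k x)) =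
    ci (fun x => a x * (h x * k x)) + ci (fun x => a x * (h1 x * k x)).
  move=> Lh Lh1 Lk; rewrite -ciD; try exact: Cint_wt.
  by apply: eq_ci => x; ring.
have -> : ci (fun x => a x * (g' x * (v x + v1 x))) =
    ci (fun x => a x * (g' x * v x)) + ci (fun x => a x * (g' x * v1 x)).
  by rewrite -ciD; try exact: Cint_wt; apply: eq_ci => x; ring.
rewrite e1//.
have -> : (fun x => v x + v1 x - (g x + g1 x)) = (fun x => (v x - g x) + (v1 x - g1 x)).
  by apply/funext => x; ring.
have -> : (fun x => v x + v1 x + (g x + g1 x)) = (fun x => (v x + g x) + (v1 x + g1 x)).
  by apply/funext => x; ring.
have Lp := L2cB Lv Lg; have Lp1 := L2cB Lv1 Lg1; have Lq := L2cD Lv Lg; have Lq1 := L2cD Lv1 Lg1.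
have Lp' := L2cB Lv' Lg'; have Lq' := L2cD Lv' Lg'.
rewrite /M (kernel_formDl mom omc (bpair_L2 Lp Lq') (bpair_L2 Lp1 Lq')).
rewrite (kernel_formDr mom omc (bpair_L2 Lp' Lq) (bpair_L2 Lp' Lq1)).
by atoms; ring.
Qed.

Lemma lyapunov_formZ k g v g' v' : L2c g -> L2c v -> L2c g' -> L2c v' ->
  lyapunov_form (fun x => k * g x) (fun x => k * v x) g' v' = k * lyapunov_form g v g' v'.
Proof.
move=> Lg Lv Lg' Lv'; rewrite /lyapunov_form !ipZl//.
have -> : ci (fun x => a x * (k * g x * v' x + g' x * (k * v x))) =
    k * ci (fun x => a x * (g x * v' x + g' x * v x)).
  rewrite -ciZ; first by apply: eq_ci => x; ring.
  move: (CintD (Cint_wt Lg Lv') (Cint_wt Lg' Lv)); congr Cint; apply/funext => x; ring.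
have -> : (fun x => k * v x - k * g x) = (fun x => k * (v x - g x)).
  by apply/funext => x; ring.
have -> : (fun x => k * v x + k * g x) = (fun x => k * (v x + g x)).
  by apply/funext => x; ring.
have Lp := L2cB Lv Lg; have Lq := L2cD Lv Lg; have Lp' := L2cB Lv' Lg'; have Lq' := L2cD Lv' Lg'.
rewrite /M (kernel_formZl mom omc k (bpair_L2 Lp Lq')) (kernel_formZr mom omc k (bpair_L2 Lp' Lq)).
by atoms; ring.
Qed.

Lemma A_ge0 : 0 <= A. Proof. exact: le_trans (normr_ge0 _) (aA 0). Qed.

Lemma wt_le g v : L2c g -> L2c v -> `|ci (fun x => a x * (g x * v x))| <= A * (nrm g * nrm v).
Proof.
move=> Lg Lv; apply: le_trans (ci_abs (Cint_wt Lg Lv)) _.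
have [_ _ I1] := L2_mul (L2c_abs Lg) (L2c_abs Lv).
apply: (@le_trans _ _ (ci (fun x => A * (`|g x| * `|v x|)))).
  apply: ci_le => [||x]; [exact: Cint_abs (Cint_wt Lg Lv)|exact: CintZ|].
  by rewrite !normrM ler_wpM2r ?mulr_ge0.
rewrite ciZ// ler_wpM2l ?A_ge0//.
have := CS_nrm (L2c_abs Lg) (L2c_abs Lv); rewrite /nrm.
have E c : ip (fun d => `|c d|) (fun d => `|c d|) = ip c c.
  by apply: eq_ci => d; rewrite -normrM ger0_norm// -expr2 sqr_ge0.
by rewrite !E; apply: le_trans; exact: ler_norm.
Qed.

Lemma nrmN g : nrm (fun x => - g x) = nrm g.
Proof. by congr Num.sqrt; apply: eq_ci => x; rewrite mulrNN. Qed.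

Lemma nrmB_le g v : L2c g -> L2c v -> nrm (fun x => g x - v x) <= nrm g + nrm v.
Proof.
by move=> Lg Lv; apply: le_trans (nrm_triangle Lg (L2cN Lv)) _; rewrite nrmN.
Qed.

Lemma nrm_en_l g v : nrm g <= Num.sqrt (en g v).
Proof. by rewrite ler_sqrt ?addr_ge0 ?ip_ge0// lerDl ip_ge0. Qed.
Lemma nrm_en_r g v : nrm v <= Num.sqrt (en g v).
Proof. by rewrite ler_sqrt ?addr_ge0 ?ip_ge0// lerDr ip_ge0. Qed.

Lemma double_le (x y z : R) : x <= z -> y <= z -> x + y <= 2 * z.
Proof. by move=> xz yz; rewrite mulr_natl mulr2n lerD. Qed.

Lemma half_le (x y z : R) : x <= z -> y <= z -> 2^-1 * (x + y) <= z.
Proof. by move=> xz yz; rewrite mulrC ler_pdivrMr// mulrC double_le. Qed.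

Lemma quarter_le (x y z : R) : x <= 2 * z -> y <= 2 * z -> 4^-1 * (x + y) <= z.
Proof. by move=> xz yz; have := double_le xz yz; lra. Qed.

Lemma lyapunov_form_le g v g' v' : L2c g -> L2c v -> L2c g' -> L2c v' ->
  `|lyapunov_form g v g' v'| <= (N + A + K * osize om) * Num.sqrt (en g v) * Num.sqrt (en g' v').
Proof.
move=> Lg Lv Lg' Lv'; have A0 := A_ge0; have K0' := K0; have N0' := N0; have o0 := osize_ge0 om.
have := nrm_en_l g v; have := nrm_en_r g v; have := nrm_en_l g' v'; have := nrm_en_r g' v'.
set X := Num.sqrt (en g v); set X' := Num.sqrt (en g' v') => v'X g'X vX gX.
have n1 := nrm_ge0 g; have n2 := nrm_ge0 v; have n3 := nrm_ge0 g'; have n4 := nrm_ge0 v'.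
have X0 : 0 <= X := le_trans n1 gX; have X'0 : 0 <= X' := le_trans n3 g'X.
have XX' := mulr_ge0 X0 X'0.
have m1 := CS_nrm Lg Lg'; have m2 := CS_nrm Lv Lv'.
have m3 := wt_le Lg Lv'; have m4 := wt_le Lg' Lv.
have Lp := L2cB Lv Lg; have Lq := L2cD Lv Lg; have Lp' := L2cB Lv' Lg'; have Lq' := L2cD Lv' Lg'.
have m5 := kernel_form_le mom omc Lp Lq'; have m6 := kernel_form_le mom omc Lp' Lq.
have k1 : nrm g * nrm g' <= X * X' by apply: ler_pM.
have k2 : nrm v * nrm v' <= X * X' by apply: ler_pM.
have k3 : A * (nrm g * nrm v') <= A * (X * X') by rewrite ler_wpM2l// ler_pM.
have k4 : A * (nrm g' * nrm v) <= A * (X * X') by rewrite ler_wpM2l// [X * X']mulrC ler_pM.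
have k5 : osize om * (2^-1 * (nrm (fun x => v x - g x) * nrm (fun x => v' x + g' x))) <= osize om * (2 * (X * X')).
  rewrite ler_wpM2l// (_ : 2 * (X * X') = 2^-1 * ((2 * X) * (2 * X'))); last by field.
  rewrite ler_wpM2l ?invr_ge0// ler_pM ?nrm_ge0//.
    by apply: le_trans (nrmB_le Lv Lg) _; exact: double_le.
  by apply: le_trans (nrm_triangle Lv' Lg') _; exact: double_le.
have k6 : osize om * (2^-1 * (nrm (fun x => v' x - g' x) * nrm (fun x => v x + g x))) <= osize om * (2 * (X * X')).
  rewrite ler_wpM2l// (_ : 2 * (X * X') = 2^-1 * ((2 * X') * (2 * X))); last by field.
  rewrite ler_wpM2l ?invr_ge0// ler_pM ?nrm_ge0//.
    by apply: le_trans (nrmB_le Lv' Lg') _; exact: double_le.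
  by apply: le_trans (nrm_triangle Lv Lg) _; exact: double_le.
rewrite /lyapunov_form ci_wt//.
have e1 : `|N / 2 * (ip g g' + ip v v')| <= N * (X * X').
  rewrite normrM (ger0_norm (divr_ge0 N0' _))// -mulrA ler_wpM2l//.
  apply: le_trans (ler_wpM2l _ (ler_normD _ _)) _; first by rewrite invr_ge0.
  exact: half_le (le_trans m1 k1) (le_trans m2 k2).
have e2 : `|2^-1 * (ci (fun x => a x * (g x * v' x)) + ci (fun x => a x * (g' x * v x)))| <= A * (X * X').
  rewrite normrM ger0_norm ?invr_ge0//.
  apply: le_trans (ler_wpM2l _ (ler_normD _ _)) _; first by rewrite invr_ge0.
  exact: half_le (le_trans m3 k3) (le_trans m4 k4).
have e3 : `|K / 4 * (M (fun x => v x - g x) (fun x => v' x + g' x) + M (fun x => v' x - g' x) (fun x => v x + g x))|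
    <= K * (osize om * (X * X')).
  rewrite normrM (ger0_norm (divr_ge0 K0' _))// -mulrA ler_wpM2l//.
  apply: le_trans (ler_wpM2l _ (ler_normD _ _)) _; first by rewrite invr_ge0.
  move: (le_trans m5 k5) (le_trans m6 k6); rewrite mulrCA; exact: quarter_le.
apply: le_trans (ler_normD _ _) _; apply: le_trans (lerD (ler_normD _ _) e3) _.
have : (N + A + K * osize om) * X * X' = N * (X * X') + A * (X * X') + K * (osize om * (X * X')) by ring.
move=> ->; rewrite lerD2r; exact: lerD.
Qed.

Lemma lyapunov_form_coercive g v : L2c g -> L2c v ->
  (N / 2 - A / 2 - K * osize om / 4) * en g v <= lyapunov_form g v g v.
Proof.
move=> Lg Lv; have A0 := A_ge0; have K0' := K0; have o0 := osize_ge0 om.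
have Lp := L2cB Lv Lg; have Lq := L2cD Lv Lg.
have m1 := wt_le Lg Lv; have m2 := kernel_form_le mom omc Lp Lq.
rewrite /lyapunov_form ci_wt// -/(en g v).
set p := (fun x => v x - g x) in Lp m2 *; set q := (fun x => v x + g x) in Lq m2 *.
have pq : ip p p + ip q q = 2 * en g v.
  have [_ _ I1] := L2_mul Lp Lp; have [_ _ I2] := L2_mul Lq Lq.
  have [_ _ I3] := L2_mul Lg Lg; have [_ _ I4] := L2_mul Lv Lv.
  rewrite /en /ip -!ciD// -ciZ; last exact: CintD.
  by apply: eq_ci => x; rewrite /p /q; ring.
have h1 : nrm g * nrm v <= en g v / 2.
  have := sqr_ge0 (nrm g - nrm v); rewrite sqrrB !nrm_sqr /en; lra.
have h2 : nrm p * nrm q <= en g v.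
  have := sqr_ge0 (nrm p - nrm q); rewrite sqrrB !nrm_sqr; lra.
have k1 : `|ci (fun x => a x * (g x * v x))| <= A * (en g v / 2).
  by apply: le_trans m1 _; rewrite ler_wpM2l.
have k2 : K * `|kernel_form om p q| <= K * (osize om * (2^-1 * en g v)).
  by rewrite ler_wpM2l//; apply: le_trans m2 _; rewrite ler_wpM2l// ler_wpM2l// invr_ge0.
have k3 : K * - `|kernel_form om p q| <= K * kernel_form om p q by rewrite ler_wpM2l// lerNl -normrN ler_norm.
move: k1; rewrite ler_norml => /andP[k1 _].
move: k1 k2 k3; rewrite /M; lra.
Qed.

End form.

End damping.

(** * Dissipation *)

Section dissipation.
Context {R : realType}.
Local Notation mu := (@lebesgue_measure R).
Local Notation T := (@circumference R).
Implicit Types (f g h v p q : R -> R).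

(** The last field is the dissipation inequality at a state [(G, V)] whose time
    derivative is [(eta, f)], that is [eta = V'] and [f = G' - W V]. *)
Record damping_form (W : R -> R) (B : (R -> R) -> (R -> R) -> (R -> R) -> (R -> R) -> R) (Kb k : R)
  : Prop := DampingForm {
  df_K : 0 <= Kb;
  df_D : forall g v g1 v1 g' v', L2c g -> L2c v -> L2c g1 -> L2c v1 -> L2c g' -> L2c v' ->
    B (fun x => g x + g1 x) (fun x => v x + v1 x) g' v' = B g v g' v' + B g1 v1 g' v';
  df_Z : forall c g v g' v', L2c g -> L2c v -> L2c g' -> L2c v' ->
    B (fun x => c * g x) (fun x => c * v x) g' v' = c * B g v g' v';
  df_C : forall g v g' v', B g v g' v' = B g' v' g v;
  df_coercive : forall g v, L2c g -> L2c v -> en g v <= B g v g v;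
  df_le : forall g v g' v', L2c g -> L2c v -> L2c g' -> L2c v' ->
    `|B g v g' v'| <= Kb * Num.sqrt (en g v) * Num.sqrt (en g' v');
  df_diss : forall G V eta f, is_primitive V eta -> is_primitive G (fun x => f x + W x * V x) ->
    per G -> per V -> L2c eta -> L2c f -> ci G = 0 ->
    B G V eta f <= - k * B G V G V }.

Lemma oi_indic om f : om `<=` circle -> measurable (om : set (measurableTypeR R)) ->
  oi om f = ci (fun x => \1_om x * f x).
Proof.
move=> omc mom; rewrite /oi /ci -{1}(setIidr omc) Rintegral_mkcondr.
apply: eq_Rintegral => x _; rewrite patchE indicE.
by case: ifP => _; rewrite ?mul1r ?mul0r.
Qed.

(** Collects the estimates of [dissipation].  Here [X], [I] and [J] are the
    integrals of [a W g v], [W v^2] and [W g^2], [Y] is twice the energy, [oG],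
    [oV] and [oc] are integrals over the region, [Er] is the effect of the
    damping on the kernel form, and [Ti] is [1 / T]. *)
Lemma diss_arith (N I Y J X oG oV oc Er K Ti d c ke kap C2 : R) :
  - X <= d * J + c * I -> K * oV <= ke * I -> 12 * kap * Y - 2 * Y <= K * (Ti * oc) ->
  - (K / 4 * Er) <= C2 * I + kap * Y -> 0 <= d * I ->
  N / 2 * - I + 2^-1 * (- X - Y - d * (I + J) + K / 2 * (oG + oV)) + K / 4 * (oV - oG - Ti * oc - Er)
   <= - (N / 2 - (ke / 2 + c / 2) - C2) * I - 2 * kap * Y.
Proof. move=> h1 h2 h3 h4 h5; lra. Qed.

Lemma kernel_arith (x y z u e : R) : x + y - - (z + u) = e -> x + z = e - (y + u).
Proof. by move=> <-; ring. Qed.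

Lemma sqrD_arith (x y z u v : R) : x ^+ 2 <= z -> y ^+ 2 <= u -> 0 <= (x - y) ^+ 2 ->
  z + u = 2 * v -> (x + y) ^+ 2 <= 4 * v.
Proof. by rewrite sqrrB sqrrD; lra. Qed.

Variables (W : R -> R) (om : set R) (eps gam : R).
Hypotheses (LW : L1c W) (W0 : forall x, 0 <= W x).
Hypotheses (mom : measurable (om : set (measurableTypeR R))) (omc : om `<=` circle).
Hypotheses (eps0 : 0 < eps) (Weps : forall x, om x -> eps <= W x) (o0 : 0 < osize om) (gam0 : 0 < gam).
Hypothesis Hgap : forall P Q, L2c P -> L2c Q -> ci P = ci Q ->
    gam * (ip P P + ip Q Q) <= oi om (gapN P Q).

Definition bdd h := exists M, forall x, `|h x| <= M.

Lemma bddM h k : bdd h -> bdd k -> bdd (fun x => h x * k x).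
Proof.
move=> [M1 h1] [M2 h2]; exists (M1 * M2) => x; rewrite normrM.
by rewrite ler_pM.
Qed.

Lemma Cint_W h : measurable_fun setT h -> bdd h -> Cint (fun x => W x * h x).
Proof.
move=> mh [M hM]; have [_ mW IW] := LW.
by rewrite (_ : (fun x => _) = (fun x => h x * W x));
  [exact: (Cint_bddM mh hM mW IW)|apply/funext => x; rewrite mulrC].
Qed.

Let w1 := ci W.
(* By [K_low] the gap inequality is worth at least [16 kap] in [hoc], and by
   [delta_w1] the share of [K] that is due to [delta] costs at most [4 kap]. *)
Let kap := gam / (8 * osize om).
Let delta := gam * T / (4 * osize om * (w1 + 1)).
(* This value makes the mean of [alpha] zero, hence [a] vanish at [pi]. *)
Let K := 2 * (T + delta * w1) / osize om.
Let alpha x : R := 2 * (1 + delta * W x) - K * \1_om x.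
Let a x := prim alpha x - prim alpha (- pi).
(* The weight is needed on one period only; cutting it off makes it bounded. *)
Let a1 x : R := \1_circle x * a x.
Let A := li (- pi) pi (fun x => `|alpha x|).

Let T0 : 0 < T := @circumference_gt0 R.
Let w1_ge0 : 0 <= w1. Proof. exact: ci_ge0. Qed.
Let kap0 : 0 < kap. Proof. by rewrite divr_gt0// mulr_gt0. Qed.
Let delta0 : 0 < delta.
Proof. by rewrite divr_gt0 ?mulr_gt0// ltr_wpDl. Qed.
Let K0 : 0 <= K.
Proof. by rewrite divr_ge0 ?(ltW o0)// mulr_ge0// addr_ge0 ?(ltW T0)// mulr_ge0// ltW. Qed.

Let delta_w1 : delta * w1 / (2 * T) <= kap.
Proof.
rewrite /delta /kap ler_pdivrMr ?mulr_gt0// mulrAC ler_pdivrMr ?mulr_gt0 ?ltr_wpDl//.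
rewrite [leRHS](_ : _ = gam * T * (w1 + 1)).
  by rewrite ler_wpM2l ?lerDl// mulr_ge0// ltW.
by move: (@circumference R) => t; field; rewrite gt_eqF.
Qed.

Let K_low : 4 * kap <= K * gam / (4 * T).
Proof.
have e : 4 * kap = 2 * T / osize om * gam / (4 * T).
  by rewrite /kap; move: T0; move: (@circumference R) => t t0; field; rewrite !gt_eqF.
rewrite e ler_pM2r ?invr_gt0 ?mulr_gt0// ler_pM2r// /K ler_pM2r ?invr_gt0//.
by rewrite ler_pM2l// lerDl mulr_ge0// ltW.
Qed.

Let K_os : K * osize om / (4 * T) = 2^-1 + delta * w1 / (2 * T).
Proof. rewrite /K divfK ?gt_eqF//; move: (delta * w1) T0; move: (@circumference R) => t u t0.
by field; rewrite gt_eqF. Qed.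

Let lint_ind : lint (\1_om : R -> R).
Proof.
apply: (@lint_le _ _ (cst 1)); [exact: measurable_indic|exact: lint_cst|].
by move=> x; rewrite indicE; case: (_ \in _); rewrite ?normr1 ?normr0.
Qed.

Let lint_alpha : lint alpha.
Proof.
apply: lintB; last exact: lintZ.
by apply: lintZ; apply: lintD; [exact: lint_cst|apply/lintZ/L1c_lint].
Qed.

Let Aa : is_primitive a alpha.
Proof.
have := primitiveB (prim_primitive lint_alpha) (primitive_cst (prim alpha (- pi))).
by congr is_primitive; apply/funext => x; rewrite subr0.
Qed.

Let a_lpi : a (- pi) = 0. Proof. exact: subrr. Qed.

Let ci_ind : ci (\1_om) = osize om.
Proof.
have := oi_indic (cst 1) omc mom; rewrite (oi_cst mom 1) mul1r => ->.
by apply: eq_ci => x; rewrite mulr1.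
Qed.

Let Cint_ind : Cint (\1_om).
Proof. by have [_] := lint_ind; apply. Qed.

Let a_pi : a pi = 0.
Proof.
have pi0 := pi_gt0 R; have [_ H] := Aa.
have := H (- pi) pi; rewrite a_lpi subr0 => ->; last lra.
have [_ _ IW] := LW.
rewrite li_circle /alpha ciB; last 2 first.
- by apply/CintZ/CintD; [exact: (Cint_cst 1)|exact: CintZ].
- exact: CintZ.
rewrite (ciZ K Cint_ind) ci_ind ciZ; last by apply: CintD; [exact: (Cint_cst 1)|exact: CintZ].
rewrite ciD; [|exact: (Cint_cst 1)|exact: CintZ].
rewrite ciZ// (ci_cst 1) mul1r -/w1 /K divfK ?gt_eqF//; ring.
Qed.

Let ma1 : measurable_fun setT a1.
Proof.
apply: measurable_funM; last exact: primitive_measurable Aa.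
by apply: measurable_indic; exact: mcircle.
Qed.

Let A0 : 0 <= A. Proof. exact: li_ge0. Qed.

Let a1A x : `|a1 x| <= A.
Proof.
rewrite /a1 normrM indicE; case: (boolP (x \in circle)) => [|_]; last first.
  by rewrite normr0 mul0r.
rewrite inE /circle/= in_itv/= => /andP[x1 x2]; rewrite normr1 mul1r.
have := @primitive_bound _ a alpha (- pi) pi x Aa; rewrite a_lpi normr0 add0r; apply.
by rewrite x1 ltW.
Qed.

Let ci_a1 h : ci (fun x => a1 x * h x) = ci (fun x => a x * h x).
Proof.
apply: eq_Rintegral => x cx; rewrite /a1 indicE cx mul1r//.
Qed.

(* The next four constants come from Young's inequality and from the lower
   bound of the damping on the region; [N] dominates the sum of all losses. *)
Let C2 := K ^+ 2 * T * w1 / (64 * kap).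
Let c := A ^+ 2 / (4 * delta).
Let ke := K / eps.
Let N := 2 * (1 + A / 2 + K * osize om / 4 + (ke / 2 + c / 2) + C2).
Let form := lyapunov_form om a1 K N.

Let C2_ge0 : 0 <= C2.
Proof.
by apply: divr_ge0; rewrite mulr_ge0 ?(ltW kap0) ?w1_ge0// mulr_ge0 ?sqr_ge0// ltW.
Qed.
Let c_ge0 : 0 <= c.
Proof. by apply: divr_ge0; rewrite ?sqr_ge0// mulr_ge0// ltW. Qed.
Let ke_ge0 : 0 <= ke.
Proof. by apply: divr_ge0; rewrite ?K0// ltW. Qed.
Let Ko_ge0 : 0 <= K * osize om.
Proof. by rewrite mulr_ge0 ?K0// ltW. Qed.
Let N_ge2 : 2 <= N.
Proof.
have [h1 h2 h3 h4] := And4 C2_ge0 c_ge0 ke_ge0 Ko_ge0; have h5 := A0.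
rewrite /N; lra.
Qed.

Section trajectory.
Variables (G V eta f : R -> R).
Hypotheses (AV : is_primitive V eta) (AG : is_primitive G (fun x => f x + W x * V x)).
Hypotheses (pG : per G) (pV : per V) (Leta : L2c eta) (Lf : L2c f) (G0 : ci G = 0).

Let mG : measurable_fun setT G := primitive_measurable AG.
Let mV : measurable_fun setT V := primitive_measurable AV.
Let bG : bdd G := periodic_primitive_bdd AG pG.
Let bV : bdd V := periodic_primitive_bdd AV pV.
Let LG : L2c G := L2c_periodic_primitive AG pG.
Let LV : L2c V := L2c_periodic_primitive AV pV.
Let p x := V x - G x.
Let q x := V x + G x.
Let Lp : L2c p := L2cB LV LG.
Let Lq : L2c q := L2cD LV LG.
Let I := ci (fun x => W x * (V x * V x)).
Let J := ci (fun x => W x * (G x * G x)).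
Let Y := en G V.
Let X := ci (fun x => a1 x * (W x * (G x * V x))).

Let CI : Cint (fun x => W x * (V x * V x)).
Proof. by apply: Cint_W; [exact: measurable_funM|exact: bddM]. Qed.
Let CJ : Cint (fun x => W x * (G x * G x)).
Proof. by apply: Cint_W; [exact: measurable_funM|exact: bddM]. Qed.
Let CWGV : Cint (fun x => W x * (G x * V x)).
Proof. by apply: Cint_W; [exact: measurable_funM|exact: bddM]. Qed.
Let mW : measurable_fun setT W. Proof. by case: LW. Qed.
Let CX : Cint (fun x => a1 x * (W x * (G x * V x))).
Proof.
apply: (Cint_bddM ma1 a1A _ CWGV); by apply: measurable_funM => //; exact: measurable_funM.
Qed.
Let I0 : 0 <= I. Proof. by apply: ci_ge0 => x; rewrite mulr_ge0// -expr2 sqr_ge0. Qed.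
Let J0 : 0 <= J. Proof. by apply: ci_ge0 => x; rewrite mulr_ge0// -expr2 sqr_ge0. Qed.
Let Y0 : 0 <= Y. Proof. by rewrite addr_ge0 ?ip_ge0. Qed.

Let ener : ip G eta + ip V f = - I.
Proof.
have pGV : per (fun x => G x * V x) by move=> x; rewrite pG pV.
have := ci_periodic_derivative (primitiveM AG AV) pGV.
have [_ _ I1] := L2_mul LG Leta; have [_ _ I2] := L2_mul LV Lf.
rewrite (@eq_ci _ _ (fun x => G x * eta x + V x * f x + W x * (V x * V x))); last by move=> x; ring.
by rewrite ciD//; [rewrite ciD// -/I -/(ip _ _) -/(ip _ _); lra|exact: CintD].
Qed.

Let pq_en : ip p p + ip q q = 2 * Y.
Proof.
have [_ _ I1] := L2_mul Lp Lp; have [_ _ I2] := L2_mul Lq Lq.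
have [_ _ I3] := L2_mul LG LG; have [_ _ I4] := L2_mul LV LV.
rewrite /Y /en /ip -!ciD// -ciZ; last exact: CintD.
by apply: eq_ci => x; rewrite /p /q; ring.
Qed.

Let weight : ci (fun x => a1 x * (G x * f x + eta x * V x)) =
  - X - Y - delta * (I + J) + K / 2 * (oi om (fun x => G x * G x) + oi om (fun x => V x * V x)).
Proof.
have APhi := primitiveD (primitiveM AG AG) (primitiveM AV AV); have AM := primitiveM Aa APhi.
have pi0 := pi_gt0 R; have [lM HM] := AM.
have := HM (- pi) pi; rewrite a_lpi a_pi !mul0r subrr => /(_ ltac:(lra))/esym.
rewrite li_circle => E0.
have [_ /(_ (- pi) pi) C1] := lint_primitiveM Aa (primitive_lint APhi).
have [_ /(_ (- pi) pi) C3] := lint_primitiveM APhi lint_alpha.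
move: E0; rewrite ciD//.
have [_ _ Lf1] := L2_mul LG Lf; have [_ _ Le1] := L2_mul Leta LV.
have mG2 : measurable_fun setT (fun x => G x * f x) by apply: measurable_funM => //; case: Lf.
have mV2 : measurable_fun setT (fun x => eta x * V x) by apply: measurable_funM => //; case: Leta.
have CZ : Cint (fun x => a1 x * (G x * f x + eta x * V x)).
  by apply: (Cint_bddM ma1 a1A); [exact: measurable_funD|exact: CintD].
have -> : ci (fun x => a x * (G x * (f x + W x * V x) + G x * (f x + W x * V x) + (V x * eta x + V x * eta x)))
    = 2 * (ci (fun x => a1 x * (G x * f x + eta x * V x)) + X).
  rewrite -ci_a1 /X -ciD// -ciZ; last exact: CintD.
  by apply: eq_ci => x; ring.
have [_ _ IG] := L2_mul LG LG; have [_ _ IV] := L2_mul LV LV.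
have CoG : Cint (fun x => \1_om x * (G x * G x)).
  apply: (@Cint_bddM _ 1) => //; last exact: measurable_funM.
  by move=> x; rewrite indicE; case: (_ \in _); rewrite ?normr1 ?normr0.
have CoV : Cint (fun x => \1_om x * (V x * V x)).
  apply: (@Cint_bddM _ 1) => //; last exact: measurable_funM.
  by move=> x; rewrite indicE; case: (_ \in _); rewrite ?normr1 ?normr0.
have -> : ci (fun x => (G x * G x + V x * V x) * alpha x) =
   2 * Y + 2 * delta * (I + J) - K * (oi om (fun x => G x * G x) + oi om (fun x => V x * V x)).
  rewrite !oi_indic// /Y /en /ip /I /J -!ciD// -!ciZ; try exact: CintD.
  rewrite -ciD; [|by apply: CintZ; exact: CintD|by apply: CintZ; exact: CintD].
  rewrite -ciB.
  - by apply: eq_ci => x; rewrite /alpha; ring.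
  - by apply: CintD; apply: CintZ; exact: CintD.
  - by apply: CintZ; exact: CintD.
by move=> E; lra.
Qed.

(** Young's inequality with the factor [W] in front: the term in [g] goes to
    the part of the weight proportional to [delta W]. *)
Let hX : - X <= delta * J + c * I.
Proof.
have d0 := delta0.
rewrite /X /I /J -ciN// -!ciZ// -ciD; [|exact: CintZ|exact: CintZ].
apply: ci_le => [||x]; [exact: CintN|by apply: CintD; exact: CintZ|].
have h1 : a1 x ^+ 2 <= A ^+ 2.
  by rewrite -(real_normK (num_real (a1 x))) ler_sqr ?nnegrE ?normr_ge0 ?A0 ?a1A.
have h2 : a1 x ^+ 2 / (4 * delta) <= c by rewrite /c ler_pM2r// invr_gt0 mulr_gt0.
rewrite -subr_ge0; have -> : delta * (W x * (G x * G x)) + c * (W x * (V x * V x)) - - (a1 x * (W x * (G x * V x)))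
   = W x * (delta * (G x + a1 x / (2 * delta) * V x) ^+ 2 + (c - a1 x ^+ 2 / (4 * delta)) * V x ^+ 2).
  by field; rewrite gt_eqF.
rewrite mulr_ge0// addr_ge0// mulr_ge0 ?sqr_ge0 ?(ltW d0)// subr_ge0//.
Qed.

Let OV : Oint om (fun x => V x * V x).
Proof. by apply: Cint_Oint => //; have [] := L2_mul LV LV. Qed.
Let OG : Oint om (fun x => G x * G x).
Proof. by apply: Cint_Oint => //; have [] := L2_mul LG LG. Qed.

Let hV : K * oi om (fun x => V x * V x) <= ke * I.
Proof.
rewrite /ke -mulrA; apply: ler_wpM2l; first exact: K0.
rewrite [_^-1 * I]mulrC ler_pdivlMr// mulrC.
have OWV := Cint_Oint mom omc CI.
apply: (@le_trans _ _ (oi om (fun x => W x * (V x * V x)))); last first.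
  by apply: oi_le_ci => // x; rewrite mulr_ge0// -expr2 sqr_ge0.
rewrite /oi -(RintegralZl _ mom OV); apply: le_Rintegral => //.
  exact: (integrableZl mom eps OV).
by move=> x ox; rewrite ler_wpM2r ?Weps// -expr2 sqr_ge0.
Qed.

Let pq0 : ci p = ci q.
Proof.
have [_ _ I1] := L2_L1 LV; have [_ _ I2] := L2_L1 LG.
by rewrite /p /q ciB// ciD// G0 addr0 subr0.
Qed.

Let oc := oi om (correlation (cst 1) p q).

Let Ocor : Oint om (correlation (cst 1) p q).
Proof.
have s1 (x : R) : `|cst 1 x| <= 1 :> R by rewrite normr1.
by apply: (Oint_correlation mom omc _ s1); [|exact: bpair_L2].
Qed.

(** The gap inequality, after the square in its right-hand side is expanded. *)
Let hoc : 12 * kap * Y - 2 * Y <= K * (T^-1 * oc).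
Proof.
have := Hgap Lp Lq pq0; rewrite pq_en.
have -> : oi om (gapN p q) = 2 * Y * osize om + 2 * oc.
  rewrite -(oi_cst mom (2 * Y)) /oc /oi.
  have Oc : Oint om (cst (2 * Y)) by apply: (@Oint_bdd _ om mom omc `|2 * Y|).
  rewrite -(RintegralZl _ mom Ocor) -RintegralD//; last exact: (integrableZl mom 2 Ocor).
  by congr Rintegral; apply/funext => z; rewrite gapNE// pq_en.
move=> h; have {}h : (gam - osize om) * Y <= oc by lra.
have k : 0 <= K / T by rewrite divr_ge0 ?K0// ltW.
have {}h := ler_wpM2l k h.
rewrite [K * (_ * _)]mulrA; apply: le_trans h.
have -> : 12 * kap * Y - 2 * Y = (12 * kap - 2) * Y by ring.
rewrite [K / T * _]mulrA ler_wpM2r//.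
have k1 := K_low; have k2 := K_os; have k3 := delta_w1.
have e1 : K / T * (gam - osize om) = 4 * (K * gam / (4 * T)) - 4 * (K * osize om / (4 * T)).
  by move: K T0; move: (@circumference R) => t u t0; field; rewrite gt_eqF.
rewrite e1 k2; lra.
Qed.

Let WV x := W x * V x.
Let LWV : L1c WV.
Proof.
have [M hM] := bV; rewrite (_ : WV = fun x => V x * W x); last by apply/funext => x; rewrite /WV mulrC.
exact: (L1c_bddM pV mV hM LW).
Qed.

Let bp : bdd p.
Proof.
have [M1 h1] := bV; have [M2 h2] := bG; exists (M1 + M2) => x.
by apply: le_trans (ler_normB _ _) _; exact: lerD.
Qed.
Let bq : bdd q.
Proof.
have [M1 h1] := bV; have [M2 h2] := bG; exists (M1 + M2) => x.
by apply: le_trans (ler_normD _ _) _; exact: lerD.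
Qed.
Let mp : measurable_fun setT p. Proof. exact: measurable_funB. Qed.
Let mq : measurable_fun setT q. Proof. exact: measurable_funD. Qed.

Let bp1 : bpair p WV. Proof. by have [M hM] := bp; exact: (bpair_bL1 LWV mp hM). Qed.
Let bp2 : bpair WV q. Proof. by have [M hM] := bq; exact: (bpair_L1b LWV mq hM). Qed.

Let Er := kernel_form om p WV + kernel_form om WV q.

(** The time derivatives of [p] and [q] are [- p'] and [q'] up to [W V], so the
    kernel form is differentiated by [correlation_parts] at each point of the
    region, with the error [Er]. *)
Let kernel_part : kernel_form om p (fun x => f x + eta x) + kernel_form om (fun x => f x - eta x) q =
  oi om (fun x => V x * V x) - oi om (fun x => G x * G x) - T^-1 * oc - Er.
Proof.
have Lfe := L2cD Lf Leta; have Lfe' := L2cB Lf Leta.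
pose q' x := (f x + eta x) + WV x; pose p' x := - (f x - eta x) - WV x.
have Aq : is_primitive q q'.
  have := primitiveD AV AG; congr is_primitive; by apply/funext => x; rewrite /q' /WV; ring.
have Ap : is_primitive p p'.
  have := primitiveB AV AG; congr is_primitive; by apply/funext => x; rewrite /p' /WV; ring.
have b1 := bpair_L2 Lp Lfe; have b2 := bpair_L2 Lfe' Lq.
have E1 : kernel_form om p q' = kernel_form om p (fun x => f x + eta x) + kernel_form om p WV := kernel_formDr mom omc b1 bp1.
have b3 : bpair (fun x => -1 * (f x - eta x)) q := bpair_L2 (L2cZ (-1) Lfe') Lq.
have b4 : bpair (fun x => -1 * WV x) q.
  by have [M hM] := bq; exact: (bpair_L1b (L1cZ (-1) LWV) mq hM).
have E2 : kernel_form om p' q = - (kernel_form om (fun x => f x - eta x) q + kernel_form om WV q).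
  rewrite (_ : p' = fun x => -1 * (f x - eta x) + -1 * WV x); last first.
    by apply/funext => x; rewrite /p' !mulN1r.
  by rewrite (kernel_formDl mom omc b3 b4) (kernel_formZl mom omc _ b2) (kernel_formZl mom omc _ bp2) !mulN1r opprD.
suff E : kernel_form om p q' - kernel_form om p' q = oi om (fun x => V x * V x) - oi om (fun x => G x * G x) - T^-1 * oc.
  by move: E; rewrite E1 E2; exact: kernel_arith.
have Lq' : L1c q' := L1cD (L2_L1 Lfe) LWV.
have Lp' : L1c p'.
  have := L1cB (L2_L1 (L2cN Lfe')) LWV; by [].
have b5 : bpair p q' by have [M hM] := bp; exact: (bpair_bL1 Lq' mp hM).
have b6 : bpair p' q by have [M hM] := bq; exact: (bpair_L1b Lp' mq hM).
have O5 := Oint_correlation mom omc (@sawtooth_meas R) (@sawtooth_le R) b5.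
have O6 := Oint_correlation mom omc (@sawtooth_meas R) (@sawtooth_le R) b6.
have OVG : Oint om (fun z => V z * V z - G z * G z) := integrableB mom OV OG.
have OT : Oint om (fun z => T^-1 * correlation (cst 1) p q z) := integrableZl mom _ Ocor.
rewrite /oc /kernel_form /oi -(RintegralB mom O5 O6) -(RintegralZl _ mom Ocor).
rewrite -(RintegralB mom OV OG) -(RintegralB mom OVG OT).
congr Rintegral; apply/funext => z.
rewrite (correlation_parts z Ap Aq); [|by case: b5|by case: b6].
by rewrite /p /q; ring.
Qed.

(** Cauchy-Schwarz for the measure of density [W]. *)
Let WV_sqr : (ci (fun x => `|WV x|)) ^+ 2 <= w1 * I.
Proof.
have -> : ci (fun x => `|WV x|) = ci (fun x => W x * `|V x|).
  by apply: eq_ci => x; rewrite normrM ger0_norm.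
have bN : bdd (fun x => `|V x|) by have [M hM] := bV; exists M => x; rewrite normr_id.
have CN : Cint (fun x => W x * `|V x|) by apply: Cint_W => //; exact: measurableT_comp.
have [_ _ IW] := LW.
apply: quad_discr => // t; rewrite /I /w1 -!ciZ// -!ciD//; try exact: CintZ; last first.
  by apply: CintD => //; exact: CintZ.
apply: ci_ge0 => x.
have -> : W x + 2 * t * (W x * `|V x|) + t ^+ 2 * (W x * (V x * V x)) = W x * (1 + t * `|V x|) ^+ 2.
  have -> : V x * V x = `|V x| ^+ 2 by rewrite real_normK ?num_real.
  ring.
by rewrite mulr_ge0 ?sqr_ge0.
Qed.

Let pq_sqr : (ci (fun x => `|p x|) + ci (fun x => `|q x|)) ^+ 2 <= 4 * (T * Y).
Proof.
have h1 := ci_abs_le Lp; have h2 := ci_abs_le Lq.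
have h3 := sqr_ge0 (ci (fun x => `|p x|) - ci (fun x => `|q x|)).
have : T * ip p p + T * ip q q = 2 * (T * Y) by rewrite -mulrDr pq_en mulrCA.
exact: sqrD_arith h1 h2 h3.
Qed.

Let hE : - (K / 4 * Er) <= C2 * I + kap * Y.
Proof.
have m1 := kernel_form_err mom omc (L2_L1 Lp) LWV bp1; have m2 := kernel_form_err mom omc LWV (L2_L1 Lq) bp2.
set b := ci (fun x => `|WV x|) in m1 m2 *.
have b2 : b ^+ 2 <= w1 * I := WV_sqr.
pose d := ci (fun x => `|p x|) + ci (fun x => `|q x|).
have d2 : d ^+ 2 <= 4 * (T * Y) := pq_sqr.
have b0 : 0 <= b by exact: ci_ge0.
have hEr : `|Er| <= 2^-1 * (b * d).
  apply: le_trans (ler_normD _ _) _; apply: le_trans (lerD m1 m2) _.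
  by rewrite /d [ci (fun x => `|p x|) * b]mulrC -!mulrDr.
have k0 : 0 <= K / 4 by rewrite divr_ge0 ?K0.
apply: (@le_trans _ _ (K / 8 * (b * d))).
  rewrite -mulrN; apply: le_trans (ler_wpM2l k0 (_ : _ <= `|Er|)) _; first by rewrite -normrN ler_norm.
  apply: le_trans (ler_wpM2l k0 hEr) _.
  by rewrite le_eqVlt; apply/orP; left; apply/eqP; field.
have k00 : 0 <= kap := ltW kap0.
apply: young_sqr => //.
rewrite exprMn [(b * d) ^+ 2]exprMn.
have -> : 4 * C2 * kap * (I * Y) = (K / 8) ^+ 2 * ((w1 * I) * (4 * (T * Y))).
  rewrite /C2; move: kap0; move: kap => k kk; move: (@circumference R) K => t u.
  by field; rewrite gt_eqF.
by rewrite ler_wpM2l ?sqr_ge0// ler_pM ?sqr_ge0.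
Qed.

Lemma dissipation : form G V eta f <= - (N / 2 - (ke / 2 + c / 2) - C2) * I - 2 * kap * Y.
Proof.
rewrite /form /lyapunov_form weight kernel_part ener.
exact: (diss_arith N _ hX hV hoc hE (mulr_ge0 (ltW delta0) I0)).
Qed.

End trajectory.

(** The loss of [2 kap] times [en G V] becomes a rate through the upper bound of
    the form, and [N] makes the form dominate [en]. *)
Lemma exists_damping_form : exists B Kb k, 0 < k /\ damping_form W B Kb k.
Proof.
have N0 : 0 <= N by apply: le_trans N_ge2.
have Kb0 : 0 < N + A + K * osize om.
  by have := N_ge2; have := A0; have := Ko_ge0; lra.
exists form, (N + A + K * osize om), (2 * kap / (N + A + K * osize om)).
split; first by rewrite divr_gt0// mulr_gt0.
split.
- exact: ltW.
- by move=> *; exact: (lyapunov_formD K N mom omc ma1 a1A).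
- by move=> *; exact: (lyapunov_formZ K N mom omc ma1 a1A).
- by move=> *; exact: lyapunov_formC.
- move=> g v Lg Lv; apply: le_trans (@lyapunov_form_coercive _ om a1 A K N mom omc ma1 a1A K0 _ _ Lg Lv).
  rewrite ler_peMl ?addr_ge0 ?ip_ge0//.
  by have [h1 h2 h3 h4] := And4 C2_ge0 c_ge0 ke_ge0 Ko_ge0; rewrite /N; lra.
- by move=> *; exact: (@lyapunov_form_le _ om a1 A K N mom omc ma1 a1A K0 N0).
- move=> G V eta f AV AG pG pV Le Lf G0.
  apply: le_trans (dissipation AV AG pG pV Le Lf G0) _.
  have LG : L2c G := L2c_periodic_primitive AG pG; have LV : L2c V := L2c_periodic_primitive AV pV.
  have e0 : 0 <= en G V by rewrite addr_ge0 ?ip_ge0.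
  have := le_trans (ler_norm _) (@lyapunov_form_le _ om a1 A K N mom omc ma1 a1A K0 N0 _ _ _ _ LG LV LG LV).
  rewrite -/(form G V G V) -mulrA -expr2 sqr_sqrtr// => h.
  have {}h : 2 * kap / (N + A + K * osize om) * form G V G V <= 2 * kap * en G V.
    rewrite -mulrA; apply: ler_wpM2l; last by rewrite mulrC ler_pdivrMr// mulrC.
    by rewrite mulr_ge0// ltW.
  have I0 : 0 <= ci (fun x => W x * (V x * V x)).
    by apply: ci_ge0 => x; rewrite mulr_ge0// -expr2 sqr_ge0.
  have N1 : 0 <= N / 2 - (ke / 2 + c / 2) - C2.
    by have := A0; have := Ko_ge0; rewrite /N; lra.
  have := mulr_ge0 N1 I0; move: h; lra.
Qed.

End dissipation.

(** * Completeness of the square-integrable functions *)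

Section completeness.
Context {R : realType}.
Local Notation mu := (@lebesgue_measure R).
Local Notation T := (@circumference R).
Implicit Types (f g h u v w : R -> R).

Lemma limn_einf_le (u : (\bar R)^nat) (c : \bar R) k : (forall n, (k <= n)%N -> (u n <= c)%E) ->
  (limn_einf u <= c)%E.
Proof.
move=> H; rewrite limn_einf_lim; apply: lime_le; first exact: is_cvg_einfs.
apply: nearW => n; apply: ge_ereal_inf; exists (u (maxn n k)); last by apply: H; exact: leq_maxr.
by exists (maxn n k) => //=; exact: leq_maxl.
Qed.

Lemma measurable_limn_einf (f_ : nat -> R -> \bar R) (D : set R) :
  (forall n, measurable_fun D (f_ n)) -> measurable_fun D (fun x => limn_einf (f_^~ x)).
Proof.
move=> mf; rewrite (_ : (fun x => _) = (fun x => - limn_esup ((fun n x => - f_ n x)%E ^~ x))%E).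
  apply: measurableT_comp => //; apply: measurable_fun_limn_esup => n.
  by apply: measurableT_comp => //; exact: mf.
by apply/funext => x; rewrite -limn_einfN; congr limn_einf; apply/funext => n /=; rewrite oppeK.
Qed.

Definition half k : R := 2^-1 ^+ k.

Lemma half_gt0 k : 0 < half k. Proof. by rewrite exprn_gt0// invr_gt0. Qed.

Lemma sum_half n : \sum_(0 <= k < n) half k <= 2.
Proof.
suff -> : \sum_(0 <= k < n) half k = 2 - 2 * half n by rewrite lerBlDr lerDl mulr_ge0// ltW// half_gt0.
elim: n => [|n IH]; first by rewrite big_nil /half expr0; lra.
rewrite big_nat_recr//= IH /half exprS; lra.
Qed.

Lemma half_lt (e : R) : 0 < e -> exists k, half k <= e.
Proof.
move=> e0; have c : half k @[k --> \oo] --> (0 : R).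
  by apply: cvg_expr; rewrite ger0_norm ?invr_ge0//; lra.
have : \forall k \near \oo, half k < e.
  have /cvgrPdist_lt/(_ e e0) := c; apply: filterS => k.
  by rewrite sub0r normrN; apply: le_lt_trans; exact: ler_norm.
by move=> [k _ Hk]; exists k; apply/ltW/Hk => /=.
Qed.

Lemma ci_nrm f : L2c f -> ci (fun x => `|f x|) <= Num.sqrt T * nrm f.
Proof.
move=> Lf; have T0 := @circumference_gt0 R.
have n0 : 0 <= Num.sqrt T * nrm f by rewrite mulr_ge0 ?sqrtr_ge0 ?nrm_ge0.
rewrite -ler_sqr ?nnegrE ?ci_ge0//.
by rewrite exprMn sqr_sqrtr ?(ltW T0)// nrm_sqr ci_abs_le.
Qed.

Section fast.
Variable h_ : nat -> R -> R.
Hypotheses (Lh : forall k, L2c (h_ k)) (fast : forall k, nrm (fun x => h_ k.+1 x - h_ k x) <= half k).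

(** The increments have a finite sum of L1 norms, so almost everywhere a finite
    sum of absolute values. *)
Lemma fast_cvg_ae : {ae mu, forall x, circle x -> cvgn (h_^~ x)}.
Proof.
pose g k x := `|h_ k.+1 x - h_ k x|.
have Lg k : L1c (g k) := L1c_abs (L2_L1 (L2cB (Lh k.+1) (Lh k))).
have g0 k x : 0 <= g k x by exact: normr_ge0.
have mg k : measurable_fun (circle : set (measurableTypeR R)) (fun x => (g k x)%:E).
  by apply/measurable_EFinP; apply: measurable_funTS; have [] := Lg k.
have mS : measurable_fun (circle : set (measurableTypeR R)) (fun x => \sum_(k <oo) (g k x)%:E)%E.
  by apply: ge0_emeasurable_sum => // k x _ _; rewrite lee_fin.
have S0 x : (0 <= \sum_(k <oo) (g k x)%:E)%E by apply: nneseries_ge0 => k _ _; rewrite lee_fin.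
have fin : (\int[mu]_(x in circle) \sum_(k <oo) (g k x)%:E < +oo)%E.
  rewrite integral_nneseries//; last by move=> k x _; rewrite lee_fin.
  apply: (@le_lt_trans _ _ (Num.sqrt T * 2)%:E); last exact: ltry.
  apply: lime_le.
    by apply: is_cvg_nneseries => k _ _; apply: integral_ge0 => x _; rewrite lee_fin.
  apply: nearW => n.
  apply: (@le_trans _ _ (\sum_(0 <= k < n) (Num.sqrt T * half k)%:E)%E).
    apply: lee_sum => k _; rewrite -EFin_ci//; last by have [] := Lg k.
    rewrite lee_fin; apply: le_trans (ci_nrm (L2cB (Lh k.+1) (Lh k))) _.
    by rewrite ler_wpM2l ?sqrtr_ge0.
  by rewrite sumEFin lee_fin -mulr_sumr ler_wpM2l ?sqrtr_ge0// sum_half.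
have Ig : mu.-integrable circle (fun x => \sum_(k <oo) (g k x)%:E)%E.
  apply/integrableP; split => //.
  by apply: le_lt_trans fin; rewrite le_eqVlt; apply/orP; left; apply/eqP; apply: eq_integral => x _; rewrite gee0_abs.
apply: ae_imp (integrable_ae mcircle Ig) => x Hx cx.
have {}Hx := Hx cx; set S := (\sum_(k <oo) (g k x)%:E)%E in Hx.
have ub n : \sum_(0 <= k < n) g k x <= fine S.
  rewrite -lee_fin fineK// -sumEFin; apply: nneseries_lim_ge => k _ _; by rewrite lee_fin.
have c1 : cvgn [normed series (telescope (h_^~ x))].
  apply: nondecreasing_is_cvgn.
    apply: nondecreasing_series => k _ _; exact: normr_ge0.
  by exists (fine S) => _ [n _ <-]; have := ub n; rewrite /= /series/= /telescope/=.
have c2 := normed_cvg c1.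
rewrite (_ : h_^~ x = (fun n => h_ 0%N x + series (telescope (h_^~ x)) n)).
  by apply: is_cvgD => //; exact: is_cvg_cst.
by apply/funext => n; exact: eq_sum_telescope.
Qed.

(** The upper limit exists at every point, so periodicity and measurability
    hold everywhere and not only where the sequence converges. *)
Definition flim x : R := fine (limn_esup (fun k => (h_ k x)%:E)).

Lemma flim_meas : measurable_fun setT flim.
Proof.
apply: measurableT_comp => //; apply: measurable_fun_limn_esup => k.
by apply/measurable_EFinP; have [] := Lh k.
Qed.

Lemma flim_per : per flim.
Proof.
move=> x; congr (fine (limn_esup _)); apply/funext => k; congr EFin.
by have [] := Lh k.
Qed.

Lemma flim_cvg x : cvgn (h_^~ x) -> h_ k x @[k --> \oo] --> flim x.
Proof.
move=> /cvg_ex[l cl]; suff -> : flim x = l by [].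
have ce : (h_ k x)%:E @[k --> \oo] --> l%:E by apply: cvg_EFin; [exact: nearW|exact: cl].
rewrite /flim is_cvg_limn_esupE; last by apply/cvg_ex; exists l%:E.
by have -> : limn (fun k => (h_ k x)%:E) = l%:E by apply/cvg_lim.
Qed.

(** Fatou's lemma. *)
Lemma flim_dist f c : L2c f -> (exists k, forall j, (k <= j)%N -> nrm (fun x => f x - h_ j x) <= c) ->
  L2c (fun x => f x - flim x) /\ nrm (fun x => f x - flim x) <= c.
Proof.
move=> Lf [k Hk]; have c0 : 0 <= c := le_trans (nrm_ge0 _) (Hk k (leqnn k)).
have [pf mf _] := Lf; have mF := flim_meas; have pF := flim_per.
have mD : measurable_fun setT (fun x => f x - flim x) by exact: measurable_funB.
pose u_ j x := ((f x - h_ j x) ^+ 2)%:E.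
have mu_ j : measurable_fun setT (u_ j).
  apply/measurable_EFinP; apply: measurable_sqr; apply: measurable_funB => //.
  by have [] := Lh j.
have le1 : (\int[mu]_(x in circle) limn_einf (u_^~ x) <= (c ^+ 2)%:E)%E.
  have mc j : measurable_fun (circle : set (measurableTypeR R)) (u_ j) by exact: (measurable_funTS (mu_ j)).
  have u0 j x : circle x -> (0 <= u_ j x)%E by rewrite lee_fin sqr_ge0.
  apply: le_trans (@fatou _ (measurableTypeR R) _ mu circle mcircle u_ mc u0) _.
  apply: (@limn_einf_le _ _ k) => j kj.
  have Lj := L2cB Lf (Lh j); have [_ _ Ij] := Lj.
  rewrite /u_ -EFin_ci//; last by move=> x; exact: sqr_ge0.
  by rewrite lee_fin -[ci _]/(ip _ _) -nrm_sqr ler_sqr ?nnegrE ?nrm_ge0// Hk.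
have e1 : (\int[mu]_(x in circle) ((f x - flim x) ^+ 2)%:E = \int[mu]_(x in circle) limn_einf (u_^~ x))%E.
  apply: ge0_ae_eq_integral.
  - exact: mcircle.
  - by apply/measurable_EFinP; apply: measurable_funTS; exact: measurable_sqr.
  - by apply: measurable_funTS; exact: measurable_limn_einf.
  - by move=> x _; rewrite lee_fin sqr_ge0.
  - move=> x _; rewrite limn_einf_lim; apply: lime_ge; first exact: is_cvg_einfs.
    by apply: nearW => n; apply: le_ereal_inf_tmp => _ [j _ <-]; rewrite lee_fin sqr_ge0.
  - apply: ae_imp fast_cvg_ae => x H cx; have {}H := flim_cvg (H cx).
    have cu : u_ j x @[j --> \oo] --> ((f x - flim x) ^+ 2)%:E.
      apply: cvg_EFin; first exact: nearW.
      rewrite (_ : fine \o _ = fun j => (f x - h_ j x) ^+ 2)//.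
      by rewrite expr2; apply: cvgM; apply: cvgB => //; exact: cvg_cst.
    rewrite is_cvg_limn_einfE; last by apply/cvg_ex; exists ((f x - flim x) ^+ 2)%:E.
    exact/esym/cvg_lim.
have IF : Cint (fun x => (f x - flim x) ^+ 2).
  apply/integrableP; split.
    by apply/measurable_EFinP; apply: measurable_funTS; exact: measurable_sqr.
  apply: (@le_lt_trans _ _ (c ^+ 2)%:E); last exact: ltry.
  apply: le_trans le1; rewrite -e1 le_eqVlt; apply/orP; left; apply/eqP.
  by apply: eq_integral => x _; rewrite /= ger0_norm// sqr_ge0.
have LD : L2c (fun x => f x - flim x).
  by split => // x; rewrite pf pF.
split=> //; rewrite -ler_sqr ?nnegrE ?nrm_ge0// nrm_sqr -lee_fin.
by rewrite /ip EFin_ci ?e1// => x; rewrite -expr2 sqr_ge0.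
Qed.

End fast.

Lemma L2c_complete (f_ : nat -> R -> R) : (forall n, L2c (f_ n)) ->
  (forall e, 0 < e -> exists n0, forall m n, (n0 <= m)%N -> (n0 <= n)%N ->
     nrm (fun x => f_ m x - f_ n x) <= e) ->
  exists2 f, L2c f & forall e, 0 < e -> exists n0, forall n, (n0 <= n)%N ->
     nrm (fun x => f_ n x - f x) <= e.
Proof.
move=> Lf cauchy.
have /choice[N HN] : forall k, exists n0, forall m n, (n0 <= m)%N -> (n0 <= n)%N ->
     nrm (fun x => f_ m x - f_ n x) <= half k.
  by move=> k; apply: cauchy; exact: half_gt0.
pose phi k := (\sum_(i < k.+1) N i)%N.
have Nphi k j : (k <= j)%N -> (N k <= phi j)%N.
  move=> kj; rewrite /phi (bigD1 (Ordinal (kj : (k < j.+1)%N)))//=; exact: leq_addr.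
pose h_ k := f_ (phi k).
have Lh k : L2c (h_ k) by exact: Lf.
have fast k : nrm (fun x => h_ k.+1 x - h_ k x) <= half k.
  by apply: HN; exact: Nphi.
have D k n : (N k <= n)%N -> L2c (fun x => f_ n x - flim h_ x) /\ nrm (fun x => f_ n x - flim h_ x) <= half k.
  move=> kn; apply: (flim_dist Lh fast) => //; exists k => j kj.
  by apply: HN => //; exact: Nphi.
exists (flim h_).
  have [L _] := D 0%N (N 0%N) (leqnn _).
  have := L2cB (Lf (N 0%N)) L; congr L2c; by apply/funext => x; ring.
move=> e e0; have [k ke] := half_lt e0; exists (N k) => n kn.
by apply: le_trans ke; have [] := D k n kn.
Qed.

End completeness.

Local Open Scope complex_scope.

(** * Strongly continuous semigroups and Lyapunov functionals *)

Section real_lemmas.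
Context {R : realType}.

Lemma at_right_le (f : R -> R) :
  (f h @[h --> 0^'+] --> (0 : R)) <->
  (forall e, 0 < e -> exists2 d, 0 < d & forall h, 0 < h <= d -> `|f h| <= e).
Proof.
split.
  move=> /cvgrPdist_le H e e0; have [d /= d0 Hd] := H e e0.
  exists (d / 2); first by rewrite divr_gt0.
  move=> h /andP[h0 hd]; have := Hd h; rewrite /= sub0r normrN (gtr0_norm h0).
  by rewrite sub0r normrN => ->//; lra.
move=> H; apply/cvgrPdist_le => e e0; have [d d0 Hd] := H e e0.
exists d => // h hd h0; rewrite sub0r normrN; apply: Hd; rewrite h0/=.
by move: hd; rewrite /= sub0r normrN (gtr0_norm h0); exact: ltW.
Qed.

(** The set of times up to which [f] stays below the line of slope [e] is an
    interval.  The second hypothesis, a one-sided continuity from the left, shows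
    that it contains its supremum, and the bound on the right derivative that
    this supremum is [d]. *)
Lemma dini_nonincreasing (f : R -> R) (d : R) : 0 <= d ->
  (forall t e, 0 <= t < d -> 0 < e ->
     exists2 r, 0 < r & forall h, 0 < h <= r -> f (t + h) <= f t + e * h) ->
  (forall t e, 0 < t <= d -> 0 < e ->
     exists2 r, 0 < r & forall h, 0 < h <= r -> h <= t -> f t <= f (t - h) + e) ->
  forall t, 0 <= t <= d -> f t <= f 0.
Proof.
move=> d0 fr fl t0 t0d.
suff H e : 0 < e -> f t0 <= f 0 + e * t0.
  have [t00|t00] := eqVneq t0 0; first by rewrite t00.
  have t0p : 0 < t0 by rewrite lt_neqAle eq_sym t00; case/andP: t0d.
  apply/ler_addgt0Pr => e e0; have := H (e / t0) (divr_gt0 e0 t0p).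
  by rewrite divfK.
move=> e0; pose A := [set t | 0 <= t <= d /\ forall s, 0 <= s <= t -> f s <= f 0 + e * s].
have A0 : A 0.
  split; first by rewrite lexx.
  move=> s /andP[s0 s1]; have -> : s = 0 by apply/eqP; rewrite eq_le s0 s1.
  by rewrite mulr0 addr0.
have supA : has_sup A by split; [exists 0|exists d => x [/andP[]]].
set c := sup A.
have c0 : 0 <= c by exact: (ub_le_sup (proj2 supA) A0).
have cd : c <= d by apply: sup_le_ub; [exists 0|move=> x [/andP[]]].
have below s : 0 <= s < c -> f s <= f 0 + e * s.
  move=> /andP[s0 sc]; have [|x [xd Hx] sx] := sup_adherent (eps := c - s) _ supA.
    by rewrite subr_gt0.
  by apply: Hx; rewrite s0 ltW//; move: sx; rewrite -/c; lra.
have Hc : f c <= f 0 + e * c.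
  have [c00|c00] := eqVneq c 0; first by rewrite c00 mulr0 addr0.
  have cp : 0 < c by rewrite lt_neqAle eq_sym c00.
  apply/ler_addgt0Pr => e1 e10; have [|r r0 Hr] := fl c e1 _ e10; first by rewrite cp.
  have hr : 0 < Num.min r c by rewrite lt_min r0.
  have h1 : Num.min r c <= r by rewrite ge_min lexx.
  have h2 : Num.min r c <= c by rewrite ge_min lexx orbT.
  have := Hr (Num.min r c); rewrite hr h1 h2 => /(_ isT isT) h3.
  have := below (c - Num.min r c).
  rewrite subr_ge0 h2 ltrBlDr ltrDl hr => /(_ isT) h4.
  have : 0 <= e * Num.min r c by rewrite mulr_ge0// ltW.
  by rewrite mulrBr in h4; lra.
have Ac s : 0 <= s <= c -> f s <= f 0 + e * s.
  move=> /andP[s0]; rewrite le_eqVlt => /orP[/eqP->//|sc].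
  by apply: below; rewrite s0.
have [cd'|cd'] := ltP c d; last by apply: Ac; move: t0d; lra.
have [|r r0 Hr] := fr c e _ e0; first by rewrite c0.
pose h := Num.min r (d - c).
have h0 : 0 < h by rewrite lt_min r0 subr_gt0.
have hr : h <= r by rewrite ge_min lexx.
have hd : h <= d - c by rewrite ge_min lexx orbT.
have Ah : A (c + h).
  split; first by apply/andP; split; lra.
  move=> s /andP[s0 sh]; have [sc|sc] := leP s c; first by apply: Ac; rewrite s0.
  have := Hr (s - c); rewrite (addrC c) subrK => H.
  have {}H : f s <= f c + e * (s - c) by apply: H; apply/andP; split; lra.
  by apply: (le_trans H); move: Hc; lra.
have := ub_le_sup (proj2 supA) Ah; rewrite -/c; lra.
Qed.

Lemma frac_le (M g k : R) : 0 <= M -> 0 <= g -> 0 < k -> M * (g / (k * (M + 1))) <= g / k.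
Proof.
move=> M0 g0 k0; have M1 : 0 < M + 1 by exact: (ltr_wpDl M0 ltr01).
rewrite (_ : M * _ = g / k * (M / (M + 1))); last by field; rewrite !gt_eqF.
by rewrite ler_piMr ?divr_ge0 ?(ltW k0)// ler_pdivrMr// mul1r lerDl.
Qed.

End real_lemmas.

Section seminormed.
Context {R : realType} {V : lmodType R[i]}.
Variables (X : set V) (N : V -> R).

(** A seminorm instead of a norm, because the elements are functions and not
    classes of functions. *)
Record seminormed : Prop := Seminormed {
  sn_0 : X 0;
  sn_lin : forall a x y, X x -> X y -> X (a *: x + y);
  sn_ge0 : forall x, 0 <= N x;
  sn_D : forall x y, X x -> X y -> N (x + y) <= N x + N y;
  sn_Z : forall (a : R) x, X x -> N (a%:C *: x) = `|a| * N x }.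

Definition seq_complete : Prop := forall x_ : nat -> V, (forall n, X (x_ n)) ->
  (forall e, 0 < e -> exists n0, forall m n, (n0 <= m)%N -> (n0 <= n)%N ->
     N (x_ m - x_ n) <= e) ->
  exists2 x, X x & forall e, 0 < e -> exists n0, forall n, (n0 <= n)%N -> N (x_ n - x) <= e.

Hypothesis sX : seminormed.

Lemma XZ a x : X x -> X (a *: x).
Proof. by move=> Xx; rewrite -[a *: x]addr0; apply: (sn_lin sX) => //; exact: (sn_0 sX). Qed.
Lemma XD x y : X x -> X y -> X (x + y).
Proof. by move=> Xx Xy; rewrite -[x]scale1r; exact: (sn_lin sX). Qed.
Lemma XN x : X x -> X (- x).
Proof. by move=> Xx; rewrite -scaleN1r; exact: XZ. Qed.
Lemma XB x y : X x -> X y -> X (x - y).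
Proof. by move=> Xx Xy; apply: XD => //; exact: XN. Qed.
Lemma Xsum (I : Type) (r : seq I) (F : I -> V) : (forall i, X (F i)) -> X (\sum_(i <- r) F i).
Proof. by move=> XF; apply: big_ind => //; [exact: (sn_0 sX)|exact: XD]. Qed.

Lemma N0 : N 0 = 0.
Proof. by have := sn_Z sX 0 (sn_0 sX); rewrite scaler0 normr0 mul0r. Qed.
Lemma NN x : X x -> N (- x) = N x.
Proof.
move=> Xx; have := sn_Z sX (-1) Xx; rewrite normrN normr1 mul1r => <-.
by rewrite rmorphN1 scaleN1r.
Qed.
Lemma NC x y : X x -> X y -> N (x - y) = N (y - x).
Proof. by move=> Xx Xy; rewrite -NN ?opprB//; exact: XB. Qed.
Lemma Ntri y x z : X x -> X y -> X z -> N (x - z) <= N (x - y) + N (y - z).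
Proof.
move=> Xx Xy Xz; rewrite -{1}(subrK y x) -addrA; apply: (sn_D sX); exact: XB.
Qed.
Lemma NB x y : X x -> X y -> N (x - y) <= N x + N y.
Proof. by move=> Xx Xy; rewrite -(NN Xy); apply: (sn_D sX) => //; exact: XN. Qed.
Lemma Nsub x y : X x -> X y -> N x <= N y + N (x - y).
Proof. by move=> Xx Xy; rewrite -{1}(subrK y x) addrC; apply: (sn_D sX) => //; exact: XB. Qed.
Lemma Neq x y : X x -> X y -> N (x - y) = 0 -> N x = N y.
Proof.
move=> Xx Xy xy; apply/eqP; rewrite eq_le.
have := Nsub Xx Xy; have := Nsub Xy Xx; rewrite (NC Xy Xx) xy !addr0 => -> ->//.
Qed.
Lemma Nsum n (F : 'I_n -> V) : (forall i, X (F i)) ->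
  N (\sum_(i < n) F i) <= \sum_(i < n) N (F i).
Proof.
move=> XF; elim: n F XF => [|n IH] F XF; first by rewrite !big_ord0 N0.
rewrite !big_ord_recr/=.
have XS : X (\sum_(i < n) F (widen_ord (leqnSn n) i)) by apply: Xsum.
by apply: (le_trans (sn_D sX XS (XF ord_max))); apply: lerD => //; exact: IH.
Qed.

Section semigroup.
Variable S : R -> V -> V.
Hypothesis HS : C0_semigroup X N S.

Lemma SX t x : 0 <= t -> X x -> X (S t x).
Proof. exact: (semigroup_stable HS). Qed.

Lemma S_D t x y : 0 <= t -> X x -> X y -> N (S t (x + y) - (S t x + S t y)) = 0.
Proof. by move=> t0 Xx Xy; have := semigroup_linear HS 1 t0 Xx Xy; rewrite !scale1r. Qed.

Lemma S_B t x y : 0 <= t -> X x -> X y -> N (S t (x - y) - (S t x - S t y)) = 0.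
Proof.
move=> t0 Xx Xy; have := semigroup_linear HS (-1) t0 Xy Xx.
by rewrite !scaleN1r !(addrC (- y)) !(addrC (- S t y)).
Qed.

Lemma S_0 t : 0 <= t -> N (S t 0) = 0.
Proof.
move=> t0; have := S_B t0 (sn_0 sX) (sn_0 sX); rewrite !subrr subr0//.
Qed.

Lemma S_Z t a x : 0 <= t -> X x -> N (S t (a *: x) - a *: S t x) = 0.
Proof.
move=> t0 Xx; have X0 := sn_0 sX; have := semigroup_linear HS a t0 Xx X0; rewrite addr0 => H.
have XS0 := SX t0 X0; have XSx := SX t0 Xx; have XSa := SX t0 (XZ a Xx).
apply/eqP; rewrite eq_le (sn_ge0 sX) andbT -(addr0 0) -{1}H -(S_0 t0).
rewrite (_ : _ - _ = (S t (a *: x) - (a *: S t x + S t 0)) + S t 0).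
  by apply: (sn_D sX) => //; apply: XB => //; apply: XD => //; exact: XZ.
by rewrite opprD addrA subrK.
Qed.

Lemma N_SB t x y : 0 <= t -> X x -> X y -> N (S t x - S t y) = N (S t (x - y)).
Proof.
move=> t0 Xx Xy; apply/esym/Neq; last exact: S_B.
- by apply: SX => //; exact: XB.
- by apply: XB; exact: SX.
Qed.

Lemma N_SZ t (a : R) x : 0 <= t -> X x -> N (S t (a%:C *: x)) = `|a| * N (S t x).
Proof.
move=> t0 Xx; have XSx : X (S t x) by exact: SX.
rewrite -(sn_Z sX a XSx); apply: (Neq _ _ (S_Z a%:C t0 Xx)).
- by apply: SX => //; exact: XZ.
- exact: XZ.
Qed.

Lemma S_sum t n (F : 'I_n -> V) : 0 <= t -> (forall i, X (F i)) ->
  N (S t (\sum_(i < n) F i) - \sum_(i < n) S t (F i)) = 0.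
Proof.
move=> t0; elim: n F => [|n IH] F XF; first by rewrite !big_ord0 subr0 S_0.
rewrite !big_ord_recr/=; set a := \sum_(i < n) F _; set b := \sum_(i < n) S t _.
have Xa : X a by exact: Xsum.
have Xb : X b by apply: Xsum => i; exact: SX.
have XF' : X (F ord_max) by [].
have XS' : X (S t (F ord_max)) by exact: SX.
have XSa : X (S t a) by exact: SX.
apply/eqP; rewrite eq_le (sn_ge0 sX) andbT.
apply: le_trans (@Ntri (S t a + S t (F ord_max)) _ _ _ _ _) _; do ?[exact: XD|by apply: SX => //; exact: XD].
by rewrite S_D// add0r opprD addrACA subrr addr0 IH.
Qed.

Lemma S_cont0 x e : X x -> 0 < e ->
  exists2 r, 0 < r & forall h, 0 <= h <= r -> N (S h x - x) <= e.
Proof.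
move=> Xx e0; have /at_right_le/(_ e e0)[r r0 Hr] := semigroup_cvg0 HS Xx.
exists r => // h /andP[h0 hr]; move: h0; rewrite le_eqVlt => /orP[/eqP<-|h0].
  by rewrite (semigroup_0 HS)// ltW.
by apply: le_trans (ler_norm _) _; apply: Hr; rewrite h0.
Qed.

Definition valid t M := 0 <= M /\ forall x, X x -> N (S t x) <= M * N x.
(** The operator norm; being an infimum it is attained as a bound, and anything
    smaller fails at some vector. *)
Definition opn t := inf [set M | valid t M].

Lemma opn_valid t : 0 <= t -> valid t (opn t).
Proof.
move=> t0; have [M HM] := semigroup_bounded HS t0.
have neV : [set M | valid t M] !=set0.
  exists `|M|; split => // x Xx; apply: (le_trans (HM x Xx)).
  by rewrite ler_wpM2r ?ler_norm//; exact: (sn_ge0 sX).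
split; first by apply: lb_le_inf => // y [].
move=> x Xx; have [Nx|Nx] := eqVneq (N x) 0.
  by have := HM x Xx; rewrite Nx !mulr0.
have Np : 0 < N x by rewrite lt_neqAle eq_sym Nx (sn_ge0 sX).
rewrite -ler_pdivrMr//; apply: lb_le_inf => // y [_ /(_ x Xx)].
by rewrite ler_pdivrMr.
Qed.

Lemma opn_attain t m : 0 <= t -> 0 <= m < opn t -> exists2 x, X x & m * N x < N (S t x).
Proof.
move=> t0 /andP[m0 mt]; apply: contrapT => H; move: mt; rewrite ltNge => /negP; apply.
apply: ge_inf; first by exists 0 => y [].
split => // x Xx; rewrite leNgt; apply/negP => h; apply: H; by exists x.
Qed.

(** The uniform boundedness principle by a gliding hump, without Baire's
    theorem.  If the norms are unbounded near 0, choose times [h_n] at most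
    [1 / (n + 1)] with norms above [4 ^ n], and vectors of norm [3 ^- n] nearly
    attaining them.  Adding or subtracting the next vector, one of the two
    choices keeps the image at [h_n] large; the later steps are too small to
    undo this.  The images of the limit at the times [h_n] are then unbounded,
    against strong continuity at 0. *)
Lemma local_bound : seq_complete -> exists d M : R, [/\ 0 < d, 0 <= M &
  forall h x, 0 <= h <= d -> X x -> N (S h x) <= M * N x].
Proof.
move=> cX; apply: contrapT => nH.
have H n : exists h, [/\ 0 <= h, h <= n.+1%:R^-1 & 4 ^+ n < opn h].
  apply: contrapT => H; apply: nH; exists n.+1%:R^-1, (4 ^+ n); split.
  - by rewrite invr_gt0.
  - exact: exprn_ge0.
  move=> h x /andP[h0 hn] Xx; have [_ /(_ x Xx)] := opn_valid h0.
  move=> /le_trans; apply; apply: ler_wpM2r; first exact: (sn_ge0 sX).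
  by rewrite leNgt; apply/negP => ?; apply: H; exists h.
have [h_ Hh] := choice H.
have h0 n : 0 <= h_ n by have [] := Hh n.
have op0 n : 0 < opn (h_ n).
  by have [_ _] := Hh n; apply: le_lt_trans; exact: exprn_ge0.
have H2 n : exists y, [/\ X y, N y = 3 ^- n &
    3 / 4 * opn (h_ n) * 3 ^- n <= N (S (h_ n) y)].
  have [|x Xx Hx] := @opn_attain (h_ n) (3 / 4 * opn (h_ n)) (h0 n).
    by have := op0 n; set a := opn _ => a0; apply/andP; split; lra.
  have Nx : N x != 0.
    apply/eqP => Nx; have [_ /(_ x Xx)] := opn_valid (h0 n).
    by move: Hx; rewrite Nx !mulr0 => /lt_le_trans /[apply]; rewrite ltxx.
  have Np : 0 < N x by rewrite lt_neqAle eq_sym Nx (sn_ge0 sX).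
  have p0 : 0 < 3 ^- n :> R by rewrite invr_gt0 exprn_gt0.
  exists ((3 ^- n / N x)%:C *: x); split; first exact: XZ.
    by rewrite (sn_Z sX)// ger0_norm ?divfK// divr_ge0// ltW.
  rewrite N_SZ// ger0_norm; last by rewrite divr_ge0// ltW.
  rewrite -(ler_pM2r Np) (_ : 3 ^- n / N x * N (S (h_ n) x) * N x = 3 ^- n * N (S (h_ n) x)).
    by rewrite mulrAC mulrC ler_pM2l// ltW.
  by field; rewrite Nx expf_neq0.
have [y_ Hy] := choice H2.
have Xy n : X (y_ n) by have [] := Hy n.
pose fix x_ n := if n is m.+1 then
  (if N (S (h_ m) (y_ m)) <= N (S (h_ m) (x_ m + y_ m)) then x_ m + y_ m else x_ m - y_ m)
  else 0.
have Xx n : X (x_ n).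
  elim: n => [|n IH]/=; first exact: (sn_0 sX).
  by case: ifP => _; [exact: XD|exact: XB].
have x_step n : N (x_ n.+1 - x_ n) = 3 ^- n.
  have [_ <- _] := Hy n; rewrite /=; case: ifP => _; rewrite addrAC subrr add0r//.
  by rewrite NN.
have x_big n : N (S (h_ n) (y_ n)) <= N (S (h_ n) (x_ n.+1)).
  rewrite /=; case: ifPn => //; rewrite -ltNge => Hlt.
  set a := x_ n; set b := y_ n.
  have Xa : X a by exact: Xx.
  have Xb : X b by exact: Xy.
  have Xab : X (a + b) by exact: XD. have XaB : X (a - b) by exact: XB.
  have Eab : (a + b) - (a - b) = (2 : R)%:C *: b.
    by rewrite opprB addrC addrA subrK -mulr2n -scaler_nat rmorph_nat.
  have E : N (S (h_ n) (a + b) - S (h_ n) (a - b)) = 2 * N (S (h_ n) b).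
    by rewrite N_SB// Eab N_SZ// ger0_norm.
  have := @NB (S (h_ n) (a + b)) (S (h_ n) (a - b)); rewrite E.
  move=> /(_ (SX (h0 n) Xab) (SX (h0 n) XaB)).
  by move: Hlt; rewrite -/a -/b; lra.
have x_tail m n : (n <= m)%N -> N (x_ m - x_ n) <= 3 / 2 * (3 ^- n - 3 ^- m).
  elim: m => [|m IH]; first by rewrite leqn0 => /eqP->; rewrite !subrr N0 mulr0.
  rewrite leq_eqVlt => /orP[/eqP->|]; first by rewrite !subrr N0 mulr0.
  rewrite ltnS => /IH Hm; apply: le_trans (Ntri (y := x_ m) _ _ _) _ => //.
  rewrite x_step exprS invfM; lra.
have x_tail' m n : (n <= m)%N -> N (x_ m - x_ n) <= 3 / 2 * 3 ^- n.
  move=> /x_tail h; apply: (le_trans h).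
  have : 0 < 3 ^- m :> R by rewrite invr_gt0 exprn_gt0.
  lra.
have geo n : n.+1%:R <= 3 ^+ n :> R.
  elim: n => [|n IH]; first by rewrite expr0.
  by rewrite exprS -natr1; move: IH; have : 0 <= n%:R :> R by []; rewrite -!natr1; lra.
have geo' (e : R) : 0 < e -> exists n, 3 ^- n <= e.
  move=> e0; exists (Num.truncn e^-1); rewrite -[e in leRHS]invrK.
  rewrite lef_pV2 ?posrE ?exprn_gt0 ?invr_gt0//.
  apply: (le_trans _ (geo _)); apply/ltW/truncnS_gt.
have [|x Xxx Hx] := cX x_ Xx.
  move=> e e0; have [n Hn] := geo' (e / 3) (divr_gt0 e0 (ltr0n R 3)).
  exists n => m k nm nk; apply: le_trans (Ntri (y := x_ n) _ _ _) _ => //.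
  rewrite (NC (Xx n))//; have := x_tail' _ _ nm; have := x_tail' _ _ nk; lra.
have Hlim n : N (x_ n.+1 - x) <= 2^-1 * 3 ^- n.
  apply/ler_addgt0Pr => e e0; have [n0 Hn0] := Hx e e0.
  pose m := maxn n0 n.+1.
  apply: le_trans (Ntri (y := x_ m) _ _ _) _ => //; apply: lerD; last first.
    by apply: Hn0; rewrite leq_maxl.
  rewrite NC//; have := x_tail' m n.+1 (leq_maxr _ _); rewrite exprS invfM; lra.
(* 3/4 from the hump and 1/2 lost in the tail leave 1/4. *)
have low n : 4^-1 * (4 / 3) ^+ n <= N (S (h_ n) x).
  have [_ _ yn] := Hy n; have [_ _ on] := Hh n.
  have [_ /(_ (x_ n.+1 - x) (XB (Xx n.+1) Xxx)) h1] := opn_valid (h0 n).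
  have h2 := x_big n.
  have h3 := Nsub (SX (h0 n) (Xx n.+1)) (SX (h0 n) Xxx).
  rewrite N_SB// in h3.
  have h4 : opn (h_ n) * N (x_ n.+1 - x) <= opn (h_ n) * (2^-1 * 3 ^- n).
    by rewrite ler_wpM2l//; exact: ltW.
  have h5 : 4 ^+ n * 3 ^- n <= opn (h_ n) * 3 ^- n.
    by rewrite ler_wpM2r ?invr_ge0 ?exprn_ge0// ltW.
  rewrite expr_div_n; set a := N (S (h_ n) x) in h3 *; lra.
have [r r0 Hr] := S_cont0 Xxx ltr01.
have bern n : 1 + n%:R / 3 <= (4 / 3) ^+ n :> R.
  elim: n => [|n IH]; first by rewrite expr0 mul0r addr0.
  rewrite exprS -natr1.
  have : 4 / 3 * (1 + n%:R / 3) <= 4 / 3 * (4 / 3) ^+ n :> R by rewrite ler_wpM2l//; lra.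
  by have : 0 <= n%:R :> R by []; lra.
pose n := (Num.truncn r^-1 + Num.truncn (12 * (N x + 2)))%N.
have hn : h_ n <= r.
  have [_ hn _] := Hh n; apply: (le_trans hn); rewrite -[r in leRHS]invrK.
  rewrite lef_pV2 ?posrE ?invr_gt0//; apply: (le_trans (ltW (truncnS_gt _))).
  by rewrite ler_nat ltnS leq_addr.
have := low n; have := Hr (h_ n); rewrite h0 hn => /(_ isT) h1.
have := Nsub (SX (h0 n) Xxx) Xxx.
have : 12 * (N x + 2) < n.+1%:R.
  apply: lt_le_trans (truncnS_gt _) _; by rewrite ler_nat ltnS leq_addl.
have := bern n; rewrite -[n.+1%:R]natr1; lra.
Qed.

Section locally_bounded.
Variables (d M : R).
Hypotheses (d0 : 0 < d) (M0 : 0 <= M)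
  (bS : forall h x, 0 <= h <= d -> X x -> N (S h x) <= M * N x).

Lemma orbit_cont s t x : 0 <= s -> s <= t <= d -> X x ->
  N (S t x - S s x) <= M * N (S (t - s) x - x).
Proof.
move=> s0 /andP[st td] Xx; have ts0 : 0 <= t - s by lra.
have Xts : X (S (t - s) x) by exact: SX.
have t0 : 0 <= t by lra.
apply: le_trans (Ntri (y := S s (S (t - s) x)) _ _ _) _; do ?exact: SX.
have := semigroup_D HS s0 ts0 Xx; rewrite (_ : s + (t - s) = t); last by ring.
move=> ->.
rewrite add0r N_SB//; apply: bS; last exact: XB.
by rewrite s0/=; lra.
Qed.

Lemma avg_le n (F : nat -> V) b e : (forall i, X (F i)) -> X b ->
  (forall i, (i < n.+1)%N -> N (F i - b) <= e) ->
  N ((n.+1%:R^-1 : R)%:C *: (\sum_(i < n.+1) F i) - b) <= e.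
Proof.
move=> XF Xb H.
have -> : (n.+1%:R^-1 : R)%:C *: (\sum_(i < n.+1) F i) - b =
    (n.+1%:R^-1 : R)%:C *: (\sum_(i < n.+1) (F i - b)).
  rewrite sumrB scalerBr; congr (_ - _).
  rewrite sumr_const card_ord -[b *+ _]scaler_nat scalerA -(rmorph_nat (real_complex R)) -rmorphM.
  by rewrite mulVf ?pnatr_eq0// rmorph1 scale1r.
have XFb i : X (F i - b) by exact: XB.
rewrite (sn_Z sX) ?ger0_norm ?invr_ge0//; last exact: Xsum.
rewrite mulrC ler_pdivrMr ?ltr0n//; apply: le_trans (Nsum _) _ => //.
apply: le_trans (ler_sum _ (fun (i : 'I_n.+1) _ => H i (ltn_ord i))) _.
by rewrite sumr_const card_ord mulr_natr.
Qed.

Lemma sum_mul (F : nat -> V) m q :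
  \sum_(i < m * q) F i = \sum_(j < m) \sum_(i < q) F (j * q + i)%N.
Proof.
elim: m => [|m IH]; first by rewrite mul0n !big_ord0.
rewrite big_ord_recr/= -IH -!(big_mkord xpredT) mulSn addnC.
rewrite (@big_cat_nat _ _ _ (m * q)%N) ?leq_addr//=; congr (_ + _).
rewrite -{1}(add0n (m * q)%N) big_addn addKn big_mkord; apply: eq_bigr => i _.
by rewrite addnC.
Qed.

Lemma sum_shift (F : nat -> V) m k :
  \sum_(j < m) (F (j + k)%N - F j) = \sum_(i < k) (F (m + i)%N - F i).
Proof.
rewrite !sumrB; apply/eqP; rewrite subr_eq addrAC eq_sym subr_eq; apply/eqP.
have E : \sum_(i < m) F i + \sum_(i < k) F (m + i)%N = \sum_(i < m + k) F i.
  by rewrite big_split_ord.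
have E' : \sum_(i < k) F i + \sum_(i < m) F (k + i)%N = \sum_(i < k + m) F i.
  by rewrite big_split_ord.
under [in RHS]eq_bigr do rewrite addnC.
by rewrite addrC E addrC E' addnC.
Qed.

(** The mean of the orbit of [x] over a short interval [[0, T0]] is close to
    [x] and lies in the domain, with image [(S T0 x - x) / T0].  The mean is
    taken as the limit of averages over uniform meshes, which is a Cauchy
    sequence because any two meshes have a common refinement. *)
Lemma generator_dense x e : seq_complete -> X x -> 0 < e ->
  exists y z, [/\ X y, X z, N (y - x) <= e &
    N ((h^-1)%:C *: (S h y - y) - z) @[h --> 0^'+] --> (0 : R)].
Proof.
move=> cX Xx e0; have [r0 r00 Hr0] := S_cont0 Xx e0.
pose T0 := Num.min r0 (d / 2).
have T00 : 0 < T0 by rewrite lt_min r00 divr_gt0.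
have T0r : T0 <= r0 by rewrite ge_min lexx.
have T0d : T0 <= d / 2 by rewrite ge_min lexx orbT.
clearbody T0.
pose F m j := S (j%:R * (T0 / m.+1%:R)) x.
have st0 m : 0 < T0 / m.+1%:R by rewrite divr_gt0.
have tm0 m j : 0 <= j%:R * (T0 / m.+1%:R) by rewrite mulr_ge0// ltW.
have XF m j : X (F m j) by apply: SX.
have tmT m j : (j <= m.+1)%N -> j%:R * (T0 / m.+1%:R) <= T0.
  by move=> jm; rewrite mulrCA ger_pMr// ler_pdivrMr// mul1r ler_nat.
pose y m := (m.+1%:R^-1 : R)%:C *: (\sum_(j < m.+1) F m j).
have Xy m : X (y m) by apply: XZ; exact: Xsum.
have osc s r c : 0 <= s -> 0 <= r -> s + r <= d ->
    N (S r x - x) <= c -> N (S (s + r) x - S s x) <= M * c.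
  move=> s0' r0' srd h; apply: le_trans (orbit_cont s0' _ Xx) _.
    by rewrite lerDl r0'.
  by rewrite (_ : s + r - s = r) ?ler_wpM2l//; ring.
have refine m q eta c : 0 < eta -> (forall r, 0 <= r <= eta -> N (S r x - x) <= c) ->
    T0 / m.+1%:R <= eta -> N (y (m.+1 * q.+1).-1 - y m) <= M * c.
  move=> eta0 Hc Hm; set p := (m.+1 * q.+1).-1.
  have pE : p.+1 = (m.+1 * q.+1)%N by rewrite prednK.
  have -> : y p = (m.+1%:R^-1 : R)%:C *: \sum_(j < m.+1) ((q.+1%:R^-1 : R)%:C *: \sum_(i < q.+1) F p (j * q.+1 + i)%N).
    rewrite /y; have -> : \sum_(j < p.+1) F p j = \sum_(j < m.+1 * q.+1) F p j by rewrite pE.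
    rewrite sum_mul -scaler_sumr scalerA; congr (_ *: _).
    by rewrite -rmorphM pE natrM invfM.
  rewrite /y -scalerBr -sumrB.
  have := @avg_le m (fun j => (q.+1%:R^-1 : R)%:C *: (\sum_(i < q.+1) F p (j * q.+1 + i)%N) - F m j) 0 (M * c).
  rewrite subr0; apply.
  - by move=> i; apply: XB => //; apply: XZ; exact: Xsum.
  - exact: (sn_0 sX).
  move=> j jm; rewrite subr0; apply: (@avg_le q (fun i => F p (j * q.+1 + i)%N)) => //.
  move=> i iq; rewrite /F.
  have -> : (j * q.+1 + i)%:R * (T0 / p.+1%:R) = j%:R * (T0 / m.+1%:R) + i%:R * (T0 / p.+1%:R).
    rewrite natrD mulrDl; congr (_ + _); rewrite pE !natrM; field.
    by rewrite !nat1r ?pnatr_eq0.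
  have ip : i%:R * (T0 / p.+1%:R) <= T0 / m.+1%:R.
    rewrite pE natrM invfM [T0 * _]mulrA mulrCA ger_pMr//.
    by rewrite ler_pdivrMr// mul1r ler_nat ltnW.
  apply: osc => //.
    have tm1 := tmT m 1%N isT; rewrite mul1r in tm1.
    apply: le_trans (lerD (tmT m j (ltnW jm)) (le_trans ip tm1)) _; lra.
  by apply: Hc; rewrite tm0/= (le_trans ip).
have modulus c : 0 < c -> exists2 eta, 0 < eta & forall r, 0 <= r <= eta -> N (S r x - x) <= c.
  by move=> c0; exact: S_cont0.
have fine_mesh eta : 0 < eta -> exists n0, forall m, (n0 <= m)%N -> T0 / m.+1%:R <= eta.
  move=> eta0; exists (Num.truncn (T0 / eta)) => m nm.
  rewrite ler_pdivrMr// mulrC -ler_pdivrMr//; apply: (le_trans (ltW (truncnS_gt _))).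
  by rewrite ler_nat ltnS.
have M1 : 0 < M + 1 by exact: (ltr_wpDl M0 ltr01).
have [|yl Xyl Hyl] := cX y Xy.
  move=> c c0; have c1 : 0 < c / (2 * (M + 1)) by rewrite divr_gt0// mulr_gt0.
  have [eta eta0 Heta] := modulus _ c1; have [n0 Hn0] := fine_mesh _ eta0.
  exists n0 => m n nm nn.
  have h1 := @refine m n _ _ eta0 Heta (Hn0 m nm).
  have h2 := @refine n m _ _ eta0 Heta (Hn0 n nn).
  rewrite mulnC in h2; set p := (m.+1 * n.+1).-1 in h1 h2.
  apply: le_trans (Ntri (y := y p) _ _ _) _ => //; rewrite (NC (Xy m))//.
  have : M * (c / (2 * (M + 1))) <= c / 2.
    by apply: frac_le => //; exact: ltW.
  by lra.
have XST : X (S T0 x) by apply: SX => //; exact: ltW.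
pose w := S T0 x - x.
have Xw : X w by exact: XB.
exists yl, ((T0^-1)%:C *: w); split => //; first exact: XZ.
  apply/ler_addgt0Pr => c c0; have [n Hn] := Hyl c c0.
  apply: le_trans (Ntri (y := y n) _ _ _) _ => //; rewrite addrC; apply: lerD; last first.
    by rewrite NC//; exact: Hn.
  apply: (@avg_le n (F n)) => // i im; apply: Hr0; rewrite tm0/=.
  by apply: le_trans T0r; apply: tmT; exact: ltnW.
apply/at_right_le => c c0.
pose c1 := c * T0 / (2 * (M + 1)).
have c10 : 0 < c1 by rewrite divr_gt0// ?mulr_gt0.
have [eta eta0 Heta] := modulus _ c10.
exists (Num.min eta (d / 2)); first by rewrite lt_min eta0 divr_gt0.
move=> h /andP[h0]; rewrite le_min => /andP[heta hd].
have h0' : 0 <= h by exact: ltW.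
have XSh : X (S h yl) by exact: SX.
have key : N ((S h yl - yl) - (h / T0)%:C *: w) <= h / T0 * (2 * M * c1).
  apply/ler_addgt0Pr => g g0.
  have [n1 Hn1] : exists n1, forall m, (n1 <= m)%N -> N (y m - yl) <= g / (4 * (M + 1)).
    by apply: Hyl; rewrite divr_gt0// mulr_gt0.
  have [ez ez0 Hez] : exists2 r, 0 < r & forall h, 0 <= h <= r -> N (S h yl - yl) <= g / (4 * (M + 1)).
    by apply: S_cont0 => //; rewrite divr_gt0// mulr_gt0.
  have [n2 Hn2] := fine_mesh _ ez0.
  have [n3 Hn3] : exists n3, forall m, (n3 <= m)%N -> N w / m.+1%:R <= g / 4.
    exists (Num.truncn (N w / (g / 4))) => m nm.
    rewrite ler_pdivrMr// mulrC -ler_pdivrMr; last by rewrite divr_gt0.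
    by apply: (le_trans (ltW (truncnS_gt _))); rewrite ler_nat ltnS.
  pose m := (n1 + n2 + n3)%N.
  have {}Hn1 := Hn1 m (leq_trans (leq_addr _ _) (leq_addr _ _)).
  have {}Hn2 := Hn2 m (leq_trans (leq_addl _ _) (leq_addr _ _)).
  have {}Hn3 := Hn3 m (leq_addl _ _).
  pose s := T0 / m.+1%:R.
  have s0 : 0 < s by exact: st0.
  pose k := Num.truncn (h / s).
  have hs0 : 0 <= h / s by rewrite divr_ge0// ltW.
  have /andP[ks hk] := truncn_itv hs0; rewrite -/k in ks hk.
  have {}ks : k%:R * s <= h by rewrite -ler_pdivlMr.
  have {}hk : h < k.+1%:R * s by rewrite -ltr_pdivrMr.
  have ks0 : 0 <= k%:R * s by rewrite mulr_ge0// ltW.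
  have sE : s = T0 / m.+1%:R by [].
  have mE : m.+1%:R * s = T0 by rewrite /s mulrC divfK.
  have XSk : X (S (k%:R * s) (y m)) by exact: SX.
  have XSk' : X (S (k%:R * s) yl) by exact: SX.
  have F0 : N (F m 0%N - x) = 0 by rewrite /F mul0r (semigroup_0 HS).
  pose Y := (m.+1%:R^-1 : R)%:C *: (\sum_(j < m.+1) F m (j + k)%N).
  have XY : X Y by apply: XZ; exact: Xsum.
  have e1 : N (S (k%:R * s) (y m) - Y) = 0.
    apply/eqP; rewrite eq_le (sn_ge0 sX) andbT.
    have XSS : X (S (k%:R * s) (\sum_(j < m.+1) F m j)) by apply: SX => //; exact: Xsum.
    have XZ1 := XZ ((m.+1%:R^-1 : R)%:C) XSS.
    apply: le_trans (Ntri XSk XZ1 XY) _.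
    rewrite S_Z ?add0r//; last exact: Xsum.
    rewrite /Y -scalerBr (sn_Z sX); last by apply: XB => //; exact: Xsum.
    have XsS : X (\sum_(j < m.+1) S (k%:R * s) (F m j)) by apply: Xsum => j; exact: SX.
    rewrite pmulr_rle0 ?normr_gt0 ?invr_eq0 ?pnatr_eq0//.
    apply: le_trans (Ntri XSS XsS _) _; first exact: Xsum.
    rewrite S_sum// add0r -sumrB; apply: le_trans (Nsum _) _.
      by move=> i; apply: XB => //; exact: SX.
    rewrite big1// => i _; have E := semigroup_D HS ks0 (tm0 m i) Xx.
    have XSF : X (S (k%:R * s) (F m i)) by exact: SX.
    by rewrite (NC XSF (XF _ _)) /F natrD mulrDl (addrC (i%:R * _)).
  (* Shifting an average by [k] mesh steps changes only the terms near both ends,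
     whose difference is almost [k] times the increment of the orbit. *)
  have e2 : N (Y - y m - (k%:R / m.+1%:R : R)%:C *: (F m m.+1 - F m 0%N)) <= k%:R / m.+1%:R * (2 * M * c1).
    have -> : Y - y m - (k%:R / m.+1%:R : R)%:C *: (F m m.+1 - F m 0%N) =
       (m.+1%:R^-1 : R)%:C *: \sum_(i < k) ((F m (m.+1 + i)%N - F m m.+1) - (F m i - F m 0%N)).
      rewrite /Y /y -scalerBr -sumrB sum_shift.
      rewrite [k%:R / _]mulrC rmorphM/= -scalerA -scalerBr; congr (_ *: _).
      rewrite rmorph_nat scaler_nat -[k in _ *+ k]card_ord -sumr_const -sumrB.
      apply: eq_bigr => i _; rewrite !opprB addrACA [RHS]addrACA; congr (_ + _).
      exact: addrC.
    rewrite (sn_Z sX); last by apply: Xsum => i; apply: XB; exact: XB.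
    rewrite ger0_norm ?invr_ge0// mulrC mulrAC ler_pM2r ?invr_gt0//.
    apply: le_trans (Nsum _) _; first by move=> i; apply: XB; exact: XB.
    have -> : k%:R * (2 * M * c1) = \sum_(i < k) (2 * M * c1).
      by rewrite sumr_const card_ord mulr_natl.
    apply: ler_sum => i _; apply: le_trans (NB _ _) _; do ?exact: XB.
    have ih : i%:R * s <= h by apply: (le_trans _ ks); rewrite ler_wpM2r ?ler_nat 1?ltnW// ltW.
    have is0 : 0 <= i%:R * s by rewrite mulr_ge0// ltW.
    have a1 : N (F m (m.+1 + i)%N - F m m.+1) <= M * c1.
      rewrite /F natrD mulrDl -/s; apply: osc => //; first by rewrite mE ltW.
        by rewrite mE; lra.
      by apply: Heta; rewrite is0 (le_trans ih).
    have a2 : N (F m i - F m 0%N) <= M * c1.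
      rewrite /F -/s mul0r -{1}(add0r (i%:R * s)); apply: osc => //; first by rewrite add0r; lra.
      by apply: Heta; rewrite is0 (le_trans ih).
    by lra.
  have kT : k%:R / m.+1%:R <= h / T0.
    by rewrite ler_pdivlMr// mulrAC -mulrA -/s.
  have hT : h / T0 - k%:R / m.+1%:R <= m.+1%:R^-1.
    rewrite lerBlDr ler_pdivrMr// mulrDl mulrAC -mulrA -/s mulrC -/s.
    by move: hk; rewrite -natr1 mulrDl mul1r; lra.
  have e3 : N (S h yl - S (k%:R * s) (y m)) <= g / 2.
    apply: le_trans (Ntri (y := S (k%:R * s) yl) _ _ _) _ => //.
    have b1 : N (S h yl - S (k%:R * s) yl) <= M * (g / (4 * (M + 1))).
      have hdd : h <= d by lra.
      apply: le_trans (orbit_cont ks0 _ Xyl) _; first by rewrite ks.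
      apply: ler_wpM2l => //; apply: Hez; apply/andP; split; first lra.
      by apply: le_trans Hn2; move: hk; rewrite -natr1 mulrDl mul1r -/s; lra.
    have b2 : N (S (k%:R * s) yl - S (k%:R * s) (y m)) <= M * (g / (4 * (M + 1))).
      rewrite N_SB//; apply: le_trans (bS _ _) _; [by apply/andP; split; lra|exact: XB|].
      by rewrite NC// ler_wpM2l.
    have b3 : M * (g / (4 * (M + 1))) <= g / 4.
      by apply: frac_le => //; exact: ltW.
    by lra.
  have b4 : N (y m - yl) <= g / 4.
    apply: (le_trans Hn1); rewrite invfM mulrA ler_pdivrMr// ler_peMr//; last by rewrite lerDr.
    by rewrite divr_ge0// ltW.
  have Xa : X ((h / T0)%:C *: w) by exact: XZ.
  have Xk : X ((k%:R / m.+1%:R : R)%:C *: w) by exact: XZ.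
  have XFF : X (F m m.+1 - F m 0%N) by exact: XB.
  have Xk' : X ((k%:R / m.+1%:R : R)%:C *: (F m m.+1 - F m 0%N)) by exact: XZ.
  have wF : N ((F m m.+1 - F m 0%N) - w) = 0.
    have -> : F m m.+1 - F m 0%N - w = - (F m 0%N - x).
      have FE : F m m.+1 = S T0 x by rewrite /F mE.
      by rewrite FE /w [in RHS]opprB [in LHS]opprB [LHS]addrC addrA subrK.
    by rewrite NN//; exact: XB.
  have b5 : N ((k%:R / m.+1%:R : R)%:C *: (F m m.+1 - F m 0%N) - (h / T0)%:C *: w) <= g / 4.
    apply: le_trans (Ntri Xk' Xk Xa) _.
    rewrite -scalerBr (sn_Z sX); last exact: XB.
    rewrite wF mulr0 add0r -scalerBl -rmorphB (sn_Z sX)// distrC ger0_norm ?subr_ge0//.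
    by apply: le_trans Hn3; rewrite mulrC ler_wpM2l// (sn_ge0 sX).
  have e4 : N (Y - y m - (k%:R / m.+1%:R : R)%:C *: (F m m.+1 - F m 0%N)) <= h / T0 * (2 * M * c1).
    apply: (le_trans e2); apply: ler_wpM2r kT.
    by apply: mulr_ge0; [exact: mulr_ge0|exact: ltW].
  have split5 : S h yl - yl - (h / T0)%:C *: w =
    ((S h yl - S (k%:R * s) (y m)) + (S (k%:R * s) (y m) - Y)) +
    (Y - y m - (k%:R / m.+1%:R : R)%:C *: (F m m.+1 - F m 0%N)) +
    ((y m - yl) + ((k%:R / m.+1%:R : R)%:C *: (F m m.+1 - F m 0%N) - (h / T0)%:C *: w)).
    set A := _ *: (F m _ - _); set B := _ *: w.
    rewrite subrKA -[Y - y m - A]addrA subrKA [y m - yl + _]addrACA.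
    by rewrite -[- y m - A]opprD subrKA addrA.
  rewrite split5.
  apply: le_trans (sn_D sX _ _) _; [by apply: XD; [apply: XD; exact: XB|apply: XB => //; exact: XB]|by apply: XD; exact: XB|].
  have c1' := sn_D sX (XB XSh XSk) (XB XSk XY).
  have c2' := sn_D sX (XB (Xy m) Xyl) (XB Xk' Xa).
  have c3' := sn_D sX (XD (XB XSh XSk) (XB XSk XY)) (XB (XB XY (Xy m)) Xk').
  rewrite e1 addr0 in c1'; clear -c1' c2' c3' e3 e4 b4 b5; lra.
rewrite ger0_norm ?(sn_ge0 sX)//.
have -> : (h^-1)%:C *: (S h yl - yl) - (T0^-1)%:C *: w = (h^-1)%:C *: ((S h yl - yl) - (h / T0)%:C *: w).
  rewrite [RHS]scalerBr scalerA -rmorphM; congr (_ - _%:C *: _).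
  by rewrite mulrA mulVf ?mul1r// gt_eqF.
rewrite (sn_Z sX); last by apply: XB; [exact: XB|exact: XZ].
rewrite gtr0_norm ?invr_gt0// mulrC ler_pdivrMr//; apply: (le_trans key).
rewrite /c1 (_ : _ * (_ * _) = h * c * (M / (M + 1))); last by field; rewrite !gt_eqF.
rewrite [leRHS]mulrC ler_piMr ?mulr_ge0// ?(ltW c0)// ler_pdivrMr// mul1r lerDl//.
Qed.

End locally_bounded.

(** The scalars are real: a form that adds the contributions of the real and
    imaginary parts of complex states is not complex linear. *)
Record lyapunov (B : V -> V -> R) (K : R) : Prop := Lyapunov {
  ly_K : 0 <= K;
  ly_D : forall x y z, X x -> X y -> X z -> B (x + y) z = B x z + B y z;
  ly_Z : forall (a : R) x z, X x -> X z -> B (a%:C *: x) z = a * B x z;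
  ly_C : forall x y, X x -> X y -> B x y = B y x;
  ly_ge0 : forall x, X x -> 0 <= B x x;
  ly_le : forall x y, X x -> X y -> `|B x y| <= K * N x * N y }.

Section decay.
Variables (A : V -> V -> Prop) (B : V -> V -> R) (K c : R).
Hypothesis (cX : seq_complete) (lB : lyapunov B K) (c0 : 0 <= c).
Hypothesis gA : forall x y, X x -> X y ->
  (A x y <-> N ((h^-1)%:C *: (S h x - x) - y) @[h --> 0^'+] --> (0 : R)).
Hypothesis diss : forall x y, X x -> X y -> A x y -> B x y <= - c * B x x.

Let BB x y : X x -> X y -> B (x + y) (x + y) = B x x + 2 * B x y + B y y.
Proof.
move=> Xx Xy; have Xxy := XD Xx Xy.
rewrite (ly_D lB)// (ly_C lB Xx Xxy) (ly_C lB Xy Xxy) !(ly_D lB)// (ly_C lB Xy Xx); ring.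
Qed.

Let B_sub z x y : X z -> X x -> X y -> B z (x - y) = B z x - B z y.
Proof.
move=> Xz Xx Xy; have XNy := XN Xy; have E : - y = (-1)%:C *: y by rewrite rmorphN1 scaleN1r.
rewrite (ly_C lB Xz (XB Xx Xy)) (ly_D lB)// E (ly_Z lB)// mulN1r.
by rewrite (ly_C lB Xz Xx) (ly_C lB Xz Xy).
Qed.

Let B_lip x y : X x -> X y -> B x x <= B y y + K * N (x - y) * (N x + N y).
Proof.
move=> Xx Xy; have Xxy := XB Xx Xy; have := ly_K lB => K0.
have E : B x x = B y y + (2 * B (x - y) y + B (x - y) (x - y)).
  have E0 : x = (x - y) + y by rewrite subrK.
  by rewrite [in LHS]E0 BB//; ring.
have h1 := ly_le lB Xxy Xy; have h2 := ly_le lB Xxy Xx.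
have E2 : B (x - y) (x - y) = B (x - y) x - B (x - y) y.
  exact: B_sub.
rewrite E E2; have := ler_norm (B (x - y) y); have := ler_norm (B (x - y) x); lra.
Qed.

(** The semigroup commutes with its difference quotients. *)
Lemma generator_stable t x y : 0 <= t -> X x -> X y -> A x y -> A (S t x) (S t y).
Proof.
move=> t0 Xx Xy /(gA Xx Xy)/at_right_le H.
apply/(gA (SX t0 Xx) (SX t0 Xy))/at_right_le => e e0.
have [Mt0 HM] := opn_valid t0; set Mt := opn t in Mt0 HM.
have [r r0 Hr] := H (e / (Mt + 1)) (divr_gt0 e0 (ltr_wpDl Mt0 ltr01)).
exists r => // h hr; have {}Hr := Hr h hr; have /andP[h0 _] := hr.
have h0' := ltW h0.
have XSt := SX t0 Xx; have XSh := SX h0' Xx.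
have XhSt := SX h0' XSt; have XtSh := SX t0 XSh.
have Xd := XB XSh Xx; have Xq := XZ ((h^-1)%:C) Xd.
rewrite ger0_norm ?(sn_ge0 sX)// in Hr; rewrite ger0_norm ?(sn_ge0 sX)//.
have e1 : N (S h (S t x) - S t (S h x)) = 0.
  apply/eqP; rewrite eq_le (sn_ge0 sX) andbT.
  have Xth : X (S (t + h) x) by apply: SX => //; exact: addr_ge0.
  apply: le_trans (Ntri XhSt Xth XtSh) _.
  have D1 := semigroup_D HS t0 h0' Xx; have D2 := semigroup_D HS h0' t0 Xx.
  by rewrite (addrC h) in D2; rewrite (NC XhSt Xth) D2 D1 addr0.
have e2 : N ((h^-1)%:C *: (S h (S t x) - S t x) - S t ((h^-1)%:C *: (S h x - x))) = 0.
  apply/eqP; rewrite eq_le (sn_ge0 sX) andbT.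
  have X1 := XZ ((h^-1)%:C) (SX t0 Xd).
  have X2 := XZ ((h^-1)%:C) (XB XhSt XSt).
  apply: le_trans (Ntri X2 X1 (SX t0 Xq)) _.
  rewrite (NC X1 (SX t0 Xq)) S_Z// addr0 -scalerBr (sn_Z sX); last first.
    by apply: XB; [exact: XB|exact: SX].
  rewrite mulr_ge0_le0// (le_trans (Ntri (XB XhSt XSt) (XB XtSh XSt) (SX t0 Xd)))//.
  rewrite (NC (XB XtSh XSt) (SX t0 Xd)) S_B// addr0.
  by rewrite opprB addrA subrK e1.
apply: le_trans (Ntri (XZ _ (XB XhSt XSt)) (SX t0 Xq) (SX t0 Xy)) _.
rewrite e2 add0r N_SB//; apply: (le_trans (HM _ (XB Xq Xy))).
apply: (le_trans (ler_wpM2l Mt0 Hr)); rewrite mulrA ler_pdivrMr ?(ltr_wpDl Mt0 ltr01)//.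
by rewrite mulrDr mulr1 mulrC lerDl ltW.
Qed.

(** Expanding [B] at [z + h (y + q)], where [q] is the error of the difference
    quotient: the first order term is [2 h B z y], up to [o(h)]. *)
Let right_decay z y e : X z -> X y -> A z y -> 0 < e -> exists2 r, 0 < r &
  forall h, 0 < h <= r -> B (S h z) (S h z) <= (1 - 2 * c * h) * B z z + e * h.
Proof.
move=> Xz Xy Azy e0; have K0 := ly_K lB.
have := Azy => /(gA Xz Xy)/at_right_le H.
have Nz0 := sn_ge0 sX z; have Ny0 := sn_ge0 sX y.
pose D := 4 * (K + 1) * (N z + 1).
have D0 : 0 < D by rewrite !mulr_gt0//; lra.
have [r r0 Hr] := H (Num.min (e / D) 1) ltac:(by rewrite lt_min ltr01 divr_gt0).
pose D2 := 2 * (K + 1) * (N y + 1) ^+ 2.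
have D20 : 0 < D2 by rewrite !mulr_gt0 ?exprn_gt0//; lra.
exists (Num.min r (e / D2)); first by rewrite lt_min r0 divr_gt0.
move=> h /andP[h0]; rewrite le_min => /andP[hr he].
have h0' := ltW h0.
have := Hr h; rewrite h0 hr ger0_norm ?(sn_ge0 sX)// => /(_ isT).
set q := _ - y; rewrite le_min => /andP[q1 q2].
have XSh := SX h0' Xz.
have Xq : X q by apply: XB => //; apply: XZ; exact: XB.
have Xyq := XD Xy Xq; have Xhy := XZ h%:C Xyq.
have -> : S h z = z + h%:C *: (y + q).
  rewrite /q [y + _]addrC subrK scalerA -rmorphM mulfV ?gt_eqF// rmorph1 scale1r.
  by rewrite addrC subrK.
rewrite BB// (ly_C lB Xz Xhy) !(ly_Z lB)// (ly_C lB Xyq Xhy) (ly_Z lB)//.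
rewrite (ly_C lB Xyq Xz) (ly_C lB Xz Xyq) (ly_D lB)// (ly_C lB Xy Xz).
have b1 := diss Xz Xy Azy.
have b2 : B q z <= K * (e / D) * N z.
  apply: (le_trans (ler_norm _)); apply: (le_trans (ly_le lB Xq Xz)).
  by rewrite ler_wpM2r// ler_wpM2l.
have b2' : K * (e / D) * N z <= e / 4.
  rewrite /D (_ : K * _ * _ = e / 4 * ((K * N z) / ((K + 1) * (N z + 1)))); last first.
    by field; apply/andP; split; apply/lt0r_neq0; lra.
  rewrite ler_piMr//; first by lra.
  rewrite ler_pdivrMr ?mul1r ?mulr_gt0//; [|lra|lra].
  by have := mulr_ge0 K0 Nz0; nra.
have b3 : B (y + q) (y + q) <= K * (N y + 1) ^+ 2.
  apply: (le_trans (ler_norm _)); apply: (le_trans (ly_le lB Xyq Xyq)).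
  rewrite -mulrA ler_wpM2l// expr2; have := sn_D sX Xy Xq => h1.
  have h2 : N (y + q) <= N y + 1 by lra.
  by apply: ler_pM => //; exact: (sn_ge0 sX).
have b4 : h * (K * (N y + 1) ^+ 2) <= e / 2.
  apply: (@le_trans _ _ (e / D2 * (K * (N y + 1) ^+ 2))).
    by rewrite ler_wpM2r// mulr_ge0// exprn_ge0//; lra.
  rewrite /D2 (_ : _ * _ = e / 2 * (K / (K + 1))); last first.
    by field; apply/andP; split; apply/lt0r_neq0; lra.
  rewrite ler_piMr//; first by lra.
  by rewrite ler_pdivrMr; lra.
have b5 : h * B (y + q) (y + q) <= e / 2.
  by apply: le_trans b4; rewrite ler_wpM2l.
have b6 : h * (2 * (B z y + B q z) + h * B (y + q) (y + q)) <= h * (- 2 * c * B z z + e).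
  by rewrite ler_wpM2l//; lra.
lra.
Qed.

(** On the interval where the semigroup is uniformly bounded, orbits are
    continuous on both sides, as required to integrate the differential
    inequality satisfied by [exp (2 c t) B (S t z) (S t z)]. *)
Let decay_small d M z y : 0 < d -> 0 <= M ->
  (forall h x, 0 <= h <= d -> X x -> N (S h x) <= M * N x) ->
  X z -> X y -> A z y -> forall t, 0 <= t <= d ->
  B (S t z) (S t z) <= expR (- (2 * c * t)) * B z z.
Proof.
move=> d0 M0 bS Xz Xy Azy.
have K0 := ly_K lB; have Nz0 := sn_ge0 sX z.
pose f t := expR (2 * c * t) * B (S t z) (S t z).
have Bt_le t : 0 <= t <= d -> B (S t z) (S t z) <= K * (M * N z) * (M * N z).
  move=> td; have /andP[t0 _] := td; have Xt := SX t0 Xz.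
  apply: (le_trans (ler_norm _)); apply: (le_trans (ly_le lB Xt Xt)).
  have h := bS t z td Xz; rewrite -mulrA -[leRHS]mulrA; apply: ler_wpM2l => //.
  by apply: ler_pM => //; exact: (sn_ge0 sX).
have Bt_ge t : 0 <= t -> 0 <= B (S t z) (S t z) by move=> t0; exact: (ly_ge0 lB (SX t0 Xz)).
suff H t : 0 <= t <= d -> f t <= f 0.
  move=> t td; have := H t td; rewrite /f mulr0 expR0 mul1r => h.
  rewrite expRN ler_pdivlMl ?expR_gt0//; apply: (le_trans h).
  have X0 := SX (lexx 0) Xz.
  have := B_lip X0 Xz; rewrite (semigroup_0 HS)// mulr0 mul0r addr0//.
apply: dini_nonincreasing => [|{}t e /andP[t0 td] e0|{}t e /andP[t0 td] e0]; first exact: ltW.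
- have Xt := SX t0 Xz; have Xty := SX t0 Xy.
  have E0 : 0 < expR (2 * c * d) by exact: expR_gt0.
  have [r r0 Hr] := right_decay Xt Xty (generator_stable t0 Xz Xy Azy) (divr_gt0 e0 E0).
  exists (Num.min r (d - t)); first by rewrite lt_min r0 subr_gt0.
  move=> h /andP[h0]; rewrite le_min => /andP[hr hd].
  have h0' := ltW h0.
  have {}Hr : B (S h (S t z)) (S h (S t z)) <= (1 - 2 * c * h) * B (S t z) (S t z) + e / expR (2 * c * d) * h.
    by apply: Hr; rewrite h0.
  have E : B (S (t + h) z) (S (t + h) z) <= B (S h (S t z)) (S h (S t z)).
    have X1 : X (S (t + h) z) by apply: SX => //; exact: addr_ge0.
    have X2 := SX h0' Xt.
    have := B_lip X1 X2; rewrite addrC (semigroup_D HS)// mulr0 mul0r addr0//.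
  have h2 : B (S (t + h) z) (S (t + h) z) <= expR (- (2 * c * h)) * B (S t z) (S t z) + e / expR (2 * c * d) * h.
    apply: (le_trans E); apply: (le_trans Hr); rewrite lerD2r ler_wpM2r ?Bt_ge//.
    by have := expR_ge1Dx (- (2 * c * h)); rewrite -/(1 - 2 * c * h)%R.
  rewrite /f; apply: (le_trans (ler_wpM2l (expR_ge0 _) h2)).
  rewrite mulrDr mulrA -expRD (_ : 2 * c * (t + h) + _ = 2 * c * t); last by ring.
  rewrite lerD2l mulrA ler_wpM2r// mulrCA ger_pMr// ler_pdivrMr// mul1r ler_expR.
  by rewrite ler_wpM2l ?mulr_ge0//; lra.
- pose Q := K * (M * N z) * (M * N z).
  have Q0 : 0 <= Q by rewrite /Q !mulr_ge0.
  pose E1 := expR (2 * c * d).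
  have E10 : 0 < E1 by exact: expR_gt0.
  pose P := K * M * (2 * (M * N z)) * E1.
  have P0 : 0 <= P by rewrite /P !mulr_ge0// ltW.
  have [r1 r10 Hr1] : exists2 r, 0 < r & forall h, 0 <= h <= r -> N (S h z - z) <= e / (2 * (P + 1)).
    by apply: S_cont0 => //; rewrite divr_gt0// mulr_gt0//; exact: (ltr_wpDl P0 ltr01).
  have [r2 r20 Hr2] : exists2 r, 0 < r & forall h, 0 < h <= r -> `|expR (2 * c * h) - 1| <= e / (2 * (E1 * Q + 1)).
    have ep : 0 < e / (2 * (E1 * Q + 1)).
      by rewrite divr_gt0// mulr_gt0//; apply: ltr_wpDl => //; exact: mulr_ge0 (ltW E10) Q0.
    apply: (proj1 (at_right_le (fun h => expR (2 * c * h) - 1)) _ _ ep).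
    have cts : continuous (fun h : R => expR (2 * c * h) - 1).
      move=> h; apply: cvgB; last exact: cvg_cst.
      apply: (@continuous_comp _ _ _ (fun h => 2 * c * h) expR); last exact: continuous_expR.
      by apply: continuousM; [exact: cvg_cst|exact: cvg_id].
    by have := cvg_at_right_filter (cts 0); rewrite /= mulr0 expR0 subrr.
  exists (Num.min r1 (Num.min r2 t)); first by rewrite !lt_min r10 r20.
  move=> h /andP[h0]; rewrite !le_min => /and3P[hr1 hr2 ht] _.
  have th0 : 0 <= t - h by rewrite subr_ge0.
  have t0' := ltW t0.
  have Xt := SX t0' Xz; have Xth := SX th0 Xz.
  have n1 : N (S t z - S (t - h) z) <= M * (e / (2 * (P + 1))).
    apply: le_trans (orbit_cont bS th0 _ Xz) _; first by rewrite td; lra.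
    rewrite (_ : t - (t - h) = h); last by ring.
    by rewrite ler_wpM2l// Hr1// (ltW h0).
  have n2 : N (S t z) <= M * N z by apply: bS => //; rewrite t0' td.
  have n3 : N (S (t - h) z) <= M * N z by apply: bS => //; rewrite th0/=; lra.
  have l1 := B_lip Xt Xth.
  have l2 : K * N (S t z - S (t - h) z) * (N (S t z) + N (S (t - h) z)) <= K * (M * (e / (2 * (P + 1)))) * (2 * (M * N z)).
    apply: ler_pM; [|by apply: addr_ge0; exact: (sn_ge0 sX)| |by lra].
      by rewrite mulr_ge0// (sn_ge0 sX).
    by rewrite ler_wpM2l.
  have Et : expR (2 * c * t) <= E1 by rewrite ler_expR ler_wpM2l// mulr_ge0.
  have l3 : f t <= expR (2 * c * t) * B (S (t - h) z) (S (t - h) z) + e / 2.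
    rewrite /f; apply: (le_trans (ler_wpM2l (expR_ge0 _) (le_trans l1 (lerD (lexx _) l2)))).
    rewrite mulrDr lerD2l; apply: (@le_trans _ _ (E1 * (K * (M * (e / (2 * (P + 1)))) * (2 * (M * N z))))).
      have e'0 : 0 <= e / (2 * (P + 1)) by rewrite divr_ge0 ?(ltW e0)// mulr_ge0// addr_ge0.
      apply: ler_wpM2r Et; apply: mulr_ge0; apply: mulr_ge0 => //; exact: mulr_ge0.
    have -> : E1 * (K * (M * (e / (2 * (P + 1)))) * (2 * (M * N z))) = P * (e / (2 * (P + 1))).
      by rewrite {2}/P; move: (e / _) => e'; ring.
    by apply: frac_le => //; exact: ltW.
  apply: (le_trans l3).
  have -> : expR (2 * c * t) * B (S (t - h) z) (S (t - h) z) =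
     f (t - h) + (expR (2 * c * h) - 1) * (expR (2 * c * (t - h)) * B (S (t - h) z) (S (t - h) z)).
    have Ee : expR (2 * c * t) = expR (2 * c * h) * expR (2 * c * (t - h)).
      by rewrite -expRD; congr expR; ring.
    by rewrite Ee /f; ring.
  rewrite -addrA lerD2l.
  have l4 : 0 <= expR (2 * c * (t - h)) * B (S (t - h) z) (S (t - h) z) <= E1 * Q.
    rewrite mulr_ge0 ?expR_ge0 ?Bt_ge//=; apply: ler_pM; rewrite ?expR_ge0 ?Bt_ge//.
      by rewrite ler_expR ler_wpM2l// ?mulr_ge0//; lra.
    by apply: Bt_le; rewrite th0/=; lra.
  have l5 : expR (2 * c * h) - 1 <= e / (2 * (E1 * Q + 1)).
    by apply: (le_trans (ler_norm _)); apply: Hr2; rewrite h0.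
  have EQ0 : 0 <= E1 * Q by rewrite mulr_ge0// ltW.
  have l6 : (expR (2 * c * h) - 1) * (expR (2 * c * (t - h)) * B (S (t - h) z) (S (t - h) z)) <= e / (2 * (E1 * Q + 1)) * (E1 * Q).
    case/andP: l4 => l41 l42; apply: (le_trans (ler_wpM2r l41 l5)).
    by rewrite ler_wpM2l// divr_ge0 ?(ltW e0)// mulr_ge0// addr_ge0.
  have l7 : e / (2 * (E1 * Q + 1)) * (E1 * Q) <= e / 2.
    by rewrite mulrC; apply: frac_le => //; exact: ltW.
  by lra.
Qed.

(** First on the domain, cutting [[0, t]] into steps short enough for
    [decay_small]; then everywhere, because the domain is dense and both sides
    are continuous in the initial vector. *)
Lemma lyapunov_decay t x : 0 <= t -> X x ->
  B (S t x) (S t x) <= expR (- (2 * c * t)) * B x x.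
Proof.
move=> t0 Xx; have [d [M [d0 M0 bS]]] := local_bound cX.
have K0 := ly_K lB.
have step n s z y : 0 <= s <= d -> X z -> X y -> A z y ->
    B (S (n%:R * s) z) (S (n%:R * s) z) <= expR (- (2 * c * (n%:R * s))) * B z z.
  move=> sd Xz Xy Azy; have /andP[s0 _] := sd; elim: n => [|n IH].
    rewrite mul0r mulr0 oppr0 expR0 mul1r.
    by have := B_lip (SX (lexx 0) Xz) Xz; rewrite (semigroup_0 HS)// mulr0 mul0r addr0.
  have ns0 : 0 <= n%:R * s by rewrite mulr_ge0.
  have Xn := SX ns0 Xz; have Xny := SX ns0 Xy.
  have H := decay_small d0 M0 bS Xn Xny (generator_stable ns0 Xz Xy Azy) sd.
  rewrite -[n.+1%:R]natr1 mulrDl mul1r.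
  have X1 : X (S (n%:R * s + s) z) by apply: SX => //; exact: addr_ge0.
  have := B_lip X1 (SX s0 Xn); rewrite addrC (semigroup_D HS)// mulr0 mul0r addr0 => h.
  apply: (le_trans h); apply: (le_trans H).
  apply: (le_trans (ler_wpM2l (expR_ge0 _) IH)); rewrite mulrA -expRD.
  by rewrite (_ : - _ + _ = - (2 * c * (s + n%:R * s)))//; ring.
have domain z y : X z -> X y -> A z y -> B (S t z) (S t z) <= expR (- (2 * c * t)) * B z z.
  move=> Xz Xy Azy; pose n := (Num.truncn (t / d)).
  have nd : t / n.+1%:R <= d.
    rewrite ler_pdivrMr// mulrC -ler_pdivrMr//; exact/ltW/truncnS_gt.
  have := step n.+1 (t / n.+1%:R) z y.
  rewrite (_ : n.+1%:R * (t / n.+1%:R) = t); last by rewrite mulrC divfK.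
  apply => //.
  by rewrite nd andbT divr_ge0.
have [Mt0 HM] := opn_valid t0; set Mt := opn t in Mt0 HM.
apply/ler_addgt0Pr => e e0.
have Nx0 := sn_ge0 sX x.
pose D := K * (Mt * Mt + 1) * (2 * N x + 1).
have D0 : 0 <= D by rewrite /D !mulr_ge0// addr_ge0// ?mulr_ge0.
have [z [y [Xz Xy zx /(gA Xz Xy) Azy]]] := @generator_dense d M d0 M0 bS x
  (Num.min 1 (e / (D + 1))) cX Xx ltac:(by rewrite lt_min ltr01 divr_gt0// (ltr_wpDl D0 ltr01)).
move: zx; rewrite le_min => /andP[zx1 zxe].
have H := domain z y Xz Xy Azy.
have Nz : N z <= N x + 1 by apply: (le_trans (Nsub Xz Xx)); rewrite lerD2l.
have Nz0 := sn_ge0 sX z.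
have XSx := SX t0 Xx; have XSz := SX t0 Xz.
have l1 := B_lip XSx XSz; have l2 := B_lip Xz Xx.
have a1 : N (S t x - S t z) <= Mt * N (z - x).
  by rewrite N_SB// (NC Xz Xx); apply: HM; exact: XB.
have a2 : N (S t x) + N (S t z) <= Mt * (2 * N x + 1).
  by have := HM x Xx; have := HM z Xz => b1 b2; have := ler_wpM2l Mt0 Nz; lra.
have zx0 := sn_ge0 sX (z - x).
have a3 : K * N (S t x - S t z) * (N (S t x) + N (S t z)) <= K * (Mt * N (z - x)) * (Mt * (2 * N x + 1)).
  apply: ler_pM => //; [by rewrite mulr_ge0// (sn_ge0 sX)|by rewrite addr_ge0// (sn_ge0 sX)|].
  exact: ler_wpM2l.
have a4 : K * N (z - x) * (N z + N x) <= K * N (z - x) * (2 * N x + 1).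
  by rewrite ler_wpM2l ?mulr_ge0//; lra.
have ex1 : expR (- (2 * c * t)) <= 1.
  by rewrite -expR0 ler_expR oppr_le0 !mulr_ge0.
have l3 : expR (- (2 * c * t)) * B z z <= expR (- (2 * c * t)) * B x x + K * N (z - x) * (2 * N x + 1).
  apply: (le_trans (ler_wpM2l (expR_ge0 _) (le_trans l2 (lerD (lexx _) a4)))).
  rewrite mulrDr lerD2l; apply: ler_piMl => //; apply: mulr_ge0; first exact: mulr_ge0.
  by rewrite addr_ge0// mulr_ge0.
have a5 : K * (Mt * N (z - x)) * (Mt * (2 * N x + 1)) + K * N (z - x) * (2 * N x + 1) = D * N (z - x).
  by rewrite /D; ring.
have a6 : D * N (z - x) <= e.
  apply: (le_trans (ler_wpM2l D0 zxe)); rewrite mulrA ler_pdivrMr ?(ltr_wpDl D0 ltr01)//.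
  by rewrite mulrDr mulr1 mulrC lerDl ltW.
by lra.
Qed.

End decay.
End semigroup.
End seminormed.

(** * The phase space *)

Section complex_functions.
Context {R : realType}.
Local Notation mu := (@lebesgue_measure R).
Local Notation T := (@circumference R).
Implicit Types (f g h v w : R -> R) (u : R -> R[i]) (x y z : @state R).

Definition re u t : R := complex.Re (u t).
Definition im u t : R := complex.Im (u t).

Lemma reD u1 u2 : re (u1 + u2) = (fun t => re u1 t + re u2 t).
Proof. apply/funext => t; rewrite /re -[(u1 + u2) t]/(u1 t + u2 t).
by case: (u1 t) (u2 t) => a b [c d]. Qed.
Lemma imD u1 u2 : im (u1 + u2) = (fun t => im u1 t + im u2 t).
Proof. apply/funext => t; rewrite /im -[(u1 + u2) t]/(u1 t + u2 t).
by case: (u1 t) (u2 t) => a b [c d]. Qed.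
Lemma reZ (a : R[i]) u : re (a *: u) = (fun t => complex.Re a * re u t - complex.Im a * im u t).
Proof.
apply/funext => t; rewrite /re /im -[(a *: u) t]/(a * u t).
by case: a (u t) => p q [r s].
Qed.
Lemma imZ (a : R[i]) u : im (a *: u) = (fun t => complex.Re a * im u t + complex.Im a * re u t).
Proof.
apply/funext => t; rewrite /re /im -[(a *: u) t]/(a * u t).
by case: a (u t) => p q [r s] /=.
Qed.

Lemma reZr (a : R) u : re (a%:C *: u) = (fun t => a * re u t).
Proof. by rewrite reZ; apply/funext => t /=; rewrite mul0r subr0. Qed.
Lemma imZr (a : R) u : im (a%:C *: u) = (fun t => a * im u t).
Proof. by rewrite imZ; apply/funext => t /=; rewrite mul0r addr0. Qed.

Lemma L2P u : L2 u <-> L2c (re u) /\ L2c (im u).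
Proof.
split.
  move=> [pu m1 m2 I]; have mI : measurable_fun setT (re u) by [].
  have CI : Cint (fun t => abs2 (u t)) by [].
  split; split => //.
  - by move=> t; rewrite /re; congr complex.Re; exact: pu.
  - apply: (Cint_le _ CI); first exact: measurable_sqr.
    by move=> t; rewrite ger0_norm ?sqr_ge0// /abs2 lerDl sqr_ge0.
  - by move=> t; rewrite /im; congr complex.Im; exact: pu.
  - apply: (Cint_le _ CI); first exact: measurable_sqr.
    by move=> t; rewrite ger0_norm ?sqr_ge0// /abs2 lerDr sqr_ge0.
move=> [[p1 m1 I1] [p2 m2 I2]]; split => //.
- move=> t; have := p1 t; have := p2 t; rewrite /re /im -/(circumference).
  by case: (u t) (u (t + _)) => a b [c d] /= -> ->.
- exact: (CintD I1 I2).
Qed.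

(** Test functions are real, so the weak derivative of a complex function splits
    into those of its real and imaginary parts. *)
Definition rweak w h := forall phi, test_function phi ->
  ci (fun t => derive1 phi t * w t) = - ci (fun t => phi t * h t).

Lemma cintegral_test phi u : cintegral (fun t => (phi t)%:C * u t) =
  ci (fun t => phi t * re u t) +i* ci (fun t => phi t * im u t).
Proof.
rewrite /cintegral; congr (_ +i* _); apply: eq_ci => t; rewrite /re /im;
  by case: (u t) => a b /=; rewrite mul0r ?subr0 ?addr0.
Qed.

Lemma weakP u1 u2 : weak_derivative u1 u2 <-> rweak (re u1) (re u2) /\ rweak (im u1) (im u2).
Proof.
split.
  move=> H; split => phi tp; have := H phi tp; rewrite !cintegral_test.
    by move=> /(congr1 (@complex.Re R)).
  by move=> /(congr1 (@complex.Im R)).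
by move=> [H1 H2] phi tp; rewrite !cintegral_test H1// H2//.
Qed.

Lemma gradP u : H1 u -> [/\ L2 (grad u), rweak (re u) (re (grad u)) & rweak (im u) (im (grad u))].
Proof.
move=> [_ [g Lg wg]]; have [LG /weakP[? ?]] : [set g | L2 g /\ weak_derivative u g] (grad u).
  by apply: xgetPex; exists g.
by split.
Qed.

Lemma rweakD w h w1 h1 : L2c w -> L2c h -> L2c w1 -> L2c h1 -> rweak w h -> rweak w1 h1 ->
  rweak (fun t => w t + w1 t) (fun t => h t + h1 t).
Proof.
move=> /L2_L1 Lw /L2_L1 Lh /L2_L1 Lw1 /L2_L1 Lh1 H H' phi tp; have td := test_derive tp.
have [_ _ i1] := L1c_test td Lw; have [_ _ i2] := L1c_test td Lw1.
have [_ _ i3] := L1c_test tp Lh; have [_ _ i4] := L1c_test tp Lh1.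
rewrite (@eq_ci _ _ (fun t => derive1 phi t * w t + derive1 phi t * w1 t)); last by move=> t; ring.
rewrite [in RHS](@eq_ci _ _ (fun t => phi t * h t + phi t * h1 t)); last by move=> t; ring.
by rewrite !ciD// H// H'//; ring.
Qed.

Lemma rweakZ c w h : L2c w -> L2c h -> rweak w h -> rweak (fun t => c * w t) (fun t => c * h t).
Proof.
move=> /L2_L1 Lw /L2_L1 Lh H phi tp; have td := test_derive tp.
have [_ _ i1] := L1c_test td Lw; have [_ _ i3] := L1c_test tp Lh.
rewrite (@eq_ci _ _ (fun t => c * (derive1 phi t * w t))); last by move=> t; ring.
rewrite [in RHS](@eq_ci _ _ (fun t => c * (phi t * h t))); last by move=> t; ring.
by rewrite !ciZ// H// mulrN.
Qed.

Lemma ci_circle0 f : measurable_fun setT f -> {ae mu, forall t, circle t -> f t = 0} -> ci f = 0.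
Proof.
move=> mf f0; rewrite -[RHS](mul0r T) -(ci_cst 0); congr fine; apply: ae_eq_integral => //.
- by apply/measurable_EFinP; exact: measurable_funTS.
- by apply/measurable_EFinP.
- by apply: ae_imp f0 => t H ct; rewrite /= H.
Qed.

(** Equality almost everywhere, in the form in which bounded forms see it.  It
    is required since gradients are chosen representatives and are linear only
    up to null sets. *)
Definition eqL f g := ip (fun t => f t - g t) (fun t => f t - g t) = 0.

Lemma eqL_ae f g : L2c f -> L2c g -> {ae mu, forall t, circle t -> f t = g t} -> eqL f g.
Proof.
move=> Lf Lg H; have [_ m _] := L2cB Lf Lg; apply: ci_circle0; first exact: measurable_funM.
by apply: ae_imp H => t H ct; rewrite H// subrr mul0r.
Qed.

Lemma rweak_unique w h h1 : L2c h -> L2c h1 -> rweak w h -> rweak w h1 -> eqL h h1.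
Proof.
move=> Lh Lh1 H H'; apply: eqL_ae => //.
have L : L1c (fun t => h t - h1 t) := L1cB (L2_L1 Lh) (L2_L1 Lh1).
suff Z : {ae mu, forall t, circle t -> h t - h1 t = 0}.
  by apply: ae_imp Z => t Z ct; apply/eqP; rewrite -subr_eq0 Z.
apply: du_bois_reymond0 => // phi tp.
have [_ _ i3] := L1c_test tp (L2_L1 Lh); have [_ _ i4] := L1c_test tp (L2_L1 Lh1).
rewrite (@eq_ci _ _ (fun t => phi t * h t - phi t * h1 t)); last by move=> t; ring.
rewrite ciB//; have := H _ tp; rewrite H'// => /oppr_inj ->; ring.
Qed.

(** Weak derivatives are closed, which gives completeness of H1. *)
Lemma rweak_lim (w_ h_ : nat -> R -> R) w h : (forall n, L2c (w_ n)) -> (forall n, L2c (h_ n)) ->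
  L2c w -> L2c h -> (forall n, rweak (w_ n) (h_ n)) ->
  (forall e, 0 < e -> exists n, nrm (fun t => w_ n t - w t) <= e /\ nrm (fun t => h_ n t - h t) <= e) ->
  rweak w h.
Proof.
move=> Lw_ Lh_ Lw Lh H lim phi tp; have td := test_derive tp.
have L1 : L2c (derive1 phi) by apply: (L2c_periodic_primitive (test_primitive td)); case: td.
have L2 : L2c phi by apply: (L2c_periodic_primitive (test_primitive tp)); case: tp.
apply/eqP; rewrite -addr_eq0 -normr_le0; apply/ler_addgt0Pr => e e0; rewrite add0r.
pose M := nrm (derive1 phi) + nrm phi + 1.
have M0 : 0 < M by rewrite ltr_wpDl// addr_ge0 ?nrm_ge0.
have [n [h1 h2]] := lim (e / M) (divr_gt0 e0 M0).
have Ld1 := L2cB (Lw_ n) Lw; have Ld2 := L2cB (Lh_ n) Lh.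
have k1 := CS_nrm L1 Ld1; have k2 := CS_nrm L2 Ld2.
have dist p q r : L2c p -> L2c q -> L2c r -> ip p (fun t => q t - r t) = ip p q - ip p r.
  move=> Lp Lq Lr; have [_ _ i1] := L2_mul Lp Lq; have [_ _ i2] := L2_mul Lp Lr.
  by rewrite /ip -ciB//; apply: eq_ci => t; ring.
have E : ci (fun t => derive1 phi t * w t) + ci (fun t => phi t * h t) =
   - (ip (derive1 phi) (fun t => w_ n t - w t) + ip phi (fun t => h_ n t - h t)).
  rewrite !dist// -/(ip _ w) -/(ip _ h); have := H n phi tp; rewrite -/(ip _ (w_ n)) -/(ip _ (h_ n)) => ->; ring.
rewrite E normrN; apply: le_trans (ler_normD _ _) _.
apply: le_trans (lerD k1 k2) _.
apply: (@le_trans _ _ (nrm (derive1 phi) * (e / M) + nrm phi * (e / M))).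
  by rewrite lerD// ler_wpM2l ?nrm_ge0.
rewrite -mulrDl mulrCA ler_piMr ?(ltW e0)// ler_pdivrMr// mul1r /M lerDl//.
Qed.

Lemma H1D u1 u2 : H1 u1 -> H1 u2 -> H1 (u1 + u2) /\
  eqL (re (grad (u1 + u2))) (fun t => re (grad u1) t + re (grad u2) t) /\
  eqL (im (grad (u1 + u2))) (fun t => im (grad u1) t + im (grad u2) t).
Proof.
move=> h1 h2; have [/L2P[a1 b1] _] := h1; have [/L2P[a2 b2] _] := h2.
have [/L2P[c1 d1] r1 i1] := gradP h1; have [/L2P[c2 d2] r2 i2] := gradP h2.
have r := rweakD a1 c1 a2 c2 r1 r2; have i := rweakD b1 d1 b2 d2 i1 i2.
have h : H1 (u1 + u2).
  split; first by apply/L2P; rewrite reD imD; split; exact: L2cD.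
  exists (grad u1 + grad u2); first by apply/L2P; rewrite reD imD; split; exact: L2cD.
  by apply/weakP; rewrite !reD !imD.
split=> //; have [/L2P[c d] r' i'] := gradP h; rewrite reD in r'; rewrite imD in i'.
by split; [apply: (rweak_unique c _ r' r)|apply: (rweak_unique d _ i' i)]; exact: L2cD.
Qed.

Lemma H1Z (a : R[i]) u : H1 u -> H1 (a *: u) /\
  eqL (re (grad (a *: u))) (re (a *: grad u)) /\ eqL (im (grad (a *: u))) (im (a *: grad u)).
Proof.
move=> h1; have [/L2P[a1 b1] _] := h1; have [/L2P[c1 d1] r1 i1] := gradP h1.
have Z w v p q : L2c w -> L2c v -> L2c (fun t => p * w t + q * v t).
  by move=> Lw Lv; apply: L2cD; exact: L2cZ.
have e1 (v : R -> R[i]) : re (a *: v) = fun t => complex.Re a * re v t + - complex.Im a * im v t.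
  by rewrite reZ; apply/funext => t; rewrite mulNr.
have WZ p q w v h k : L2c w -> L2c v -> L2c h -> L2c k -> rweak w h -> rweak v k ->
   rweak (fun t => p * w t + q * v t) (fun t => p * h t + q * k t).
  by move=> *; apply: rweakD; try exact: L2cZ; exact: rweakZ.
have r := WZ (complex.Re a) (- complex.Im a) _ _ _ _ a1 b1 c1 d1 r1 i1.
have i := WZ (complex.Re a) (complex.Im a) _ _ _ _ b1 a1 d1 c1 i1 r1.
have h : H1 (a *: u).
  split; first by apply/L2P; rewrite e1 imZ; split; exact: Z.
  exists (a *: grad u); first by apply/L2P; rewrite e1 imZ; split; exact: Z.
  by apply/weakP; rewrite !e1 !imZ.
split=> //; have [/L2P[c d] r' i'] := gradP h; rewrite e1 in r'; rewrite imZ in i'.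
rewrite e1 imZ.
by split; [apply: (rweak_unique c _ r' r)|apply: (rweak_unique d _ i' i)]; exact: Z.
Qed.

Lemma L2D u1 u2 : L2 u1 -> L2 u2 -> L2 (u1 + u2).
Proof.
by move=> /L2P[a b] /L2P[c d]; apply/L2P; rewrite reD imD; split; exact: L2cD.
Qed.

Lemma L2Z (a : R[i]) u : L2 u -> L2 (a *: u).
Proof.
move=> /L2P[p q]; apply/L2P; rewrite reZ imZ.
by split; [apply: L2cB|apply: L2cD]; exact: L2cZ.
Qed.

Lemma L20 : L2 (0 : R -> R[i]).
Proof. by apply/L2P; split; exact: (L2c_cst 0). Qed.

Lemma H10 : H1 (0 : R -> R[i]).
Proof.
split; first exact: L20.
exists 0; first exact: L20.
by apply/weakP; split => phi _;
  rewrite (@eq_ci _ _ (cst 0)) ?ci_cst ?mul0r; [rewrite (@eq_ci _ _ (cst 0)) ?ci_cst ?mul0r ?oppr0// => t; rewrite mulr0|move=> t; rewrite mulr0|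
   rewrite (@eq_ci _ _ (cst 0)) ?ci_cst ?mul0r ?oppr0// => t; rewrite mulr0|move=> t; rewrite mulr0].
Qed.

Record bform (Phi : (R -> R) -> (R -> R) -> (R -> R) -> (R -> R) -> R) (Kb : R) : Prop := BForm {
  bf_K : 0 <= Kb;
  bf_D : forall g v g1 v1 g' v', L2c g -> L2c v -> L2c g1 -> L2c v1 -> L2c g' -> L2c v' ->
    Phi (fun t => g t + g1 t) (fun t => v t + v1 t) g' v' = Phi g v g' v' + Phi g1 v1 g' v';
  bf_Z : forall c g v g' v', L2c g -> L2c v -> L2c g' -> L2c v' ->
    Phi (fun t => c * g t) (fun t => c * v t) g' v' = c * Phi g v g' v';
  bf_C : forall g v g' v', Phi g v g' v' = Phi g' v' g v;
  bf_le : forall g v g' v', L2c g -> L2c v -> L2c g' -> L2c v' ->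
    `|Phi g v g' v'| <= Kb * Num.sqrt (en g v) * Num.sqrt (en g' v') }.

Lemma bform_damping W B Kb k : damping_form W B Kb k -> bform B Kb.
Proof. by case. Qed.

Definition en2 g v g' v' : R := ip g g' + ip v v'.

Lemma bform_en2 : bform en2 2.
Proof.
split; first by [].
- by move=> *; rewrite /en2 !ipDl//; ring.
- by move=> *; rewrite /en2 !ipZl//; ring.
- by move=> g v g' v'; rewrite /en2 (ipC g) (ipC v).
move=> g v g' v' Lg Lv Lg' Lv'; rewrite /en2; apply: le_trans (ler_normD _ _) _.
rewrite -mulrA mulr_natl mulr2n; apply: lerD; apply: le_trans (CS_nrm _ _) _ => //;
  by apply: ler_pM; rewrite ?nrm_ge0 ?nrm_en_l ?nrm_en_r.
Qed.

Section lift_form.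
Variables (Phi : (R -> R) -> (R -> R) -> (R -> R) -> (R -> R) -> R) (Kb : R).
Hypothesis bP : bform Phi Kb.

Lemma bform_eq g v g1 v1 g' v' : L2c g -> L2c v -> L2c g1 -> L2c v1 -> L2c g' -> L2c v' ->
  eqL g g1 -> eqL v v1 -> Phi g v g' v' = Phi g1 v1 g' v'.
Proof.
move=> Lg Lv Lg1 Lv1 Lg' Lv' Eg Ev.
have Ld := L2cB Lg Lg1; have Ld' := L2cB Lv Lv1.
have := bf_le bP Ld Ld' Lg' Lv'; rewrite /en Eg Ev addr0 sqrtr0 mulr0 mul0r normr_le0 => /eqP Z.
have := bf_D bP Lg1 Lv1 Ld Ld' Lg' Lv'; rewrite Z addr0 => <-.
by congr (Phi _ _ _ _); apply/funext => t; ring.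
Qed.

(** The equation has real coefficients, so a form on real states is applied to
    the real and to the imaginary part. *)
Definition lift_form x y : R := Phi (re (grad x.1)) (re x.2) (re (grad y.1)) (re y.2)
  + Phi (im (grad x.1)) (im x.2) (im (grad y.1)) (im y.2).

Lemma eqL_refl f : eqL f f.
Proof. by rewrite /eqL /ip (@eq_ci _ _ (cst 0)) ?ci_cst ?mul0r// => t; rewrite subrr mul0r. Qed.

Lemma spaceP x : phase_space x -> [/\ L2c (re x.1), L2c (im x.1) & [/\ L2c (re (grad x.1)), L2c (im (grad x.1)),
  L2c (re x.2) & L2c (im x.2)]].
Proof.
move=> [h1 /L2P[l1 l2]]; have [/L2P[l3 l4] _] := h1; have [/L2P[l5 l6] _ _] := gradP h1.
by split.
Qed.

Lemma liftC x y : lift_form x y = lift_form y x.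
Proof. by rewrite /lift_form (bf_C bP) [X in _ + X](bf_C bP). Qed.

Lemma liftD x y z : phase_space x -> phase_space y -> phase_space z ->
  lift_form (x + y) z = lift_form x z + lift_form y z.
Proof.
move=> Xx Xy Xz; have [_ _ [x1 x2 x3 x4]] := spaceP Xx; have [_ _ [y1 y2 y3 y4]] := spaceP Xy.
have [_ _ [z1 z2 z3 z4]] := spaceP Xz.
have [h [e1 e2]] := H1D (proj1 Xx) (proj1 Xy); have [/L2P[l1 l2] _ _] := gradP h.
rewrite /lift_form -[(x + y).1]/(x.1 + y.1) -[(x + y).2]/(x.2 + y.2).
have E1 : Phi (re (grad (x.1 + y.1))) (re (x.2 + y.2)) (re (grad z.1)) (re z.2) =
    Phi (fun t => re (grad x.1) t + re (grad y.1) t) (fun t => re x.2 t + re y.2 t) (re (grad z.1)) (re z.2).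
  by rewrite reD; apply: bform_eq => //; try exact: L2cD; exact: eqL_refl.
have E2 : Phi (im (grad (x.1 + y.1))) (im (x.2 + y.2)) (im (grad z.1)) (im z.2) =
    Phi (fun t => im (grad x.1) t + im (grad y.1) t) (fun t => im x.2 t + im y.2 t) (im (grad z.1)) (im z.2).
  by rewrite imD; apply: bform_eq => //; try exact: L2cD; exact: eqL_refl.
rewrite E1 E2 (bf_D bP x1 x3 y1 y3 z1 z3) (bf_D bP x2 x4 y2 y4 z2 z4); ring.
Qed.

Lemma liftZ (a : R) x z : phase_space x -> phase_space z -> lift_form (a%:C *: x) z = a * lift_form x z.
Proof.
move=> Xx Xz; have [_ _ [x1 x2 x3 x4]] := spaceP Xx.
have [_ _ [z1 z2 z3 z4]] := spaceP Xz.
have [h [e1 e2]] := H1Z a%:C (proj1 Xx); have [/L2P[l1 l2] _ _] := gradP h.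
rewrite reZr in e1; rewrite imZr in e2.
rewrite /lift_form -[(_ *: x).1]/(a%:C *: x.1) -[(_ *: x).2]/(a%:C *: x.2).
have E1 : Phi (re (grad (a%:C *: x.1))) (re (a%:C *: x.2)) (re (grad z.1)) (re z.2) =
    Phi (fun t => a * re (grad x.1) t) (fun t => a * re x.2 t) (re (grad z.1)) (re z.2).
  by rewrite reZr; apply: bform_eq => //; try exact: L2cZ; exact: eqL_refl.
have E2 : Phi (im (grad (a%:C *: x.1))) (im (a%:C *: x.2)) (im (grad z.1)) (im z.2) =
    Phi (fun t => a * im (grad x.1) t) (fun t => a * im x.2 t) (im (grad z.1)) (im z.2).
  by rewrite imZr; apply: bform_eq => //; try exact: L2cZ; exact: eqL_refl.
rewrite E1 E2 (bf_Z bP a x1 x3 z1 z3) (bf_Z bP a x2 x4 z2 z4); ring.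
Qed.

End lift_form.

(** Twice the energy. *)
Definition cen x : R := lift_form en2 x x.
(** The real inner product of the phase space. *)
Definition cip x y : R := ip (re x.1) (re y.1) + ip (im x.1) (im y.1) + lift_form en2 x y.

Lemma ci_abs2 u : L2 u -> ci (fun t => abs2 (u t)) = ip (re u) (re u) + ip (im u) (im u).
Proof.
move=> /L2P[l1 l2]; have [_ _ i1] := L2_mul l1 l1; have [_ _ i2] := L2_mul l2 l2.
by rewrite /ip -ciD//; apply: eq_ci => t; rewrite -!expr2.
Qed.

Lemma phase_normE x : phase_space x -> phase_norm x = Num.sqrt (cip x x).
Proof.
move=> Xx; have [lg _ _] := gradP (proj1 Xx); rewrite /phase_norm.
rewrite -[X in X + _ + _]/(ci (fun t => abs2 (x.1 t))) -[X in _ + X + _]/(ci (fun t => abs2 (grad x.1 t))).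
rewrite -[X in _ + _ + X]/(ci (fun t => abs2 (x.2 t))).
rewrite !ci_abs2//; [|by case: Xx|by case: Xx => -[]].
by congr Num.sqrt; rewrite /cip /lift_form /en2; ring.
Qed.

Lemma energyE x : phase_space x -> energy x = 2^-1 * cen x.
Proof.
move=> Xx; have [lg _ _] := gradP (proj1 Xx); have [_ lv] := Xx.
rewrite /energy; congr (_ * _); have /L2P[l1 l2] := lg; have /L2P[l3 l4] := lv.
have I1 : Cint (fun t => abs2 (grad x.1 t)) by case: lg.
have I2 : Cint (fun t => abs2 (x.2 t)) by case: lv.
rewrite -[LHS]/(ci (fun t => abs2 (grad x.1 t) + abs2 (x.2 t))) ciD// !ci_abs2//.
by rewrite /cen /lift_form /en2; ring.
Qed.

Lemma cen_ge0 x : 0 <= cen x.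
Proof. by rewrite addr_ge0// addr_ge0// ip_ge0. Qed.

Lemma cip_ge0 x : 0 <= cip x x.
Proof. by rewrite addr_ge0 ?cen_ge0// addr_ge0// ip_ge0. Qed.

Lemma phase_lin (a : R[i]) x y : phase_space x -> phase_space y -> phase_space (a *: x + y).
Proof.
move=> [h1 l1] [h2 l2]; split => /=; last by apply: L2D => //; exact: L2Z.
by have [h _] := H1Z a h1; have [] := H1D h h2.
Qed.

Lemma phase0 : phase_space (0 : @state R).
Proof. by split; [exact: H10|exact: L20]. Qed.

Lemma phaseD x y : phase_space x -> phase_space y -> phase_space (x + y).
Proof. by move=> Xx Xy; rewrite -[x]scale1r; exact: phase_lin. Qed.

Lemma phaseZ (a : R[i]) x : phase_space x -> phase_space (a *: x).
Proof. by move=> Xx; rewrite -[a *: x]addr0; apply: phase_lin => //; exact: phase0. Qed.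

Lemma cipC x y : cip x y = cip y x.
Proof.
by rewrite /cip (ipC (re x.1)) (ipC (im x.1)) (liftC bform_en2).
Qed.

Lemma cipD x y z : phase_space x -> phase_space y -> phase_space z ->
  cip (x + y) z = cip x z + cip y z.
Proof.
move=> Xx Xy Xz; have [x1 x2 _] := spaceP Xx; have [y1 y2 _] := spaceP Xy.
have [z1 z2 _] := spaceP Xz.
by rewrite /cip (liftD bform_en2)// -[(x + y).1]/(x.1 + y.1) reD imD !ipDl//; ring.
Qed.

Lemma cipZ (a : R) x z : phase_space x -> phase_space z -> cip (a%:C *: x) z = a * cip x z.
Proof.
move=> Xx Xz; have [x1 x2 _] := spaceP Xx; have [z1 z2 _] := spaceP Xz.
by rewrite /cip (liftZ bform_en2)// -[(_ *: x).1]/(a%:C *: x.1) reZr imZr !ipZl//; ring.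
Qed.

Lemma cipDD x y : phase_space x -> phase_space y -> cip (x + y) (x + y) = cip x x + 2 * cip x y + cip y y.
Proof.
move=> Xx Xy; have Xxy := phaseD Xx Xy.
by rewrite cipD// (cipC x) (cipC y) !cipD// (cipC y x); ring.
Qed.

Lemma cip_CS x y : phase_space x -> phase_space y -> cip x y <= Num.sqrt (cip x x) * Num.sqrt (cip y y).
Proof.
move=> Xx Xy; have : (cip x y) ^+ 2 <= cip x x * cip y y.
  apply: quad_discr; [exact: cip_ge0|exact: cip_ge0|move=> t].
  have Xty := phaseZ t%:C Xy; have := cip_ge0 (x + t%:C *: y); rewrite cipDD//.
  by rewrite (cipC x) !cipZ// (cipC y (_ *: y)) cipZ// (cipC y x); move=> h; apply: le_trans h _; lra.
move=> h; apply: le_trans (ler_norm _) _; rewrite -sqrtrM ?cip_ge0// -sqrtr_sqr.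
by rewrite ler_sqrt// mulr_ge0 ?cip_ge0.
Qed.

Lemma seminormed_phase : seminormed (@phase_space R) (@phase_norm R).
Proof.
split.
- exact: phase0.
- exact: phase_lin.
- by move=> x; exact: sqrtr_ge0.
- move=> x y Xx Xy; rewrite !phase_normE//; last exact: phaseD.
  rewrite -ler_sqr ?nnegrE ?addr_ge0 ?sqrtr_ge0// sqr_sqrtr ?cip_ge0// sqrrD !sqr_sqrtr ?cip_ge0//.
  by rewrite cipDD//; have := cip_CS Xx Xy; lra.
- move=> a x Xx; rewrite !phase_normE//; last exact: phaseZ.
  have Xa := phaseZ a%:C Xx.
  by rewrite cipZ// cipC cipZ// mulrA -expr2 sqrtrM ?sqr_ge0// sqrtr_sqr.
Qed.

Lemma sqrt_en_le x : phase_space x ->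
  Num.sqrt (en (re (grad x.1)) (re x.2)) <= phase_norm x /\ Num.sqrt (en (im (grad x.1)) (im x.2)) <= phase_norm x.
Proof.
move=> Xx; rewrite phase_normE//; split; rewrite ler_sqrt ?cip_ge0// /cip /lift_form /en2 /en.
- have h1 := ip_ge0 (re x.1); have h2 := ip_ge0 (im x.1).
  have h3 := ip_ge0 (im (grad x.1)); have h4 := ip_ge0 (im x.2); lra.
- have h1 := ip_ge0 (re x.1); have h2 := ip_ge0 (im x.1).
  have h3 := ip_ge0 (re (grad x.1)); have h4 := ip_ge0 (re x.2); lra.
Qed.

Lemma nrm_eqL f g : L2c f -> L2c g -> eqL f g -> nrm f = nrm g.
Proof.
have half p q : L2c p -> L2c q -> eqL p q -> nrm p <= nrm q.
  move=> Lp Lq E; have := nrm_triangle (L2cB Lp Lq) Lq.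
  rewrite {2}/nrm E sqrtr0 add0r (_ : (fun t => _) = p)//; by apply/funext => t; ring.
move=> Lf Lg E; apply/eqP; rewrite eq_le !half//.
by rewrite /eqL -E /ip; apply: eq_ci => t; ring.
Qed.

Lemma reB u1 u2 : re (u1 - u2) = (fun t => re u1 t - re u2 t).
Proof. by apply/funext => t; rewrite /re -[(u1 - u2) t]/(u1 t - u2 t); case: (u1 t) (u2 t) => a b [c d]. Qed.
Lemma imB u1 u2 : im (u1 - u2) = (fun t => im u1 t - im u2 t).
Proof. by apply/funext => t; rewrite /im -[(u1 - u2) t]/(u1 t - u2 t); case: (u1 t) (u2 t) => a b [c d]. Qed.

Lemma rweakB w h w1 h1 : L2c w -> L2c h -> L2c w1 -> L2c h1 -> rweak w h -> rweak w1 h1 ->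
  rweak (fun t => w t - w1 t) (fun t => h t - h1 t).
Proof.
move=> Lw Lh Lw1 Lh1 H H'.
have := rweakD Lw Lh (L2cZ (-1) Lw1) (L2cZ (-1) Lh1) H (rweakZ (-1) Lw1 Lh1 H').
by congr rweak; apply/funext => t; rewrite mulN1r.
Qed.

Lemma phaseB x y : phase_space x -> phase_space y -> phase_space (x - y).
Proof. by move=> Xx Xy; apply: phaseD => //; rewrite -scaleN1r; exact: phaseZ. Qed.

Lemma gradB u1 u2 h k : H1 u1 -> H1 u2 -> H1 (u1 - u2) -> L2c h -> L2c k ->
  rweak (re u2) h -> rweak (im u2) k ->
  nrm (re (grad (u1 - u2))) = nrm (fun t => re (grad u1) t - h t) /\
  nrm (im (grad (u1 - u2))) = nrm (fun t => im (grad u1) t - k t).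
Proof.
move=> h1 h2 h3 Lh Lk wh wk.
have [/L2P[a1 b1] _] := h1; have [/L2P[a2 b2] _] := h2.
have [/L2P[c1 d1] r1 i1] := gradP h1; have [/L2P[c d] r i] := gradP h3.
rewrite reB in r; rewrite imB in i.
have r' := rweakB a1 c1 a2 Lh r1 wh; have i' := rweakB b1 d1 b2 Lk i1 wk.
by split; (apply: nrm_eqL; [by []|exact: L2cB|]);
  [apply: (rweak_unique c _ r r')|apply: (rweak_unique d _ i i')]; exact: L2cB.
Qed.

Lemma nrm_phase x : phase_space x ->
  [/\ nrm (re x.1) <= phase_norm x, nrm (im x.1) <= phase_norm x &
   [/\ nrm (re (grad x.1)) <= phase_norm x, nrm (im (grad x.1)) <= phase_norm x,
     nrm (re x.2) <= phase_norm x & nrm (im x.2) <= phase_norm x]].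
Proof.
move=> Xx; rewrite phase_normE//; have := ip_ge0 (re x.1); have := ip_ge0 (im x.1).
have := ip_ge0 (re (grad x.1)); have := ip_ge0 (im (grad x.1)).
have := ip_ge0 (re x.2); have := ip_ge0 (im x.2).
by move=> *; split; [..|split]; rewrite ler_sqrt ?cip_ge0// /cip /lift_form /en2; lra.
Qed.

Lemma phase_nrm x : phase_space x ->
  phase_norm x <= nrm (re x.1) + nrm (im x.1) + (nrm (re (grad x.1)) + nrm (im (grad x.1)))
   + (nrm (re x.2) + nrm (im x.2)).
Proof.
move=> Xx; rewrite phase_normE// /cip /lift_form /en2 -!nrm_sqr.
have := nrm_ge0 (re x.1); have := nrm_ge0 (im x.1); have := nrm_ge0 (re (grad x.1)).
have := nrm_ge0 (im (grad x.1)); have := nrm_ge0 (re x.2); have := nrm_ge0 (im x.2).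
move: (nrm (re x.1)) (nrm (im x.1)) (nrm (re (grad x.1))) (nrm (im (grad x.1))) (nrm (re x.2)) (nrm (im x.2)).
move=> a b c d e f f0 e0 d0 c0 b0 a0.
have S0 : 0 <= a + b + (c + d) + (e + f) by rewrite !addr_ge0.
rewrite -[leRHS]ger0_norm// -sqrtr_sqr ler_sqrt ?sqr_ge0//.
have ab := mulr_ge0 a0 b0; have cd := mulr_ge0 c0 d0; have ef := mulr_ge0 e0 f0.
have abcd := mulr_ge0 (addr_ge0 a0 b0) (addr_ge0 c0 d0).
have abef := mulr_ge0 (addr_ge0 (addr_ge0 a0 b0) (addr_ge0 c0 d0)) (addr_ge0 e0 f0).
have -> : (a + b + (c + d) + (e + f)) ^+ 2 = a ^+ 2 + b ^+ 2 + c ^+ 2 + d ^+ 2 + e ^+ 2 + f ^+ 2 +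
   2 * (a * b) + 2 * (c * d) + 2 * (e * f) + 2 * ((a + b) * (c + d)) + 2 * ((a + b + (c + d)) * (e + f)) by ring.
lra.
Qed.

Lemma seq_complete_phase : seq_complete (@phase_space R) (@phase_norm R).
Proof.
move=> x_ Xx cauchy.
have limit (F : @state R -> R -> R) : (forall x, phase_space x -> L2c (F x)) ->
    (forall x y, phase_space x -> phase_space y -> nrm (fun t => F x t - F y t) <= phase_norm (x - y)) ->
    exists2 f, L2c f & forall e, 0 < e -> exists n0, forall n, (n0 <= n)%N -> nrm (fun t => F (x_ n) t - f t) <= e.
  move=> LF dF; apply: (@L2c_complete _ (fun n => F (x_ n))) => [n|e e0]; first exact: LF.
  have [n0 H] := cauchy e e0; exists n0 => m n nm nn.
  by apply: le_trans (dF _ _ _ _) _ => //; exact: H.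
have dist x y : phase_space x -> phase_space y -> [/\ nrm (fun t => re x.1 t - re y.1 t) <= phase_norm (x - y),
    nrm (fun t => im x.1 t - im y.1 t) <= phase_norm (x - y) &
   [/\ nrm (fun t => re (grad x.1) t - re (grad y.1) t) <= phase_norm (x - y),
    nrm (fun t => im (grad x.1) t - im (grad y.1) t) <= phase_norm (x - y),
    nrm (fun t => re x.2 t - re y.2 t) <= phase_norm (x - y) &
    nrm (fun t => im x.2 t - im y.2 t) <= phase_norm (x - y)]].
  move=> Xx' Xy; have Xxy := phaseB Xx' Xy; have [h1 h2 [h3 h4 h5 h6]] := nrm_phase Xxy.
  have [/L2P[l1 l2] r i] := gradP (proj1 Xy).
  have [e1 e2] := gradB (proj1 Xx') (proj1 Xy) (proj1 Xxy) l1 l2 r i.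
  rewrite -e1 -e2 -reB -imB -reB -imB; by split.
have [f1 L1 c1] := limit (fun x => re x.1) (fun x X => let: And3 h _ _ := spaceP X in h)
  (fun x y X Y => let: And3 h _ _ := dist x y X Y in h).
have [f2 L2' c2] := limit (fun x => im x.1) (fun x X => let: And3 _ h _ := spaceP X in h)
  (fun x y X Y => let: And3 _ h _ := dist x y X Y in h).
have [f3 L3 c3] := limit (fun x => re (grad x.1)) (fun x X => let: And3 _ _ (And4 h _ _ _) := spaceP X in h)
  (fun x y X Y => let: And3 _ _ (And4 h _ _ _) := dist x y X Y in h).
have [f4 L4 c4] := limit (fun x => im (grad x.1)) (fun x X => let: And3 _ _ (And4 _ h _ _) := spaceP X in h)
  (fun x y X Y => let: And3 _ _ (And4 _ h _ _) := dist x y X Y in h).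
have [f5 L5 c5] := limit (fun x => re x.2) (fun x X => let: And3 _ _ (And4 _ _ h _) := spaceP X in h)
  (fun x y X Y => let: And3 _ _ (And4 _ _ h _) := dist x y X Y in h).
have [f6 L6 c6] := limit (fun x => im x.2) (fun x X => let: And3 _ _ (And4 _ _ _ h) := spaceP X in h)
  (fun x y X Y => let: And3 _ _ (And4 _ _ _ h) := dist x y X Y in h).
pose u t := f1 t +i* f2 t; pose v t := f5 t +i* f6 t; pose g t := f3 t +i* f4 t.
have w1 : rweak f1 f3.
  apply: (@rweak_lim (fun n => re (x_ n).1) (fun n => re (grad (x_ n).1))) => //.
  - by move=> n; have [] := spaceP (Xx n).
  - by move=> n; have [_ _ []] := spaceP (Xx n).
  - by move=> n; have [] := gradP (proj1 (Xx n)).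
  - move=> e e0; have [n h] := c1 e e0; have [m k] := c3 e e0; exists (n + m)%N.
    by split; [apply: h; exact: leq_addr|apply: k; exact: leq_addl].
have w2 : rweak f2 f4.
  apply: (@rweak_lim (fun n => im (x_ n).1) (fun n => im (grad (x_ n).1))) => //.
  - by move=> n; have [] := spaceP (Xx n).
  - by move=> n; have [_ _ []] := spaceP (Xx n).
  - by move=> n; have [] := gradP (proj1 (Xx n)).
  - move=> e e0; have [n h] := c2 e e0; have [m k] := c4 e e0; exists (n + m)%N.
    by split; [apply: h; exact: leq_addr|apply: k; exact: leq_addl].
have Xl : phase_space ((u, v) : @state R).
  split; last by apply/L2P.
  by split; [apply/L2P|exists g; [apply/L2P|apply/weakP]].
exists (u, v) => // e e0; have e6 : 0 < e / 6 by rewrite divr_gt0.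
have [n1 d1] := c1 _ e6; have [n2 d2] := c2 _ e6; have [n3 d3] := c3 _ e6.
have [n4 d4] := c4 _ e6; have [n5 d5] := c5 _ e6; have [n6 d6] := c6 _ e6.
exists (n1 + n2 + n3 + n4 + n5 + n6)%N => n hn.
have Xd := phaseB (Xx n) Xl.
apply: le_trans (phase_nrm Xd) _.
have [E1 E2] := gradB (proj1 (Xx n)) (proj1 Xl) (proj1 Xd) L3 L4 w1 w2.
rewrite -[(x_ n - (u, v)).1]/((x_ n).1 - u) -[(x_ n - (u, v)).2]/((x_ n).2 - v) E1 E2 !reB !imB.
have k1 := d1 n ltac:(lia); have k2 := d2 n ltac:(lia); have k3 := d3 n ltac:(lia).
have k4 := d4 n ltac:(lia); have k5 := d5 n ltac:(lia); have k6 := d6 n ltac:(lia).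
apply: (@le_trans _ _ (e / 6 + e / 6 + (e / 6 + e / 6) + (e / 6 + e / 6))); last lra.
by rewrite !lerD.
Qed.

End complex_functions.

(** * Dissipation for states of finite energy *)

Section state_form.
Context {R : realType}.
Local Notation mu := (@lebesgue_measure R).
Local Notation T := (@circumference R).
Implicit Types (f g h v w u : R -> R) (x y z : @state R).

Section damped.
Variables (W : R -> R) (B : (R -> R) -> (R -> R) -> (R -> R) -> (R -> R) -> R) (Kb k : R).
Hypotheses (LW : L1c W) (dB : damping_form W B Kb k).

Lemma cen_le_lift x : phase_space x -> cen x <= lift_form B x x.
Proof.
move=> Xx; have [_ _ [h1 h2 h3 h4]] := spaceP Xx.
by rewrite lerD//; exact: (df_coercive dB).
Qed.

Lemma lift_le_cen x : phase_space x -> lift_form B x x <= Kb * cen x.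
Proof.
move=> Xx; have [_ _ [h1 h2 h3 h4]] := spaceP Xx.
have e g v : L2c g -> L2c v -> B g v g v <= Kb * en g v.
  move=> Lg Lv; apply: le_trans (ler_norm _) _; apply: le_trans (df_le dB Lg Lv Lg Lv) _.
  by rewrite -mulrA -expr2 sqr_sqrtr// addr_ge0 ?ip_ge0.
by rewrite /cen /lift_form /en2 mulrDr lerD//; exact: e.
Qed.

Lemma lyapunov_lift : lyapunov (@phase_space R) (@phase_norm R) (lift_form B) (2 * Kb).
Proof.
have bB := bform_damping dB; have Kb0 := df_K dB.
split; first by rewrite mulr_ge0.
- by move=> x y z Xx Xy Xz; exact: (liftD bB).
- by move=> a x z Xx Xz; exact: (liftZ bB).
- by move=> x y Xx Xy; exact: (liftC bB).
- by move=> x Xx; apply: le_trans (cen_ge0 x) _; exact: cen_le_lift.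
move=> x y Xx Xy; have [_ _ [h1 h2 h3 h4]] := spaceP Xx; have [_ _ [k1 k2 k3 k4]] := spaceP Xy.
have [s1 s2] := sqrt_en_le Xx; have [s3 s4] := sqrt_en_le Xy.
have N0 : 0 <= phase_norm x by exact: sqrtr_ge0.
apply: le_trans (ler_normD _ _) _.
have -> : 2 * Kb * phase_norm x * phase_norm y = Kb * phase_norm x * phase_norm y + Kb * phase_norm x * phase_norm y by ring.
apply: lerD; [apply: le_trans (df_le dB h1 h3 k1 k3) _|apply: le_trans (df_le dB h2 h4 k2 k4) _];
  by rewrite ler_pM ?mulr_ge0 ?sqrtr_ge0// ler_wpM2l.
Qed.

(** The weak equations put the state almost everywhere equal to an absolutely
    continuous one, to which the dissipation estimate applies. *)
Lemma component_diss u g v eta f : L2c u -> L2c g -> L2c v -> L2c eta -> L2c f ->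
  rweak u g -> rweak v eta ->
  (forall phi, test_function phi -> ci (fun t => phi t * f t)
     = ci (fun t => derive1 (derive1 phi) t * u t) - ci (fun t => phi t * (W t * v t))) ->
  B g v eta f <= - k * B g v g v.
Proof.
move=> Lu Lg Lv Leta Lf wu wv eqf.
have [V [AV pV _ aeV]] := weak_derivative_primitive (L2_L1 Lv) (L2_L1 Leta) wv.
have LV := L2c_periodic_primitive AV pV; have [M hM] := periodic_primitive_bdd AV pV; have mV := primitive_measurable AV.
have LWV : L1c (fun t => W t * V t).
  rewrite (_ : (fun t => _) = fun t => V t * W t); first exact: (L1c_bddM pV mV hM LW).
  by apply/funext => t; rewrite mulrC.
have Eg : forall phi, test_function phi ->
    ci (fun t => derive1 phi t * g t) = - ci (fun t => phi t * (f t + W t * V t)).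
  move=> phi tp; have td := test_derive tp.
  have E2 := wu _ td; have E1 := eqf phi tp.
  have E0 : ci (fun t => phi t * (W t * v t)) = ci (fun t => phi t * (W t * V t)).
    congr fine; apply: ae_eq_integral; first exact: mcircle.
    - have [_ mW _] := LW; have [_ mv _] := Lv; apply/measurable_EFinP; apply: measurable_funTS.
      by apply: measurable_funM; [exact: test_meas|exact: measurable_funM].
    - have [_ mWV _] := LWV; apply/measurable_EFinP; apply: measurable_funTS.
      by apply: measurable_funM => //; exact: test_meas.
    - by apply: ae_imp aeV => t H ct; rewrite H.
  have [_ _ i1] := L1c_test tp (L2_L1 Lf); have [_ _ i2] := L1c_test tp LWV.
  rewrite [in RHS](@eq_ci _ _ (fun t => phi t * f t + phi t * (W t * V t))); last by move=> t; ring.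
  by rewrite ciD//; rewrite E0 in E1; lra.
have [G [AG pG _ aeG]] := weak_derivative_primitive (L2_L1 Lg) (L1cD (L2_L1 Lf) LWV) Eg.
have LG := L2c_periodic_primitive AG pG.
have G0 : ci G = 0.
  have [_ mg _] := Lg; have [_ mG _] := LG.
  have -> : ci G = ci g.
    congr fine; apply: ae_eq_integral; first exact: mcircle.
    - by apply/measurable_EFinP; exact: measurable_funTS.
    - by apply/measurable_EFinP; exact: measurable_funTS.
    - by apply: ae_imp aeG => t H ct; rewrite H.
  have := wu _ (test_cst 1); rewrite (@eq_ci _ _ (cst 0)) ?ci_cst ?mul0r; last first.
    by move=> t; rewrite derive1_cst mul0r.
  rewrite (@eq_ci _ _ g) => [/esym/eqP|t]; last by rewrite mul1r.
  by rewrite oppr_eq0 => /eqP.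
have bB := bform_damping dB.
have e1 := eqL_ae Lg LG aeG; have e2 := eqL_ae Lv LV aeV.
rewrite (bform_eq bB Lg Lv LG LV Leta Lf e1 e2).
have -> : B g v g v = B G V G V.
  rewrite (bform_eq bB Lg Lv LG LV Lg Lv e1 e2) (df_C dB).
  exact: (bform_eq bB Lg Lv LG LV LG LV e1 e2).
exact: (df_diss dB AV AG).
Qed.

Lemma state_diss (W' : R -> R) x y : measurable_fun setT W' -> {ae mu, forall t, W' t = W t} ->
  phase_space x -> phase_space y -> damped_wave_op W' x y ->
  lift_form B x y <= - k * lift_form B x x.
Proof.
move=> mW' aeW Xx Xy [h1 h2 ae12 l2 Heq]; have [_ mW _] := LW.
have [x1 x2 [x3 x4 x5 x6]] := spaceP Xx; have [y1 y2 [y3 y4 y5 y6]] := spaceP Xy.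
have [_ rx ix] := gradP h1; have [/L2P[e3 e4] re2 ie2] := gradP h2.
have [_ ry iy] := gradP (proj1 Xy).
have ae_weak w w1 h : L2c w -> L2c w1 -> {ae mu, forall t, w t = w1 t} -> rweak w1 h -> rweak w h.
  move=> Lw Lw1 aew H phi tp; rewrite -H//; have td := test_derive tp.
  have [_ m1 _] := L1c_test td (L2_L1 Lw); have [_ m2 _] := L1c_test td (L2_L1 Lw1).
  by apply: ci_ae => //; apply: ae_imp aew => t ->.
have r1 : eqL (re (grad y.1)) (re (grad x.2)).
  apply: (rweak_unique y3 e3 ry); apply: (ae_weak _ (re x.2)) => //.
  by apply: ae_imp ae12 => t; rewrite /re => ->.
have r2 : eqL (im (grad y.1)) (im (grad x.2)).
  apply: (rweak_unique y4 e4 iy); apply: (ae_weak _ (im x.2)) => //.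
  by apply: ae_imp ae12 => t; rewrite /im => ->.
have bB := bform_damping dB.
have s g v g' g1 f : L2c g -> L2c v -> L2c g' -> L2c g1 -> L2c f -> eqL g' g1 -> B g v g' f = B g v g1 f.
  move=> Lg Lv Lg' Lg1 Lf E; rewrite (df_C dB) (bform_eq bB Lg' Lf Lg1 Lf Lg Lv E (eqL_refl f)).
  exact: (df_C dB).
rewrite /lift_form (s _ _ _ _ _ x3 x5 y3 e3 y5 r1) (s _ _ _ _ _ x4 x6 y4 e4 y6 r2).
have E phi : test_function phi ->
    ci (fun t => phi t * re y.2 t) = ci (fun t => derive1 (derive1 phi) t * re x.1 t)
      - ci (fun t => phi t * (W t * re x.2 t)) /\
    ci (fun t => phi t * im y.2 t) = ci (fun t => derive1 (derive1 phi) t * im x.1 t)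
      - ci (fun t => phi t * (W t * im x.2 t)).
  move=> tp; have := Heq phi tp; rewrite !cintegral_test => E.
  have aeE v : measurable_fun setT v ->
     ci (fun t => phi t * (W' t * v t)) = ci (fun t => phi t * (W t * v t)).
    move=> mv; apply: ci_ae; last by apply: ae_imp aeW => t ->.
      by apply: measurable_funM; [exact: test_meas|exact: measurable_funM].
    by apply: measurable_funM; [exact: test_meas|exact: measurable_funM].
  have eR : re (fun t => (W' t)%:C * x.2 t) = (fun t => W' t * re x.2 t).
    by apply/funext => t; rewrite /re; case: (x.2 t) => a b /=; rewrite mul0r subr0.
  have eI : im (fun t => (W' t)%:C * x.2 t) = (fun t => W' t * im x.2 t).
    by apply/funext => t; rewrite /im; case: (x.2 t) => a b /=; rewrite mul0r addr0.
  rewrite eR eI in E; have [_ m5 _] := x5; have [_ m6 _] := x6.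
  rewrite -aeE// -aeE//; split; first by have := congr1 (@complex.Re R) E.
  by have := congr1 (@complex.Im R) E.
rewrite mulrDr; apply: lerD.
- by apply: (@component_diss (re x.1)) => // phi tp; have [] := E phi tp.
- by apply: (@component_diss (im x.1)) => // phi tp; have [] := E phi tp.
Qed.

End damped.
End state_form.

(** * The damping coefficient and the theorem *)

Section damping_coefficient.
Context {R : realType}.
Local Notation mu := (@lebesgue_measure R).
Local Notation T := (@circumference R).
Implicit Types (f g h W : R -> R).

Lemma L1c_ae_le f g : per f -> measurable_fun setT f -> Cint g -> (forall x, 0 <= g x) ->
  {ae mu, forall x, circle x -> `|f x| <= g x} -> L1c f.
Proof.
move=> pf mf Ig g0 fg; split=> //; apply/integrableP; split.
  by apply/measurable_EFinP; exact: measurable_funTS.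
have /integrableP[mg foo] := Ig.
apply: le_lt_trans foo; apply: ae_ge0_le_integral => //.
- by apply: measurableT_comp => //; apply/measurable_EFinP; exact: measurable_funTS.
- exact: measurableT_comp.
- by apply: ae_imp fg => x H cx; rewrite /= lee_fin (ger0_norm (g0 x)) H.
Qed.

Lemma Linfty_L1c W : Linfty W -> L1c W.
Proof.
move=> [pW WL]; have mW : measurable_fun setT W by move: WL => /andP[]; rewrite inE.
have fW : finite_norm mu +oo%E W by move: WL => /andP[_]; rewrite inE.
move: fW; rewrite /finite_norm unlock.
have -> : (0 < mu [set: R])%E.
  apply: (@lt_le_trans _ _ (mu circle)); first by rewrite [X in (_ < X)%E]mu_circle lte_fin circumference_gt0.
  by apply: le_measure; rewrite ?inE//; exact: mcircle.
move=> lt; have ge := ess_sup_inf.ess_sup_ge mu (abse \o (EFin \o W)).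
have [M HM] : exists M : R, (ess_sup_inf.ess_sup mu (abse \o (EFin \o W)) <= M%:E)%E.
  move: lt; case: (ess_sup_inf.ess_sup _ _) => [r _|//|_]; first by exists r.
  by exists 0; rewrite leNye.
apply: (@L1c_ae_le _ (cst `|M|)) => //.
  exact: Cint_cst.
apply: ae_imp ge => x H _; have := le_trans H HM; rewrite /= lee_fin.
by move=> h; apply: le_trans h _; exact: ler_norm.
Qed.

Section profile.
Variables (beta sigma : R).
Hypotheses (b0 : -1 < beta < 0) (s0 : 0 < sigma < pi).

Definition half_profile (x : R) : R := \1_(`]sigma, +oo[%classic : set R) x * (x - sigma) `^ beta.

Let fpos x : 0 <= half_profile x.
Proof. by rewrite mulr_ge0 ?powR_ge0// indicE. Qed.

Let mhp : measurable_fun setT half_profile.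
Proof.
apply: measurable_funM; first by apply: measurable_indic.
by apply: (measurableT_comp (@measurable_powR R beta)); exact: measurable_funB.
Qed.

Let power_primitive (x : R) : R := (beta + 1)^-1 * (x - sigma) `^ (beta + 1).

Let d_power_primitive x : sigma < x -> is_derive x (1 : R) power_primitive ((x - sigma) `^ beta).
Proof.
move=> sx; have x0 : 0 < x - sigma by rewrite subr_gt0.
have d1 : is_derive x (1 : R) (fun y => y - sigma) 1.
  by have := is_deriveB (is_derive_id x 1) (is_derive_cst sigma x 1); rewrite subr0.
have d2 := @is_derive1_comp _ (fun y => y `^ (beta + 1)) (fun y => y - sigma) x _ _ (is_derive1_powR (beta + 1) x0) d1.
have := is_deriveM (is_derive_cst (beta + 1)^-1 x 1) d2.
move=> d3; apply: is_derive_eq d3 _.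
rewrite scaler0 addr0 mulr1 /GRing.scale/= mulrA mulVf ?mul1r; last by move: b0; lra.
by congr (_ `^ _); ring.
Qed.

(** The fundamental theorem of calculus away from the singularity; the bound is
    uniform because [beta > -1] makes the primitive nonnegative. *)
Let part_int n : (\int[mu]_(x in `[(sigma + (pi - sigma) / n.+2%:R)%R, pi]) (half_profile x)%:E <= (power_primitive pi)%:E)%E.
Proof.
have ps : 0 < pi - sigma by move: s0; lra.
have n2 : 1 < n.+2%:R :> R by rewrite ltr1n.
have d0 : 0 < (pi - sigma) / n.+2%:R by rewrite divr_gt0// ltr0n.
have ab : sigma + (pi - sigma) / n.+2%:R < pi.
  by rewrite -ltrBrDl ltr_pdivrMr ?ltr0n// ltr_pMr.
set a := sigma + _ in ab *.
have sa : sigma < a by rewrite /a ltrDl.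
have -> : (\int[mu]_(x in `[a, pi]) (half_profile x)%:E = \int[mu]_(x in `[a, pi]) ((fun y => (y - sigma) `^ beta) x)%:E)%E.
  apply: eq_integral => x; rewrite inE/= in_itv/= => /andP[ax _].
  by rewrite /half_profile indicE mem_set ?mul1r//= in_itv/= andbT (lt_le_trans sa ax).
have cpow y : sigma < y -> {for y, continuous (fun x => (x - sigma) `^ beta)}.
  move=> sy; have y0 : 0 < y - sigma by rewrite subr_gt0.
  have d1 : is_derive y (1 : R) (fun x => x - sigma) 1.
    by have := is_deriveB (is_derive_id y 1) (is_derive_cst sigma y 1); rewrite subr0.
  have [d2 _] := @is_derive1_comp _ (fun x => x `^ beta) (fun x => x - sigma) y _ _ (is_derive1_powR beta y0) d1.
  by apply: differentiable_continuous; exact/derivable1_diffP.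
have c_power_primitive y : sigma < y -> {for y, continuous power_primitive}.
  move=> sy; have [d _] := d_power_primitive sy.
  by apply: differentiable_continuous; exact/derivable1_diffP.
rewrite (@continuous_FTC2 _ _ power_primitive)//.
- by rewrite -EFinB lee_fin gerBl mulr_ge0 ?powR_ge0// invr_ge0; move: b0; lra.
- apply: continuous_in_subspaceT => y; rewrite inE/= in_itv/= => /andP[ay _].
  by apply: cpow; exact: lt_le_trans ay.
- split.
  + by move=> y; rewrite in_itv/= => /andP[ay _]; have [] := d_power_primitive (lt_trans sa ay).
  + by apply: cvg_at_right_filter; exact: c_power_primitive.
  + by apply: cvg_at_left_filter; apply: c_power_primitive; exact: lt_trans ab.
- move=> y; rewrite in_itv/= => /andP[ay _]; rewrite derive1E.
  by have [_ ->] := d_power_primitive (lt_trans sa ay).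
Qed.

(** Monotone convergence over intervals increasing to [(sigma, pi]]. *)
Lemma Cint_half_profile : Cint half_profile.
Proof.
pose F n : set R := `[sigma + (pi - sigma) / n.+2%:R, pi]%classic.
have ps : 0 < pi - sigma by move: s0; lra.
have mF n : measurable (F n : set (measurableTypeR R)) by exact: measurable_itv.
have ndF : nondecreasing_seq F.
  move=> m n mn; rewrite subsetEset => x; rewrite /F/= !in_itv/= => /andP[h1 ->]; rewrite andbT.
  by apply: le_trans h1; rewrite lerD2l ler_pM2l// lef_pV2 ?posrE ?ltr0n// ler_nat !ltnS.
have mE : measurable_fun setT (fun x => (half_profile x)%:E) by exact/measurable_EFinP.
have lim := @ge0_nondecreasing_set_cvg_integral _ (measurableTypeR R) R F (fun x => (half_profile x)%:E) mu
  ndF mF (fun n => measurable_funTS mE) (fun n x _ => fpos x).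
have bnd : (\int[mu]_(x in \bigcup_n F n) (half_profile x)%:E <= (power_primitive pi)%:E)%E.
  apply: (cvge_to_le lim); apply: nearW => n; exact: part_int.
apply/integrableP; split; first by apply/measurable_EFinP; exact: measurable_funTS.
apply: (@le_lt_trans _ _ (power_primitive pi)%:E); last exact: ltry.
apply: le_trans bnd.
have mU : measurable (\bigcup_n F n : set (measurableTypeR R)) by exact: bigcupT_measurable.
have -> : (\int[mu]_(x in circle) `|(EFin \o half_profile) x| = \int[mu]_(x in circle) (half_profile x)%:E)%E.
  by apply: eq_integral => x _; rewrite /= ger0_norm.
rewrite integral_mkcond [leRHS]integral_mkcond.
apply: ge0_le_integral => //.
- by move=> x _; rewrite patchE; case: ifP => // _; rewrite lee_fin.
- by apply/(measurable_restrictT _ _).1; [exact: mcircle|exact: measurable_funTS].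
- by apply/(measurable_restrictT _ _).1 => //; exact: measurable_funTS.
move=> x _; rewrite !patchE; case: ifPn => cx; last by case: ifP => // _; rewrite lee_fin.
case: ifPn => [//|xU]; rewrite lee_fin /half_profile indicE memNset ?mul0r// => /=.
rewrite in_itv/= andbT => sx; move: xU; rewrite notin_setE; apply.
move: cx; rewrite inE/circle/= in_itv/= => /andP[_ xp].
have xs : 0 < x - sigma by rewrite subr_gt0.
exists (Num.bound ((pi - sigma) / (x - sigma))) => //; rewrite /F/= in_itv/= (ltW xp) andbT.
rewrite -lerBrDl ler_pdivrMr ?ltr0n// mulrC -ler_pdivrMr//.
have := archi_boundP (divr_ge0 (ltW ps) (ltW xs)); move=> h.
by apply: ltW; apply: lt_le_trans h _; rewrite ler_nat -addn2 leq_addr.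
Qed.

Lemma Vprofile_ge0 x : 0 <= Vprofile beta sigma x.
Proof. by rewrite /Vprofile; case: ifP => // _; exact: powR_ge0. Qed.

Lemma Cint_Vprofile : Cint (Vprofile beta sigma).
Proof.
have [s1 s2] := andP s0.
have E : Vprofile beta sigma = fun x => half_profile x + half_profile (- x).
  have ray y : (y \in `]sigma, +oo[%classic) = (sigma < y).
    by apply/idP/idP; rewrite inE/= in_itv/= andbT.
  apply/funext => x; rewrite /Vprofile /half_profile !indicE !ray.
  case: (lerP 0 x) => x0; first rewrite (ger0_norm x0).
    by rewrite (ltNge sigma (- x)) (_ : - x <= sigma) ?mul0r ?addr0 ?ltNge; [case: ifP; rewrite ?mul0r ?mul1r|lra].
  rewrite (ltr0_norm x0) (ltNge sigma x) (_ : x <= sigma) ?mul0r ?add0r ?ltNge; [|lra].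
  by case: ifP; rewrite ?mul0r ?mul1r.
rewrite E; apply: CintD; first exact: Cint_half_profile.
have mN : measurable_fun setT (fun x : R => half_profile (- x)) by exact: measurableT_comp.
apply/integrableP; split; first by apply/measurable_EFinP; exact: measurable_funTS.
have /integrableP[_ foo] := Cint_half_profile.
apply: le_lt_trans foo; rewrite le_eqVlt; apply/orP; left; apply/eqP.
apply: (@ge0_circle_opp _ (fun x => `|(half_profile x)%:E|%E)) => //.
by apply: measurableT_comp => //; exact/measurable_EFinP.
Qed.

End profile.

Lemma poly_L1c beta theta W : -1 < beta < 0 -> poly_controlled beta theta W -> L1c W.
Proof.
move=> b0 [pW mW [C0 [sigma [C00 s0 H]]]].
have : L1c (fun x => W (theta + x)).
  apply: (@L1c_ae_le _ (fun x => C0 * Vprofile beta sigma x)).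
  - by move=> x; rewrite addrA; exact: pW.
  - exact: measurable_addl.
  - by apply: CintZ; exact: Cint_Vprofile.
  - by move=> x; rewrite mulr_ge0 ?Vprofile_ge0// ltW.
  - apply: ae_imp H => x H cx; have /andP[h1 h2] := H cx.
    rewrite ger0_norm//; apply: le_trans h1.
    by rewrite mulr_ge0 ?Vprofile_ge0// invr_ge0 ltW.
move=> /(L1c_shift (- theta)); congr L1c; apply/funext => x; congr W; ring.
Qed.

Lemma L1c_sum (n : nat) (Wj : 'I_n -> R -> R) : (forall j, L1c (Wj j)) ->
  L1c (fun x => \sum_(j < n) Wj j x).
Proof.
elim: n Wj => [|n IH] Wj H.
  rewrite (_ : (fun x => _) = cst 0); first by apply: L2_L1; exact: L2c_cst.
  by apply/funext => x; rewrite big_ord0.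
rewrite (_ : (fun x => _) = fun x => \sum_(j < n) Wj (widen_ord (leqnSn n) j) x + Wj ord_max x).
  by apply: L1cD => //; exact: IH.
by apply/funext => x; rewrite big_ord_recr.
Qed.

Lemma ae_period W : per W -> measurable_fun setT W -> {ae mu, forall x, circle x -> W x = 0} ->
  {ae mu, forall x, W x = 0}.
Proof.
move=> pW mW H; have T0 := @circumference_gt0 R.
have mA : measurable_fun setT (fun x => `|(W x)%:E|%E).
  by apply: measurableT_comp => //; exact/measurable_EFinP.
have z0 : (\int[mu]_(x in circle) `|(W x)%:E| = 0)%E.
  apply/(ae_eq_integral_abs mu mcircle _).2.
    by apply/measurable_EFinP; exact: measurable_funTS.
  by apply: ae_imp H => x H cx; rewrite /= H.
have za (a : R) : mu.-negligible [set x | a <= x < a + T /\ W x != 0].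
  have : (\int[mu]_(x in `[a, (a + T)%R[) `|(W x)%:E| = 0)%E.
    by rewrite (@ge0_integral_period _ _ mA) // => x; rewrite pW.
  move/(ae_eq_integral_abs mu (measurable_itvco a (a + T)) _).1 => /(_ ltac:(by apply/measurable_EFinP; exact: measurable_funTS)).
  apply: negligibleS => x [] xa /eqP nz /= h; apply: nz.
  by apply: EFin_inj; apply: h; rewrite in_itv.
have N1 : mu.-negligible (\bigcup_(n in setT) [set x | n%:R * T <= x < n%:R * T + T /\ W x != 0]).
  by apply: negligible_bigcup => n; exact: za.
have N2 : mu.-negligible (\bigcup_(n in setT) [set x | - (n%:R * T) <= x < - (n%:R * T) + T /\ W x != 0]).
  by apply: negligible_bigcup => n; exact: za.
apply: negligibleS (negligibleU N1 N2) => x /= /eqP nz.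
pose k := Num.floor (x / T).
have /andP[h1 h2] := floor_itv (x / T); rewrite -/k in h1 h2.
move: h1 h2; rewrite ler_pdivlMr// ltr_pdivrMr// intrD mulrDl mul1r.
case: k => n h1 h2; [left|right].
  by exists n => //; split=> //; apply/andP.
exists n.+1 => //; split=> //; move: h1 h2; rewrite NegzE mulrNz mulNr => h1 h2.
by apply/andP.
Qed.

(** A superlevel set of [W] has positive measure; around one of its points of
    density it fills three quarters of a small interval. *)
Lemma exists_region W : L1c W -> (forall x, 0 <= W x) -> ~ {ae mu, forall x, W x = 0} ->
  exists (om : set R) (eps x0 l : R), [/\ measurable (om : set (measurableTypeR R)), om `<=` circle,
    0 < eps, (forall x, om x -> eps <= W x) &
    [/\ 0 < l, om `<=` `]x0 - l, x0 + l[%classic & ((l * (3 / 2))%:E <= mu om)%E]].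
Proof.
move=> [pW mW _] W0 nz.
pose E n : set R := circle `&` [set x | n.+1%:R^-1 <= W x].
have mE n : measurable (E n : set (measurableTypeR R)).
  apply: measurableI; first exact: mcircle.
  rewrite (_ : [set x | _] = W @^-1` `[n.+1%:R^-1, +oo[%classic).
    by rewrite -[X in measurable X]setTI; apply: mW => //; exact: measurable_itv.
  by apply/seteqP; split=> x /=; rewrite in_itv/= andbT.
have [n En] : exists n, (0 < mu (E n))%E.
  apply: contrapT => H; apply: nz; apply: ae_period => //.
  have N n : mu.-negligible (E n).
    apply/negligibleP; first exact: mE.
    by apply/eqP; rewrite eq_le measure_ge0 andbT leNgt; apply/negP => h; apply: H; exists n.
  apply: negligibleS (negligible_bigcup N) => x /= /not_implyP[cx /eqP xnz].
  have x0 : 0 < W x by rewrite lt_neqAle eq_sym xnz W0.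
  exists (Num.bound (W x)^-1) => //; split=> //=.
  rewrite -[leRHS]invrK lef_pV2 ?posrE ?invr_gt0 ?ltr0n//.
  have := archi_boundP (ltW (_ : 0 < (W x)^-1)); rewrite invr_gt0 => /(_ x0) h.
  by apply: ltW; apply: lt_le_trans h _; rewrite ler_nat.
have [x0 [Ex0 dens]] : exists x0 : R, E n x0 /\ (mu (E n `&` ball x0 r) * (mu (ball x0 r))^-1 @[r --> 0^'+] --> (\1_(E n) x0)%:E)%E.
  apply: contrapT => H; have [N [mN N0 HN]] := lebesgue_density (mE n).
  have : (mu (E n) <= mu N)%E.
    apply: le_measure; rewrite ?inE// => x Ex; apply: HN => /= dx; apply: H; exists x; split=> //.
  by rewrite leNgt N0 En.
have i1 : \1_(E n) x0 = 1 :> R by rewrite indicE mem_set.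
rewrite i1 in dens.
have q : 3 / 4 < 1 :> R by lra.
have nb := @nbhs_open_ereal_gt R 1 (fun=> 3 / 4) q.
have [d /= d0 Hd] := dens _ nb.
pose l := d / 2; have l0 : 0 < l by rewrite divr_gt0.
have /= key := Hd l ltac:(by rewrite /= sub0r normrN gtr0_norm// /l; lra) l0.
exists (E n `&` ball x0 l), n.+1%:R^-1, x0, l; split.
- by apply: measurableI => //; rewrite ball_itv; exact: measurable_itv.
- by move=> x [[]].
- by rewrite invr_gt0 ltr0n.
- by move=> x [[]].
split=> //; first by move=> x [_]; rewrite ball_itv.
move: key; rewrite (lebesgue_measure_ball _ (ltW l0)) inver gt_eqF; last by rewrite mulrn_wgt0.
have fin : (mu (E n `&` ball x0 l) < +oo)%E.
  apply: (@le_lt_trans _ _ (mu circle)); last by rewrite [X in (X < _)%E]mu_circle ltry.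
  apply: le_measure; rewrite ?inE//; last by move=> x [[]].
  by apply: measurableI => //; rewrite ball_itv; exact: measurable_itv.
have -> : mu (E n `&` ball x0 l) = (fine (mu (E n `&` ball x0 l)))%:E by rewrite fineK// ge0_fin_numE.
rewrite -EFinM lte_fin lee_fin ltr_pdivlMr ?mulrn_wgt0// => h.
by apply: ltW; apply: le_lt_trans h; rewrite -mulr_natl; lra.
Qed.

End damping_coefficient.

Theorem theorem5 (R : realType) (n : nat) (n_ge1 : (1 <= n)%N)
    (Wj : 'I_n -> R -> R)
    (Wj_class : forall j : 'I_n, Linfty (Wj j) \/
       exists beta theta : R, -1 < beta < 0 /\ poly_controlled beta theta (Wj j))
    (W : R -> R) (W_sum : forall x, W x = \sum_(j < n) Wj j x)
    (W_ge0 : {ae @lebesgue_measure R, forall x, 0 <= W x})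
    (W_neq0 : ~ {ae @lebesgue_measure R, forall x, W x = 0}) :
  exists C c : R, [/\ 0 < C, 0 < c &
    forall S : R -> @state R -> @state R,
      generates phase_space phase_norm (damped_wave_op W) S ->
      forall (t : R) (u0 u1 : R -> R[i]), 0 <= t -> H1 u0 -> L2 u1 ->
        energy (S t (u0, u1)) <= C * expR (- (c * t)) * energy (u0, u1)].
Proof.
have LW : L1c W.
  rewrite (_ : W = fun x => \sum_(j < n) Wj j x); last exact/funext.
  apply: L1c_sum => j; case: (Wj_class j) => [|[beta [theta [b0 Hp]]]]; first exact: Linfty_L1c.
  exact: poly_L1c Hp.
(* A representative which is nonnegative everywhere and not only almost
   everywhere; the generator does not see the difference. *)
pose W' x := `|W x|.
have LW' : L1c W' := L1c_abs LW.
have W'0 x : 0 <= W' x by exact: normr_ge0.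
have aeW : {ae @lebesgue_measure R, forall x, W x = W' x}.
  by apply: ae_imp W_ge0 => x H; rewrite /W' ger0_norm.
have nz : ~ {ae @lebesgue_measure R, forall x, W' x = 0}.
  move=> H; apply: W_neq0; apply: ae_imp H => x /eqP.
  by rewrite normr_eq0 => /eqP.
have [om [eps [x0 [l [mom omc eps0 Weps [l0 oml lom]]]]]] := exists_region LW' W'0 nz.
have o0 : 0 < osize om.
  rewrite -lte_fin -(osizeE mom omc); apply: lt_le_trans lom; rewrite lte_fin; lra.
have [gam gam0 Hgap] := correlation_gap mom omc l0 oml lom.
have [B [Kb [k [k0 dB]]]] := exists_damping_form LW' W'0 mom omc eps0 Weps o0 gam0 Hgap.
have Kb0 := df_K dB.
exists (Kb + 1), (2 * k); split; [lra|lra|].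
move=> S [HS gA] t u0 u1 t0 Hu0 Lu1.
have X0 : phase_space ((u0, u1) : @state R) by split.
have Xt : phase_space (S t (u0, u1)) by exact: (semigroup_stable HS).
have mW : measurable_fun setT W by case: LW.
have diss x y : phase_space x -> phase_space y -> damped_wave_op W x y ->
    lift_form B x y <= - k * lift_form B x x.
  by move=> Xx Xy; exact: (state_diss LW' dB mW aeW Xx Xy).
have := lyapunov_decay seminormed_phase HS seq_complete_phase (lyapunov_lift dB) (ltW k0) gA diss t0 X0.
move=> D; rewrite !energyE//.
have h1 := cen_le_lift dB Xt; have h2 := lift_le_cen dB X0.
have e0 := expR_ge0 (- (2 * k * t)).
have h3 : lift_form B (S t (u0, u1)) (S t (u0, u1)) <= expR (- (2 * k * t)) * ((Kb + 1) * cen (u0, u1)).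
  apply: le_trans D _; rewrite ler_wpM2l//; apply: le_trans h2 _.
  by rewrite ler_wpM2r ?cen_ge0// lerDl.
rewrite mulrCA ler_wpM2l ?invr_ge0//; apply: le_trans h1 _; apply: le_trans h3 _.
by rewrite mulrCA mulrA.
Qed.
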